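(* Let $G$ be a connected, locally finite, unimodular transitive graph with edge set $E$, let $\omega\in\{0,1\}^E$ be a random subgraph of $G$ whose law is automorphism-invariant and insertion-tolerant, and let $(Z_n)_{n\geq 0}$ be a simple random walk on $G$ independent of $\omega$. If $\omega$ has infinitely many infinite clusters almost surely, then $Z$ visits each cluster of $\omega$ at most finitely many times almost surely.
   Context: A transitive graph $G$ is unimodular if there is a subgroup $\Gamma\subseteq\operatorname{Aut}(G)$ acting transitively on vertices with $|\operatorname{Stab}_v u|=|\operatorname{Stab}_u v|$ for all vertices $u,v$, where $\operatorname{Stab}_x y$ denotes the orbit of $y$ under the stabilizer of $x$ in $\Gamma$. A random subgraph $\omega$ is insertion-tolerant if the law of $\omega\cup F$ is absolutely continuous with respect to the law of $\omega$ for each finite set of edges $F$. Clusters of $\omega$ are the connected components of the subgraph of $G$ formed by all vertices and the edges $e$ with $\omega(e)=1$. The simple random walk is started from a fixed vertex. *)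

(* Defs.v *)
From Stdlib Require Export Relation_Operators.
From HB Require Export structures.
From mathcomp Require Export all_boot all_order all_algebra finmap.
From mathcomp Require Export all_classical all_reals all_analysis.

Set Implicit Arguments.
Unset Strict Implicit.
Unset Printing Implicit Defensive.

Import Order.TTheory GRing.Theory Num.Theory.

Local Open Scope classical_set_scope.
Local Open Scope ring_scope.

(* A [pointedType] is just a nonempty set of vertices; [pointedType] is what
   the measurable structure on the trajectory space [nat -> V] requires. *)
Record sgraph (V : pointedType) := SGraph {
  adj : rel V ;
  adj_sym : symmetric adj ;
  adj_irr : irreflexive adj }.

Section Graph.
Variables (V : pointedType) (G : sgraph V).

Definition connected_graph :=
  forall u v : V, clos_refl_trans V (fun x y => adj G x y) u v.

Definition locally_finite := forall u : V, finite_set [set v | adj G u v].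

Definition degree (u : V) : nat := #|` fset_set [set v | adj G u v] |%fset.

Definition aut : set (V -> V) :=
  [set f | bijective f /\ forall u v, adj G (f u) (f v) = adj G u v].

Definition transitive_on_vertices (Gam : set (V -> V)) :=
  forall u v, exists2 f, Gam f & f u = v.

Definition transitive_graph := transitive_on_vertices aut.

Definition aut_subgroup (Gam : set (V -> V)) :=
  [/\ Gam `<=` aut,
      Gam id,
      forall f g, Gam f -> Gam g -> Gam (f \o g) &
      forall f, Gam f -> exists g, [/\ Gam g, cancel f g & cancel g f]].

Definition stab_orbit (Gam : set (V -> V)) (x y : V) : set V :=
  [set f y | f in Gam `&` [set f | f x = x]].

Definition unimodular :=
  exists Gam : set (V -> V),
    [/\ aut_subgroup Gam, transitive_on_vertices Gam &
        forall u v, (stab_orbit Gam v u #= stab_orbit Gam u v)%card].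

Definition is_edge (s : set V) := exists u v, adj G u v /\ s = [set u; v].

Definition edge := {s : set V | is_edge s}.

Lemma is_edge_image (f : V -> V) (s : set V) :
  aut f -> is_edge s -> is_edge (f @` s).
Proof.
move=> [_ fG] [u [v [uv ->]]]; exists (f u), (f v); split; first by rewrite fG.
by rewrite image_setU !image_set1.
Qed.

Definition edge_map (f : V -> V) (fA : aut f) (e : edge) : edge :=
  exist is_edge (f @` sval e) (is_edge_image fA (svalP e)).

Definition open_adj (w : edge -> bool) (u v : V) :=
  exists2 e : edge, sval e = [set u; v] & w e.

Definition cluster_of (w : edge -> bool) (v : V) : set V :=
  [set u | clos_refl_trans V (open_adj w) v u].

Definition clusters (w : edge -> bool) : set (set V) := range (cluster_of w).

Definition infinitely_many_infinite_clusters (w : edge -> bool) :=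
  infinite_set [set C | clusters w C /\ infinite_set C].

Definition insert_edges (F : set edge) (w : edge -> bool) : edge -> bool :=
  fun e => w e || `[< F e >].

(* The translate of [w] by the inverse of [f]: invariance under all of these is
   invariance under the whole group of automorphisms. *)
Definition translate (f : V -> V) (fA : aut f) (w : edge -> bool) :
  edge -> bool := fun e => w (edge_map fA e).

End Graph.

(* Generators of the product sigma-algebra on [I -> T], with [T] discrete. *)
Definition cylinders (I T : Type) : set (set (I -> T)) :=
  [set C | exists (i : I) (U : set T), C = [set f | U (f i)]].

Notation product_space I T := (g_sigma_algebraType (@cylinders I T)).

Notation config G := (product_space (edge G) bool).

Notation trajectory V := (product_space nat V).

Section RandomSubgraph.
Variables (R : realType) (V : pointedType) (G : sgraph V).

Definition automorphism_invariant (mu : set (config G) -> \bar R) :=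
  forall (f : V -> V) (fA : aut G f) (A : set (config G)),
    measurable A ->
    pushforward mu (translate fA : config G -> config G) A = mu A.

Definition insertion_tolerant (mu : set (config G) -> \bar R) :=
  forall F : set (edge G), finite_set F ->
    pushforward mu (insert_edges F : config G -> config G) `<< mu.

End RandomSubgraph.

Section RandomWalk.
Variables (R : realType) (d : measure_display) (Omega : measurableType d).
Variables (P : probability Omega R) (V : pointedType) (G : sgraph V).

Definition srw_step (u v : V) : R := if adj G u v then (degree G u)%:R^-1 else 0.

Definition follows (Z : Omega -> nat -> V) (p : nat -> V) (n : nat) :
  set Omega := [set x | forall i, (i <= n)%N -> Z x i = p i].

Definition simple_random_walk (o : V) (Z : Omega -> nat -> V) :=
  P [set x | Z x 0%N = o] = 1%E /\
  forall (p : nat -> V) (n : nat),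
    P (follows Z p n.+1) =
      (P (follows Z p n) * (srw_step (p n) (p n.+1))%:E)%E.

End RandomWalk.

Definition independent_rv (R : realType) (d d1 d2 : measure_display)
    (Omega : measurableType d) (T1 : measurableType d1)
    (T2 : measurableType d2) (P : probability Omega R)
    (X : Omega -> T1) (Y : Omega -> T2) :=
  forall (A : set T1) (B : set T2), measurable A -> measurable B ->
    P (X @^-1` A `&` Y @^-1` B) = (P (X @^-1` A) * P (Y @^-1` B))%E.

(* Main.v *)
From Stdlib Require Import Operators_Properties.
Require Import Defs.
From mathcomp Require Import measurable_realfun.
From mathcomp Require Import zify lra.

Set Implicit Arguments.
Unset Strict Implicit.
Unset Printing Implicit Defensive.

Import Order.TTheory GRing.Theory Num.Theory.
Import numFieldNormedType.Exports.

Local Open Scope classical_set_scope.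
Local Open Scope ring_scope.

(** Call a set of vertices small if the simple random walk, from every starting
    point, almost surely visits it finitely often. Since the walk is independent
    of the configuration, it is enough to show that almost surely all clusters
    are small ([clusters_small]); [pr_finite_visits] translates this back to
    the walk of the statement.

    A zero-one law comes first. In its cluster let a vertex [u] send to [v] a mass
    proportional to the probability that the walk never returns to the cluster
    from [u], the expected number of passages from [u] to [v], and the probability
    of infinitely many visits from [v]. What is received is bounded by [1], because
    it counts last visits; what is sent is infinite where both probabilities are
    positive. By mass transport on the unimodular graph and the maximum
    principle, almost surely each cluster is small or recurrent, that is hit
    almost surely from everywhere, even by the walk observed at the multiples of
    an odd number ([nonsmall_recurrent_as]).

    As there are infinitely many infinite clusters, three of them meet some ball
    with positive probability. By insertion tolerance the ball may be opened, and
    becomes a trifurcation: removing some of its edges leaves three infinite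
    branches. Seen from a finite set [S], there are at most [D * size S]
    trifurcations ([size_trif], Burton and Keane); as their density is positive,
    finite sets have large boundaries ([isoperimetric]). By the inequality of
    Cheeger the Green function is finite and the walk never returns to its
    starting point with a probability bounded below ([escape_pos]).

    Assume now that some cluster is not small, hence recurrent, with positive
    probability. There are two cases.

    Suppose three recurrent clusters coexist with positive probability. Opening
    a ball creates trifurcations with recurrent branches. A walk of [n] steps
    visits of the order of [n] distinct vertices, a positive fraction of them
    trifurcations. Being recurrent, their branches are hit at times divisible by
    a large odd [M], so that most of these trifurcations are seen from the
    [n / M] vertices occupied at these times. For [M] large this contradicts the
    count of trifurcations ([no_recurrent_trifurcations]).

    Otherwise a non-small cluster coexists with two infinite small ones, and
    opening a ball produces a furcation: a ball in a non-small cluster that cuts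
    off at least two infinite small branches. Furcations are ordered by lying in a
    small branch of each other, which forms a forest. Give to the pair of a
    furcation [x] and of a vertex [u] below it the weight [l ^+ k], where [k] is
    the number of furcations between them and [l] is slightly less than [1]. A
    vertex sees few furcations of each depth, so the total weight above it is
    bounded; as each furcation has at least two branches, the total weight below
    it is infinite ([weight_unbounded]). Mass transport excludes this
    ([pr_furcation]). *)

(** * Counting compatible tripartitions *)

Section CompatibleTripartitions.
Variables (V : choiceType) (T U : Type) (k : V -> U) (lab : V -> V -> T).

(** Read [lab x s] as the part in which [x] sees [s] inside the class [k x].
    Compatibility is the geometric fact about separators: whatever [x] separates
    from [y] is seen by [y] on the same side as [x]. *)
Definition compatible (X S : seq V) := forall x y s,
  x \in X -> y \in X -> s \in S ++ X -> x != y -> k y = k x -> k s = k x ->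
  lab x s <> lab x y -> lab y s = lab y x.

Definition three_labels (S : seq V) (x : V) := exists c1 c2 c3,
  [/\ c1 \in S, c2 \in S & c3 \in S] /\
  [/\ k c1 = k x, k c2 = k x & k c3 = k x] /\
  [/\ lab x c1 <> lab x c2, lab x c1 <> lab x c3 & lab x c2 <> lab x c3].

(** Seen from a point [x] whose part containing a reference point [x0] holds as
    many points of [X] as possible, no other point can lie outside that part:
    such a point would see [x] together with everything [x] sees with [x0]. *)
Lemma extremal_point (X S : seq V) (x0 : V) : x0 \in X -> compatible X S ->
  exists2 x, x \in X & exists t, forall y, y \in X -> y != x -> k y = k x ->
    lab x y = t.
Proof.
move=> x0X cX.
pose cand x := [&& x \in X, x != x0 & `[< k x = k x0 >]].
(* [f x] counts the points seen by [x] together with [x0]; [m] is its maximum. *)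
pose f x := count (fun z => (z != x) && `[< k z = k x0 /\ lab x z = lab x x0 >]) X.
pose Q m := `[< exists x, cand x /\ f x = m >].
have [/hasP[x1 x1X x1c]|/hasPn noc] := boolP (has cand X); last first.
  exists x0 => //; exists (lab x0 x0) => y yX yx0 kyx0.
  by have := noc y yX; rewrite /cand yX yx0 /= asboolT.
have exQ : exists m, Q m by exists (f x1); apply/asboolP; exists x1.
have bQ m : Q m -> (m <= size X)%N.
  by move=> /asboolP[x [_ <-]]; exact: count_size.
case: (ex_maxnP exQ bQ) => m /asboolP[x [/and3P[xX xx0 /asboolP kx]] fxm mmax].
exists x => //; exists (lab x x0) => y yX yx kyx.
apply: contrapT => lxy.
have yx0 : y != x0 by apply/eqP => yx0; apply: lxy; rewrite yx0.
have : (f y <= m)%N.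
  apply: mmax; apply/asboolP; exists y; split => //.
  by rewrite /cand yX yx0 /=; apply/asboolP; rewrite kyx.
rewrite -fxm leqNgt => /negP; apply.
have inX z : z \in X -> z \in S ++ X by move=> zX; rewrite mem_cat zX orbT.
have xny : x != y by rewrite eq_sym.
have lx0 : lab y x0 = lab y x.
  by apply: (cX x y x0) => //; [exact: inX | by move=> h; apply: lxy].
pose g z := ((z != x) && `[< k z = k x0 /\ lab x z = lab x x0 >]) || (z == x).
have -> : (f x).+1 = ((f x) + 1)%N by rewrite addn1.
have x1c' : (1 <= count_mem x X)%N by rewrite -has_count has_pred1.
apply: leq_trans (leq_add (leqnn _) x1c') _.
rewrite /f -count_predUI.
rewrite (_ : count (predI _ _) X = 0%N) ?addn0; last first.
  by apply/eqP; rewrite -leqn0 leqNgt -has_count; apply/hasPn => z zX /=; case: (z == x); rewrite ?andbF.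
rewrite (@eq_in_count _ _ (predI g (mem X))); last by move=> z /= ->; rewrite andbT.
apply: sub_count => z /= /andP[/orP[/andP[zx /asboolP[kz lz]]|/eqP ->] zX].
  have zy : z != y by apply/eqP => zy; apply: lxy; rewrite -zy.
  rewrite zy /=; apply/asboolP; split=> //; rewrite lx0.
  apply: (cX x y z) => //; [exact: inX | by rewrite kz | move=> h].
  by apply: lxy; rewrite -h.
by rewrite xny /=; apply/asboolP; split => //; rewrite lx0.
Qed.

(** The Burton--Keane count. At an extremal point, discard the point together
    with one of its parts that meets [S] but not [X]; another such part stays
    and stands in for the discarded one as seen from the remaining points. *)
Lemma size_tripartitions (X S : seq V) : uniq X -> compatible X S ->
  (forall x, x \in X -> three_labels S x) -> (size X <= size S)%N.
Proof.
have [n] := ubnP (size X); elim: n X S => // n IH [|x0 X0] S // sX uX cX lX.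
set X := x0 :: X0 in sX uX cX lX *.
have [x xX [t tx]] := @extremal_point X S x0 (mem_head _ _) cX.
have [l [l' [[c [cS kc lc]] [c' [c'S kc' lc']] lt l't]]] : exists l l',
  [/\ (exists c, [/\ c \in S, k c = k x & lab x c = l]),
      (exists c, [/\ c \in S, k c = k x & lab x c = l']),
      l <> t & l' <> t /\ l <> l'].
  have [c1 [c2 [c3 [[s1 s2 s3] [[k1 k2 k3] [n12 n13 n23]]]]]] := lX x xX.
  have [e1|e1] := pselect (lab x c1 = t).
    exists (lab x c2), (lab x c3); split; [by exists c2|by exists c3|congruence|].
    by split; congruence.
  have [e2|e2] := pselect (lab x c2 = t).
    exists (lab x c1), (lab x c3); split; [by exists c1|by exists c3|congruence|].
    by split; congruence.
  by exists (lab x c1), (lab x c2); split; [exists c1|exists c2| |split].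
pose W s := `[< k s = k x /\ lab x s = l >].
pose S' := [seq s <- S | ~~ W s]; pose X' := rem x X.
have mX' y : (y \in X') = (y != x) && (y \in X) by rewrite mem_rem_uniq.
have sS' : (size S' < size S)%N.
  rewrite size_filter ltnNge; apply/negP => h.
  have /eqP : count (fun s => ~~ W s) S = size S.
    by apply/eqP; rewrite eqn_leq count_size h.
  rewrite -all_count => /allP/(_ c cS)/negP; apply; exact/asboolP.
have sX' : size X' = (size X).-1 by rewrite size_rem.
have Xp : (0 < size X)%N by [].
rewrite -(prednK Xp) -sX'; apply: leq_ltn_trans sS'.
apply: IH; first by rewrite sX'; move: sX; lia.
- exact: rem_uniq.
- move=> y z s; rewrite !mX' => /andP[_ yX] /andP[_ zX] sin; apply: cX => //.
  by move: sin; rewrite !mem_cat mem_filter mX' => /orP[/andP[_ ->]|/andP[_ ->]]; rewrite ?orbT.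
move=> y; rewrite mX' => /andP[yx yX].
have lyW s : W s -> k y = k x -> s \in S -> lab y s = lab y x.
  move=> /asboolP[ks ls] ky sS; apply: (cX x y s) => //.
  - by rewrite mem_cat sS.
  - by rewrite eq_sym.
  - by rewrite ls (tx y).
(* The label [l] is removed from [S]; [c'], seen by [x] in another part free of
   [X], replaces it. *)
have sub s : s \in S -> k s = k y -> exists s', [/\ s' \in S', k s' = k y & lab y s' = lab y s].
  move=> sS ks; have [Ws|Ws] := boolP (W s); last by exists s; rewrite mem_filter Ws sS.
  have ky : k y = k x by rewrite -ks; case/asboolP: Ws.
  exists c'; rewrite mem_filter c'S andbT; split.
  - by apply/negP => /asboolP[_]; rewrite lc'; case: l't => _ h /esym.
  - by rewrite kc' ky.
  - rewrite (lyW s) //; apply: (cX x y c') => //; rewrite ?mem_cat ?c'S //.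
      by rewrite eq_sym.
    by rewrite lc' (tx y) //; case: l't.
have [c1 [c2 [c3 [[s1 s2 s3] [[k1 k2 k3] [n12 n13 n23]]]]]] := lX y yX.
have [d1 [? ? e1]] := sub c1 s1 k1.
have [d2 [? ? e2]] := sub c2 s2 k2.
have [d3 [? ? e3]] := sub c3 s3 k3.
by exists d1, d2, d3; rewrite e1 e2 e3; do !split.
Qed.

End CompatibleTripartitions.

(** * Balls and automorphisms *)

Section Balls.
Variables (V : pointedType) (G : sgraph V).
Hypothesis Glf : locally_finite G.

Definition nbr (u : V) : seq V := fset_set [set v | adj G u v].

Lemma mem_nbr u v : (v \in nbr u) = adj G u v.
Proof.
rewrite /nbr in_fset_set //; apply/idP/idP; rewrite inE //.
Qed.

Lemma nbr_uniq u : uniq (nbr u). Proof. exact: fset_uniq. Qed.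

Lemma size_nbr u : size (nbr u) = degree G u. Proof. by []. Qed.

Fixpoint ball (n : nat) (u : V) : seq V :=
  if n is m.+1 then u :: flatten [seq ball m v | v <- nbr u] else [:: u].

Lemma ball_center n u : u \in ball n u.
Proof. by case: n => [|n] /=; rewrite mem_head. Qed.

Lemma ballSP n u v :
  reflect (v = u \/ exists2 x, adj G u x & v \in ball n x) (v \in ball n.+1 u).
Proof.
rewrite /= in_cons; apply: (iffP orP) => [[/eqP ->|/flatten_mapP[x]]|[->|[x ux vx]]].
- by left.
- by rewrite mem_nbr => ux vx; right; exists x.
- by left.
- by right; apply/flatten_mapP; exists x; rewrite ?mem_nbr.
Qed.

Lemma ball_leS n u v : v \in ball n u -> v \in ball n.+1 u.
Proof.
elim: n u => [|n IH] u; first by rewrite inE => /eqP ->; exact: ball_center.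
by case/ballSP => [->|[x ux vx]]; apply/ballSP; [left|right; exists x => //; exact: IH].
Qed.

Lemma ball_le m n u v : (m <= n)%N -> v \in ball m u -> v \in ball n u.
Proof. by move=> /subnK <-; elim: (n - m)%N => // k IH /IH; rewrite addSn; exact: ball_leS. Qed.

Lemma ball_trans m n u v x :
  v \in ball m u -> x \in ball n v -> x \in ball (m + n) u.
Proof.
elim: m u => [|m IH] u; first by rewrite inE => /eqP ->.
case/ballSP => [->|[y uy vy]] xv; first by apply: ball_le xv; rewrite leq_addl.
by rewrite addSn; apply/ballSP; right; exists y => //; exact: IH.
Qed.

Lemma ball_adj u v : adj G u v -> v \in ball 1 u.
Proof. by move=> uv; apply/ballSP; right; exists v; rewrite ?ball_center. Qed.

Lemma ball_sym n u v : (v \in ball n u) = (u \in ball n v).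
Proof.
suff H k x y : y \in ball k x -> x \in ball k y by apply/idP/idP; exact: H.
elim: k x y => [|k IH] x y; first by rewrite !inE eq_sym.
case/ballSP => [->|[z xz /IH]]; first exact: ball_center.
by move=> zy; rewrite -addn1; apply: ball_trans zy _; apply: ball_adj; rewrite adj_sym.
Qed.

Lemma ball_connected : connected_graph G -> forall u v, exists n, v \in ball n u.
Proof.
move=> Gc u v; elim: (Gc u v) => [x y xy|x|x y z _ [m xy] _ [n yz]].
- by exists 1%N; exact: ball_adj.
- by exists 0%N; exact: ball_center.
- by exists (m + n)%N; exact: ball_trans xy yz.
Qed.

Lemma seq_in_ball : connected_graph G -> forall u (s : seq V), exists n, {subset s <= ball n u}.
Proof.
move=> Gc u; elim=> [|x s [N hN]]; first by exists 0%N.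
have [m xm] := ball_connected Gc u x; exists (maxn m N) => v.
rewrite inE => /orP[/eqP ->|/hN vN]; first exact: ball_le (leq_maxl m N) xm.
exact: ball_le (leq_maxr m N) vN.
Qed.

(** An enumeration of the vertices by pairs (radius, position in the ball); it is
    what makes quantifiers over vertices countable. *)
Definition enumV (o : V) (n : nat) : V :=
  if (@choice.unpickle (nat * nat)%type n) is Some (a, b) then nth o (ball a o) b else o.

Lemma enumV_surj (o : V) : connected_graph G -> forall v, exists n, enumV o n = v.
Proof.
move=> Gc v; have [n vn] := ball_connected Gc o v.
exists (choice.pickle (n, index v (ball n o))).
by rewrite /enumV choice.pickleK nth_index.
Qed.

Lemma aut_adj f u v : aut G f -> adj G (f u) (f v) = adj G u v.
Proof. by case=> _ ->. Qed.

Lemma aut_inv f : aut G f -> exists g, [/\ aut G g, cancel f g & cancel g f].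
Proof.
move=> [[g fg gf] fa]; exists g; split=> //; split; first by exists f.
by move=> u v; rewrite -fa !gf.
Qed.

Lemma aut_inj f : aut G f -> injective f.
Proof. by move=> [/bij_inj]. Qed.

Lemma nbr_aut f u : aut G f -> perm_eq (nbr (f u)) (map f (nbr u)).
Proof.
move=> fA; apply: uniq_perm; rewrite ?nbr_uniq ?map_inj_uniq ?nbr_uniq//.
  exact: aut_inj.
move=> v; rewrite mem_nbr; have [g [gA fg gf]] := aut_inv fA.
apply/idP/mapP => [h|[x]].
  by exists (g v); rewrite ?gf // mem_nbr -(aut_adj _ _ fA) gf.
by rewrite mem_nbr => ux ->; rewrite aut_adj.
Qed.

Lemma degree_aut f u : aut G f -> degree G (f u) = degree G u.
Proof. by move=> /(nbr_aut u)/perm_size; rewrite size_map !size_nbr. Qed.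

Lemma degree_const : transitive_graph G -> forall u v, degree G u = degree G v.
Proof. by move=> Gt u v; have [f fA <-] := Gt v u; rewrite degree_aut. Qed.

Lemma ball_aut f n u v : aut G f -> (f v \in ball n (f u)) = (v \in ball n u).
Proof.
move=> fA; suff H f' x y k : aut G f' -> y \in ball k x -> f' y \in ball k (f' x).
  have [g [gA fg gf]] := aut_inv fA.
  by apply/idP/idP => [/(H g)|]; rewrite ?fg; [exact|exact: H].
move=> {}fA; elim: k x y => [|k IH] x y; first by rewrite !inE => /eqP ->.
case/ballSP => [->|[z xz /IH yz]]; first exact: ball_center.
by apply/ballSP; right; exists (f' z); rewrite ?aut_adj.
Qed.

Lemma size_ball : transitive_graph G ->
  forall o n u, (size (ball n u) <= (degree G o).+1 ^ n)%N.
Proof.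
move=> Gt o; elim=> [|n IH] u //=; rewrite size_flatten /shape -map_comp.
have : (sumn [seq size (ball n v) | v <- nbr u] <= size (nbr u) * (degree G o).+1 ^ n)%N.
  by elim: (nbr u) => //= v s IHs; rewrite mulSn leq_add.
rewrite size_nbr (degree_const Gt u o) => h.
rewrite expnS mulSn -add1n leq_add //.
by rewrite expn_gt0.
Qed.

End Balls.

(** * Clusters of a relation *)

Section Clusters.
Variables (V : pointedType) (G : sgraph V).
Hypothesis Glf : locally_finite G.
Implicit Types (rho : V -> V -> Prop) (B : seq V) (F : seq (V * V)).

Definition conn rho := clos_refl_trans V rho.
Definition clus rho (v : V) : set V := [set u | conn rho v u].
Definition symm rho := forall u v, rho u v -> rho v u.
Definition subgr rho := forall u v, rho u v -> adj G u v.

Definition avoid rho B u v := [/\ rho u v, u \notin B & v \notin B].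
Definition cut rho F u v := [/\ rho u v, (u, v) \notin F & (v, u) \notin F].
Definition inside rho B u v := [/\ rho u v, u \in B & v \in B].

Lemma conn_refl rho u : conn rho u u. Proof. exact: rt_refl. Qed.

Lemma conn_trans rho u v x : conn rho u v -> conn rho v x -> conn rho u x.
Proof. exact: rt_trans. Qed.

Lemma conn_step rho u v : rho u v -> conn rho u v. Proof. exact: rt_step. Qed.

Lemma conn_mono rho rho' u v : (forall x y, rho x y -> rho' x y) ->
  conn rho u v -> conn rho' u v.
Proof.
move=> h; elim=> [x y /h|x|x y z _ xy _ yz]; [exact: rt_step|exact: rt_refl|].
exact: rt_trans xy yz.
Qed.

Lemma conn_sym rho u v : symm rho -> conn rho u v -> conn rho v u.
Proof.
move=> h; elim=> [x y /h|x|x y z _ xy _ yz]; [exact: rt_step|exact: rt_refl|].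
exact: rt_trans yz xy.
Qed.

Lemma conn_ind_l rho x (Q : V -> Prop) :
  Q x -> (forall u v, rho u v -> conn rho v x -> Q v -> Q u) ->
  forall u, conn rho u x -> Q u.
Proof.
move=> Qx QS u ux; have := @clos_rt_rt1n _ _ _ _ ux; move=> {}ux; elim: ux Qx QS => // {}u v y uv vy IH Qy QS.
by apply: (QS _ _ uv); [exact: clos_rt1n_rt|exact: IH].
Qed.

Lemma clus_eq rho u v : symm rho -> conn rho u v -> clus rho u = clus rho v.
Proof.
move=> rs uv; apply/seteqP; split=> x; apply: conn_trans => //.
exact: conn_sym.
Qed.

Lemma clus_conn rho u v : clus rho u = clus rho v -> conn rho u v.
Proof. by move=> e; have : clus rho v v by [exact: conn_refl]; rewrite -e. Qed.

Lemma avoid_sym rho B : symm rho -> symm (avoid rho B).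
Proof. by move=> rs u v [/rs]. Qed.

Lemma cut_sym rho F : symm rho -> symm (cut rho F).
Proof. by move=> rs u v [/rs]. Qed.

Lemma avoid_sub rho B u v : avoid rho B u v -> rho u v. Proof. by case. Qed.

Lemma cut_sub rho F u v : cut rho F u v -> rho u v. Proof. by case. Qed.

Definition open_ball rho r x := forall u v,
  u \in ball G r x -> v \in ball G r x -> adj G u v -> rho u v.

Lemma open_ball_conn rho r x z : open_ball rho r x -> z \in ball G r x ->
  conn (inside rho (ball G r x)) x z.
Proof.
move=> op.
suff H : forall k j y, (k + j <= r)%N -> y \in ball G j x -> z \in ball G k y ->
    conn (inside rho (ball G r x)) y z.
  by move=> zr; apply: (H r 0%N) => //; rewrite ?addn0 ?inE.
elim=> [|k IH] j y kj yx; first by rewrite inE => /eqP ->; exact: conn_refl.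
case/(ballSP Glf) => [->|[t yt zt]]; first exact: conn_refl.
have tx : t \in ball G j.+1 x.
  by rewrite -addn1; apply: (ball_trans Glf) yx _; exact: ball_adj.
apply: conn_trans (IH j.+1 t _ tx zt); last by rewrite addnS.
have yr : y \in ball G r x by apply: (ball_le Glf) yx; lia.
have tr : t \in ball G r x by apply: (ball_le Glf) tx; lia.
by apply: conn_step; split => //; exact: op.
Qed.

Definition far r x y := ~~ has (mem (ball G r x)) (ball G r y).

Lemma far_sym r x y : far r x y = far r y x.
Proof.
by congr (~~ _); apply/hasP/hasP => -[z z1 z2]; exists z.
Qed.

Lemma farP r x y z : far r x y -> z \in ball G r x -> z \notin ball G r y.
Proof. by move=> /hasPn h zx; apply/negP => /h /=; rewrite zx. Qed.

Lemma far_neq r x y : far r x y -> x != y.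
Proof.
move=> f; apply/eqP => e; have := farP f (ball_center G r x).
by rewrite e ball_center.
Qed.

Lemma notfar_ball r x y : ~~ far r x y -> y \in ball G (r + r) x.
Proof.
rewrite negbK => /hasP[z zy /= zx]; apply: (ball_trans Glf) zx _.
by rewrite ball_sym.
Qed.

Lemma open_ball_avoid rho r x y z : symm rho -> open_ball rho r x -> far r x y ->
  z \in ball G r x -> conn (avoid rho (ball G r y)) z x.
Proof.
move=> rs op f zx; apply: conn_sym; first exact: avoid_sym.
apply: conn_mono (open_ball_conn op zx) => u v [uv ux vx].
by split => //; exact: farP f _.
Qed.

(** Follow a path from [s] until it first meets one of the two balls; that ball
    is connected and does not meet the other one. *)
Lemma first_ball rho r x y s : symm rho -> open_ball rho r x -> open_ball rho r y ->
  far r x y -> conn rho s x ->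
  (s \notin ball G r y /\ conn (avoid rho (ball G r y)) s x) \/
  (s \notin ball G r x /\ conn (avoid rho (ball G r x)) s y).
Proof.
move=> rs ox oy f; have f' : far r y x by rewrite far_sym.
elim/conn_ind_l: s / => [|s t st _ IH].
  by left; split; [exact: farP f (ball_center _ _ _)|exact: conn_refl].
have [sy|sy] := boolP (s \in ball G r y).
  by right; split; [exact: farP f' sy|exact: open_ball_avoid].
have [sx|sx] := boolP (s \in ball G r x).
  by left; split=> //; exact: open_ball_avoid.
case: IH => -[t1 t2]; [left|right]; split=> //;
  by apply: conn_trans t2; exact: conn_step.
Qed.

(** ** Trifurcation balls *)

(** The set [F] of cut pairs is left free inside the ball: removing it recovers
    the configuration that was there before all pairs in the ball were joined. *)
Definition trif rho r (big : set V -> Prop) (S : set V) (v : V) :=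
  open_ball rho r v /\
  exists F, (forall e, e \in F -> e.1 \in ball G r v /\ e.2 \in ball G r v) /\
  exists c1 c2 c3, [/\ S c1, S c2 & S c3] /\
    [/\ conn rho v c1, conn rho v c2 & conn rho v c3] /\
    [/\ big (clus (cut rho F) c1), big (clus (cut rho F) c2) &
        big (clus (cut rho F) c3)] /\
    [/\ ~ conn (cut rho F) c1 c2, ~ conn (cut rho F) c1 c3 &
        ~ conn (cut rho F) c2 c3].

Lemma trif_mono rho r big big' (S S' : set V) v :
  (forall C, big C -> big' C) -> S `<=` S' ->
  trif rho r big S v -> trif rho r big' S' v.
Proof.
move=> bb SS [op [F [hF [c1 [c2 [c3 [[? ? ?] [? [[? ? ?] ?]]]]]]]]].
split=> //; exists F; split=> //; exists c1, c2, c3.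
by split; [split; exact: SS|split => //; split => //; split; exact: bb].
Qed.

Lemma separated_subset r D (X : seq V) :
  (forall x, size (ball G (r + r) x) <= D)%N -> uniq X ->
  exists X', [/\ uniq X', {subset X' <= X},
    {in X' &, forall x y, x != y -> far r x y} & (size X <= D * size X')%N].
Proof.
move=> hD; have [n] := ubnP (size X); elim: n X => // n IH [|x X] sX.
  by exists [::]; split.
rewrite cons_uniq => /andP[xX uX].
have [||X' [uX' sub sep siz]] := IH [seq y <- X | far r x y].
- by rewrite size_filter; apply: leq_ltn_trans (count_size _ _) _.
- exact: filter_uniq.
have subX y : y \in X' -> far r x y /\ y \in X.
  by move=> /sub; rewrite mem_filter => /andP.
exists (x :: X'); split.
- by rewrite /= uX' andbT; apply: contra xX => /subX[].
- by move=> y; rewrite !inE => /orP[->//|/subX[_ ->]]; rewrite orbT.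
- move=> y z; rewrite !inE => /orP[/eqP ->|yX] /orP[/eqP ->|zX]; rewrite ?eqxx // => yz.
  + by case: (subX z zX).
  + by rewrite far_sym; case: (subX y yX).
  + exact: sep.
have close : (size (x :: [seq y <- X | predC (far r x) y]) <= D)%N.
  apply: leq_trans (hD x); apply: uniq_leq_size.
    by rewrite /= mem_filter (negbTE xX) andbF filter_uniq.
  move=> y; rewrite inE => /orP[/eqP ->|]; first exact: ball_center.
  by rewrite mem_filter => /andP[/= /notfar_ball].
rewrite /=; have -> : size X = (size [seq y <- X | far r x y] +
    size [seq y <- X | predC (far r x) y])%N by rewrite !size_filter count_predC.
by rewrite mulnS; apply: leq_trans (leq_add close siz); rewrite /= addSn addnC.
Qed.

(** Two far balls are compatible: whatever the first one separates from the
    second lies on the same side of the second as the first one does. *)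
Lemma size_trif rho r D big (X S : seq V) : symm rho ->
  (forall x, size (ball G (r + r) x) <= D)%N -> uniq X ->
  (forall x, x \in X -> trif rho r big [set` S] x) ->
  (size X <= D * size S)%N.
Proof.
move=> rs hD uX tX.
have [X' [uX' sub sep siz]] := separated_subset hD uX.
have tX' x : x \in X' -> trif rho r big [set` S] x by move=> /sub/tX.
pose good x F := (forall e, e \in F -> e.1 \in ball G r x /\ e.2 \in ball G r x) /\
  exists c1 c2 c3, [/\ c1 \in S, c2 \in S & c3 \in S] /\
    [/\ conn rho x c1, conn rho x c2 & conn rho x c3] /\
    [/\ ~ conn (cut rho F) c1 c2, ~ conn (cut rho F) c1 c3 &
        ~ conn (cut rho F) c2 c3].
have [Fx hFx] : exists Fx : V -> seq (V * V), forall x, x \in X' -> good x (Fx x).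
  have /choice[f hf] : forall x, exists F, x \in X' -> good x F.
    move=> x; have [xX|xX] := boolP (x \in X'); last by exists [::].
    have [_ [F [hF [c1 [c2 [c3 [h1 [h2 [_ h3]]]]]]]]] := tX' x xX.
    by exists F => _; split => //; exists c1, c2, c3.
  by exists f.
apply: leq_trans siz _; rewrite leq_mul2l; apply/orP; right.
apply: (@size_tripartitions V _ _ (clus rho) (fun x => clus (cut rho (Fx x)))) => //.
- move=> x y s xX yX _ xy kyx ksx lxy.
  have fxy := sep _ _ xX yX xy; have fyx : far r y x by rewrite far_sym.
  have [ox _] := tX' _ xX; have [oy _] := tX' _ yX.
  have sx : conn rho s x by exact: clus_conn.
  have same u v z : z \in X' -> conn (avoid rho (ball G r z)) u v ->
      clus (cut rho (Fx z)) u = clus (cut rho (Fx z)) v.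
    move=> zX uv; apply: clus_eq; first exact: cut_sym.
    apply: conn_mono uv => a b [ab az bz]; split=> //.
      by apply/negP => /(hFx z zX).1[/=]; rewrite (negbTE az).
    by apply/negP => /(hFx z zX).1[/=]; rewrite (negbTE bz).
  case: (first_ball rs ox oy fxy sx) => -[_ c]; first exact: same.
  by case: lxy; exact: same.
move=> x xX; have [_ [c1 [c2 [c3 [[? ? ?] [[? ? ?] [n12 n13 n23]]]]]]] := hFx x xX.
have ce c : conn rho x c -> clus rho c = clus rho x.
  by move=> xc; apply/esym/clus_eq.
by exists c1, c2, c3; do !split => //; try exact: ce; move/clus_conn.
Qed.

End Clusters.

(** * Finite and infinite sets of vertices *)

Lemma finite_subset_seq (V : choiceType) (A : set V) (s : seq V) :
  (forall v, A v -> v \in s) -> finite_set A.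
Proof.
move=> h; apply: (@sub_finite_set _ A [set` s]); first by move=> v /h.
exact: finite_seq.
Qed.

Lemma infinite_notin (V : choiceType) (A : set V) (s : seq V) :
  infinite_set A -> exists2 v, A v & v \notin s.
Proof.
move=> iA; apply: contrapT => h; apply: iA.
apply: (@finite_subset_seq _ _ s) => v Av; apply: contrapT => /negP vs.
by apply: h; exists v.
Qed.

Lemma infinite_uniq_seq (V : choiceType) (A : set V) (n : nat) :
  infinite_set A -> exists s, [/\ uniq s, size s = n & forall v, v \in s -> A v].
Proof.
move=> iA; elim: n => [|n [s [us ss hs]]]; first by exists [::].
have [v Av vs] := infinite_notin s iA.
exists (v :: s); split; rewrite /= ?vs ?ss // => w.
by rewrite inE => /orP[/eqP ->|/hs].
Qed.

(** * Furcations: open balls with several small branches *)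

Section SmallBranches.
Variables (V : pointedType) (G : sgraph V).
Hypothesis Glf : locally_finite G.
Variables (rho : V -> V -> Prop) (r D : nat) (small : set V -> Prop).
Hypothesis rhoS : symm rho.
Hypothesis small_sub : forall A B, A `<=` B -> small B -> small A.
Hypothesis small_setU : forall A B, small A -> small B -> small (A `|` B).
Hypothesis size_ballD : forall x, (size (ball G (r + r) x) <= D)%N.

Definition branch x s := clus (avoid rho (ball G r x)) s.

(** [below x s]: the ball of [x] separates [s] from the rest of its cluster by
    cutting off a small branch. *)
Definition below x s := [/\ s \notin ball G r x, conn rho x s & small (branch x s)].

(** The cluster is not small although two infinite pieces cut off by the ball are:
    this orients the furcations of a cluster, since two far ones cannot both cut each
    other off in a small piece. *)
Definition furcation x := [/\ open_ball G rho r x, ~ small (clus rho x) &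
  exists a1 a2, [/\ below x a1, below x a2, infinite_set (branch x a1),
    infinite_set (branch x a2) & ~ branch x a1 a2]].

Definition between u x z := [/\ furcation z, below z u & below x z].

(** Depth of [x] above [u] in the forest of furcations. *)
Definition rank u x := size (fset_set [set z | between u x z] : seq V).

Let avoidS x : symm (avoid rho (ball G r x)). Proof. exact: avoid_sym. Qed.

Lemma below_branch x s t : below x s -> t \notin ball G r x -> branch x s t -> below x t.
Proof.
move=> [sx xs ss] tx st; split=> //.
  by apply: conn_trans xs (conn_mono _ st) => a b; exact: avoid_sub.
by rewrite /branch -(clus_eq (@avoidS x) st).
Qed.

(** A path from [s] to both balls meets one of them first. *)
Lemma furcation_dichotomy x y s : furcation x -> furcation y -> far G r x y ->
  conn rho x s ->
  (s \notin ball G r y /\ branch y s x) \/ (s \notin ball G r x /\ branch x s y).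
Proof.
move=> [ox _ _] [oy _ _] f xs; apply: first_ball => //; exact: conn_sym.
Qed.

Lemma far_notin x y : far G r x y -> x \notin ball G r y.
Proof. by move=> f; apply: farP f (ball_center _ _ _). Qed.

(** If each ball cut the other one off in a small branch, the whole cluster would be
    the union of two small sets. *)
Lemma below_asym x y : furcation x -> furcation y -> far G r x y ->
  below x y -> ~ below y x.
Proof.
move=> fx fy f [_ xy sxy] [_ yx syx]; case: (fx) => _ big _; apply: big.
apply: small_sub (small_setU sxy syx) => s xs.
have [[sy h]|[sx h]] := furcation_dichotomy fx fy f xs.
  by right; exact: conn_sym h.
by left; exact: conn_sym h.
Qed.

Lemma below_trans x y s : furcation x -> furcation y -> far G r x y ->
  below x y -> below y s -> below x s.
Proof.
move=> fx fy f xy ys; have xs : conn rho x s.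
  by case: xy => _ c _; case: ys => _ c' _; exact: conn_trans c c'.
have [[sy h]|[sx h]] := furcation_dichotomy fx fy f xs.
  by case: (below_asym fx fy f xy); apply: below_branch ys _ h; exact: far_notin.
by apply: below_branch xy sx _; exact: conn_sym h.
Qed.

Lemma below_nested x y u : furcation x -> furcation y -> far G r x y ->
  below x u -> below y u -> below x y \/ below y x.
Proof.
move=> fx fy f xu yu; have [_ xuc _] := xu.
have [[uy h]|[ux h]] := furcation_dichotomy fx fy f xuc.
  by right; apply: below_branch yu _ h; exact: far_notin.
by left; apply: below_branch xu _ h; rewrite far_notin // far_sym.
Qed.

Lemma below_same_branch x z u : furcation x -> furcation z -> far G r x z ->
  below z u -> below x z -> branch x u z.
Proof.
move=> fx fz f zu xz; have xu : conn rho x u.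
  by case: xz => _ c _; case: zu => _ c' _; exact: conn_trans c c'.
have [[uz h]|[ux h]] // := furcation_dichotomy fx fz f xu.
by case: (below_asym fx fz f xz); apply: below_branch zu _ h; exact: far_notin.
Qed.

Lemma path_support u x : conn rho u x ->
  exists p : seq V, forall B : seq V, (forall z, z \in p -> z \notin B) -> conn (avoid rho B) u x.
Proof.
elim=> [a b ab|a|a b c _ [p hp] _ [q hq]].
- by exists [:: a; b] => B h; apply: conn_step; split=> //; apply: h; rewrite !inE eqxx ?orbT.
- by exists [::] => B _; exact: conn_refl.
- exists (p ++ q) => B h; apply: conn_trans (hp _ _) (hq _ _) => z zp; apply: h;
  by rewrite mem_cat zp ?orbT.
Qed.

(** A path from [u] to [x] must cross the ball of every furcation lying between
    the two. *)
Lemma finite_between u x : furcation x -> conn rho x u -> finite_set [set z | between u x z].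
Proof.
move=> fx /(conn_sym rhoS)/path_support[p hp].
apply: (@finite_subset_seq _ _ (ball G (r + r) x ++ flatten [seq ball G r t | t <- p])).
move=> z [fz zu xz]; rewrite mem_cat.
have [f|/(notfar_ball Glf) -> //] := boolP (far G r x z).
apply/orP; right; apply/flatten_mapP; apply: contrapT => h.
have ux : branch z u x.
  apply: hp => t tp; apply/negP => tz; apply: h; exists t => //.
  by rewrite ball_sym.
by case: (below_asym fx fz f xz); apply: below_branch zu _ ux; exact: far_notin.
Qed.

Lemma in_between u x z : furcation x -> conn rho x u ->
  (z \in (fset_set [set z | between u x z] : seq V)) = `[< between u x z >].
Proof.
move=> fx xu; rewrite in_fset_set; last exact: finite_between.
by apply/idP/asboolP; rewrite inE.
Qed.

Lemma rank_lt u x y : furcation x -> furcation y -> far G r x y ->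
  below x u -> below y u -> below y x -> (rank u x < rank u y)%N.
Proof.
move=> fx fy f xu yu yx; have [_ cxu _] := xu; have [_ cyu _] := yu.
rewrite /rank -[X in (X <= _)%N](_ : size (x :: fset_set [set z | between u x z]) = _) //.
apply: uniq_leq_size.
  rewrite cons_uniq fset_uniq andbT in_between //.
  by apply/asboolP => -[_ _ []]; rewrite ball_center.
move=> z; rewrite inE in_between // => /orP[/eqP ->|].
  by rewrite in_between //; exact/asboolP.
rewrite in_between // => /asboolP[fz zu xz]; apply/asboolP; split=> //.
by apply: below_trans fy fx _ yx xz; rewrite far_sym.
Qed.

(** Furcations with [u] below are nested, hence comparable as soon as they are far
    apart, and comparable ones have different ranks. *)
Lemma size_same_rank u k (X : seq V) : uniq X ->
  (forall x, x \in X -> [/\ furcation x, below x u & rank u x = k]) -> (size X <= D)%N.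
Proof.
case: X => // x X uX hX; apply: leq_trans (size_ballD x); apply: uniq_leq_size => // y yX.
have [fx xu kx] := hX x (mem_head _ _); have [fy yu ky] := hX y yX.
apply: (notfar_ball Glf); apply/negP => f.
have [xy|yx] := below_nested fx fy f xu yu.
  have f' : far G r y x by rewrite far_sym.
  by have := rank_lt fy fx f' yu xu xy; rewrite kx ky ltnn.
by have := rank_lt fx fy f xu yu yx; rewrite kx ky ltnn.
Qed.

Lemma size_close_le (x : V) (s : seq V) : uniq s ->
  (forall z, z \in s -> ~~ far G r x z) -> (size s <= D)%N.
Proof.
move=> us h; apply: leq_trans (size_ballD x); apply: uniq_leq_size => // z /h.
exact: notfar_ball.
Qed.

Lemma rank_le_close u x : furcation x -> conn rho x u ->
  (forall z, between u x z -> ~~ far G r x z) -> (rank u x <= D)%N.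
Proof.
move=> fx xu h; apply: (@size_close_le x); first exact: fset_uniq.
by move=> z; rewrite in_between // => /asboolP/h.
Qed.

(** A vertex next to the ball of [x] cannot be separated from [x] by a far ball. *)
Lemma low_rank_point x : furcation x -> exists2 u, below x u & (rank u x <= D)%N.
Proof.
move=> fx; have [op big [a1 [_ [b1 _ _ _ _]]]] := fx.
suff [u ua [b bx ub]] : exists2 u, below x u & exists2 b, b \in ball G r x & rho u b.
  exists u => //; have [ux xu _] := ua; apply: rank_le_close => // z [fz zu xz].
  have [uz _ _] := zu.
  apply/negP => f; case: (below_asym fx fz f xz); apply: below_branch zu (far_notin f) _.
  apply: conn_trans (conn_step _) (open_ball_avoid Glf rhoS op f bx).
  by split=> //; exact: farP f bx.
have [_ xa _] := b1; have ax := conn_sym rhoS xa; move: b1; clear xa.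
elim/conn_ind_l: a1 / ax => [[]|s t st tx IH bs].
  by rewrite ball_center.
have [tB|tB] := boolP (t \in ball G r x); first by exists s => //; exists t.
have [sB _ _] := bs.
have st' : avoid rho (ball G r x) s t by split.
exact: IH (below_branch bs tB (conn_step st')).
Qed.

(** Below [x], in the branch of a far furcation, some far furcation is maximal;
    passing from [x] to it changes ranks by at most the number of furcations
    close to one of the two. *)
Lemma maximal_below x z0 : furcation x -> furcation z0 -> far G r x z0 -> below x z0 ->
  exists z, [/\ furcation z, far G r x z, below x z, branch x z0 z &
    forall u, below z u -> (rank u x <= rank u z + (D + D))%N].
Proof.
move=> fx fz0 f0 xz0.
(* Climb from [z0] towards [x]: finitely many furcations lie between the two. *)
pose up z := [set z' | [/\ furcation z', far G r x z', far G r z z', below x z' & below z' z]].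
have upfin z : below x z -> finite_set (up z).
  move=> xz; have [_ cxz _] := xz.
  apply: sub_finite_set (finite_between fx cxz) => z' [fz' _ _ xz' z'z].
  by split.
pose n z := size (fset_set (up z) : seq V).
suff H k z1 : (n z1 < k)%N -> furcation z1 -> far G r x z1 -> below x z1 -> branch x z0 z1 ->
  exists z, [/\ furcation z, far G r x z, below x z, branch x z0 z & up z = set0].
  have [z [fz f xz bz uz]] := H _ z0 (ltnSn _) fz0 f0 xz0 (conn_refl _ _).
  exists z; split=> // u zu; have [_ cxz _] := xz; have [_ czu _] := zu.
  have xu : below x u by exact: below_trans fx fz f xz zu.
  have [_ cxu _] := xu.
  rewrite /rank; set s := (fset_set [set z0 | between u x z0] : seq V).
  have mem_s t : t \in s = `[< between u x t >] by exact: in_between.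
  have us : uniq s by exact: fset_uniq.
  pose P t := far G r x t; pose P' t := far G r z t.
  have h1 : (size [seq t <- s | predC P t] <= D)%N.
    apply: (@size_close_le x); first exact: filter_uniq.
    by move=> t; rewrite mem_filter => /andP[].
  have h2 : (size [seq t <- [seq t <- s | P t] | predC P' t] <= D)%N.
    apply: (@size_close_le z); first by do 2 apply: filter_uniq.
    by move=> t; rewrite mem_filter => /andP[].
  have h3 : (size [seq t <- [seq t <- s | P t] | P' t] <=
      size (fset_set [set z0 | between u z z0] : seq V))%N.
    apply: uniq_leq_size; first by do 2 apply: filter_uniq.
    move=> t; rewrite !mem_filter mem_s => /and3P[zt xt /asboolP[ft tu xt']].
    rewrite in_between //; apply/asboolP; split=> //.
    have [//|tz] := below_nested fz ft zt zu tu.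
    by have : up z t by []; rewrite uz.
  have e1 : size s = (size [seq t <- s | P t] + size [seq t <- s | predC P t])%N.
    by rewrite !size_filter count_predC.
  have e2 : size [seq t <- s | P t] = (size [seq t <- [seq t <- s | P t] | P' t] +
      size [seq t <- [seq t <- s | P t] | predC P' t])%N.
    by rewrite [in RHS]size_filter [X in (_ + X)%N]size_filter count_predC.
  by move: h1 h2 h3 e1 e2; lia.
elim: k z1 => // k IH z1 nz1 fz1 f1 xz1 bz1.
have [up0|/eqP/set0P[z2 [fz2 f2 f12 xz2 z21]]] := pselect (up z1 = set0).
  by exists z1.
have sub : up z2 `<=` up z1.
  move=> z3 [fz3 f3 f23 xz3 z32]; split=> //; last first.
    by apply: below_trans fz3 fz2 _ z32 z21; rewrite far_sym.
  rewrite /far; apply/negP => /hasP[b b3 /= b1].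
  have f21 : far G r z2 z1 by rewrite far_sym.
  have f32 : far G r z3 z2 by rewrite far_sym.
  have [opz1 _ _] := fz1; have [opz3 _ _] := fz3.
  apply: (below_asym fz2 fz3 f23) => //.
  apply: below_branch z21 _ _; first by rewrite far_notin.
  apply: conn_trans (open_ball_avoid Glf rhoS opz3 f32 b3).
  by apply: conn_sym; [exact: avoidS|exact: open_ball_avoid].
apply: (IH z2) => //.
  apply: (@leq_trans (n z1)); last by rewrite -ltnS.
  rewrite /n -[X in (X <= _)%N](_ : size (z2 :: fset_set (up z2)) = _) //.
  apply: uniq_leq_size.
    rewrite cons_uniq fset_uniq andbT in_fset_set; last exact: upfin.
    by apply/negP; rewrite inE => -[_ _ /far_neq]; rewrite eqxx.
  move=> t; rewrite inE !in_fset_set; [|exact: upfin..].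
  move=> /orP[/eqP ->|]; rewrite !inE //.
  exact: sub.
by apply: conn_trans bz1 _; exact: below_same_branch fx fz2 f2 z21 xz2.
Qed.

Variable R : realType.
Variable l : R.
Hypotheses (l0 : 0 < l) (l1 : l <= 1) (lD : 3/2 <= l ^+ (D + D) * 2).

Definition weight (U : seq V) x := \sum_(u <- U | `[< below x u >]) l ^+ rank u x.

Let expl_le m n : (m <= n)%N -> l ^+ n <= l ^+ m.
Proof. by move=> mn; apply: ler_wiXn2l => //; exact: ltW. Qed.

(** Every furcation either has an infinite branch free of far furcations, whose
    vertices all have bounded rank, or has a far furcation in each of two
    branches; in the second case the weight grows by the factor [3/2]. *)
Lemma weight_unbounded n x : furcation x ->
  exists U, uniq U /\ l ^+ D * (3/2) ^+ n <= weight U x.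
Proof.
elim: n x => [|n IH] x fx.
  have [u xu hu] := low_rank_point fx; exists [:: u]; split=> //.
  rewrite expr0 mulr1 /weight big_cons big_nil asboolT // addr0.
  exact: expl_le.
have [op big [a1 [a2 [b1 b2 i1 i2 n12]]]] := fx.
pose fars a := exists z, [/\ furcation z, far G r x z, below x z & branch x a z].
have barren a : below x a -> infinite_set (branch x a) -> ~ fars a ->
    exists U, uniq U /\ l ^+ D * (3/2) ^+ n.+1 <= weight U x.
  move=> ba ia nf.
  have iB : infinite_set (branch x a `\` [set` ball G r x]).
    by apply: infinite_setD => //; exact: finite_seq.
  have [U [uU sU hU]] := infinite_uniq_seq (Num.bound ((3/2 : R) ^+ n.+1)) iB.
  exists U; split=> //.
  have lo u : u \in U -> below x u /\ (rank u x <= D)%N.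
    move=> /hU[au /= /negP ux]; have xu := below_branch ba ux au.
    split=> //; have [_ cxu _] := xu; apply: rank_le_close => // z [fz zu xz].
    apply/negP => f; apply: nf; exists z; split=> //.
    by apply: conn_trans au _; exact: below_same_branch fx fz f zu xz.
  rewrite /weight big_seq_cond (eq_bigl (fun u => u \in U)); last first.
    by move=> u; apply: andb_idr => /lo[xu _]; exact/asboolP.
  apply: (@le_trans _ _ (\sum_(u <- U | u \in U) l ^+ D)); last first.
    by apply: ler_sum => u /lo[_]; exact: expl_le.
  rewrite -big_seq big_const_seq count_predT sU iter_addr_0 -[leRHS]mulr_natr.
  rewrite ler_pM2l ?exprn_gt0 //; apply: ltW; apply: archi_boundP.
  by rewrite exprn_ge0 //; lra.
have [f1|] := pselect (fars a1); last exact: barren.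
have [f2|] := pselect (fars a2); last exact: barren.
have top a : fars a -> exists z, [/\ furcation z, far G r x z, below x z, branch x a z &
    forall u, below z u -> (rank u x <= rank u z + (D + D))%N].
  move=> [z0 [fz0 f0 xz0 az0]].
  have [z [fz f xz z0z h]] := maximal_below fx fz0 f0 xz0.
  by exists z; split=> //; exact: conn_trans az0 z0z.
have [z1 [fz1 fr1 xz1 az1 h1]] := top _ f1; have [z2 [fz2 fr2 xz2 az2 h2]] := top _ f2.
have [U1 [uU1 w1]] := IH _ fz1; have [U2 [uU2 w2]] := IH _ fz2.
exists ([seq u <- U1 | `[< below z1 u >]] ++ [seq u <- U2 | `[< below z2 u >]]); split.
  rewrite cat_uniq !filter_uniq // andbT; apply/hasPn => u.
  rewrite !mem_filter => /andP[/asboolP zu2 _]; apply/negP => /= /andP[/asboolP zu1 _].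
  apply: n12; apply: conn_trans az1 _.
  apply: conn_trans (conn_sym _ az2); last exact: avoidS.
  apply: conn_trans (conn_sym _ (below_same_branch fx fz1 fr1 zu1 xz1)) _; first exact: avoidS.
  exact: below_same_branch fx fz2 fr2 zu2 xz2.
have part z U : furcation z -> far G r x z -> below x z ->
    (forall u, below z u -> (rank u x <= rank u z + (D + D))%N) ->
    l ^+ (D + D) * weight U z <=
      \sum_(u <- [seq u <- U | `[< below z u >]] | `[< below x u >]) l ^+ rank u x.
  move=> fz f xz h; rewrite big_filter_cond.
  rewrite (eq_bigl (fun u => `[< below z u >])); last first.
    move=> u; apply: andb_idr => /asboolP zu; apply/asboolP.
    exact: below_trans fx fz f xz zu.
  rewrite /weight mulr_sumr; apply: ler_sum => u /asboolP zu.
  by rewrite -exprD; apply: expl_le; rewrite addnC h.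
rewrite /weight big_cat /=.
apply: le_trans (lerD (part _ U1 fz1 fr1 xz1 h1) (part _ U2 fz2 fr2 xz2 h2)).
set c := l ^+ D * (3/2) ^+ n in w1 w2 *.
have c0 : 0 <= c by rewrite mulr_ge0 // exprn_ge0 ?ltW //; lra.
have -> : l ^+ D * (3/2) ^+ n.+1 = (3/2) * c by rewrite exprS mulrCA.
have e0 : 0 <= l ^+ (D + D) by rewrite exprn_ge0 // ltW.
have := ler_wpM2l e0 w1; have := ler_wpM2l e0 w2; have := ler_wpM2r c0 lD.
set e := l ^+ (D + D); rewrite (_ : e * 2 * c = e * c + e * c); first by lra.
by rewrite mulrAC mulr_natr mulr2n.
Qed.

End SmallBranches.

(** * Hitting and returning for a Markov operator *)

(** Averaging operators are used in place of transition kernels: all probabilities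
    of the walk are built by iterating [q], and [mk_lim] lets limits through. *)
Record markov (R : realType) (V : Type) (q : (V -> R) -> V -> R) := Markov {
  mkD : forall f g u, q (fun v => f v + g v) u = q f u + q g u;
  mkZ : forall c f u, q (fun v => c * f v) u = c * q f u;
  mk1 : forall u, q (fun=> 1) u = 1;
  mk_mono : forall f g, (forall v, f v <= g v) -> forall u, q f u <= q g u;
  mk_lim : forall (f : nat -> V -> R) g, (forall v, f^~ v @ \oo --> g v) ->
    forall u, (fun n => q (f n) u) @ \oo --> q g u }.

Section MarkovTheory.
Variables (R : realType) (V : Type).
Implicit Types (q : (V -> R) -> V -> R) (f g : V -> R).

Lemma markov_comp q q' : markov q -> markov q' -> markov (q \o q').
Proof.
move=> m m'; split=> /=.
- move=> f g u; rewrite -(mkD m); congr (q _ u); apply/funext => v; exact: mkD.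
- move=> c f u; rewrite -(mkZ m); congr (q _ u); apply/funext => v; exact: mkZ.
- by move=> u; rewrite -[RHS](mk1 m u); congr (q _ u); apply/funext => v; exact: mk1.
- by move=> f g fg u; apply: (mk_mono m) => v; exact: mk_mono.
- by move=> f g fg u; apply: (mk_lim m) => v; exact: mk_lim.
Qed.

Lemma markov_iter q n : markov q -> markov (iter n q).
Proof.
move=> m; elim: n => [|n IH]; first by split.
have -> : iter n.+1 q = q \o iter n q by [].
exact: markov_comp.
Qed.

Section Linearity.
Variable q : (V -> R) -> V -> R.
Hypothesis mq : markov q.

Lemma mkN f u : q (fun v => - f v) u = - q f u.
Proof.
rewrite -mulN1r -(mkZ mq); congr (q _ u); apply/funext => v; by rewrite mulN1r.
Qed.

Lemma mkB f g u : q (fun v => f v - g v) u = q f u - q g u.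
Proof. by rewrite (mkD mq) mkN. Qed.

Lemma mk0 u : q (fun=> 0) u = 0.
Proof.
transitivity (q (fun=> 0 * 1) u).
  by congr (q _ u); apply/funext => v; rewrite mul0r.
by rewrite (mkZ mq 0 (fun=> 1)) mul0r.
Qed.

Lemma mk_ge0 f : (forall v, 0 <= f v) -> forall u, 0 <= q f u.
Proof. by move=> f0 u; rewrite -(mk0 u); exact: mk_mono. Qed.

Lemma mk_le1 f : (forall v, f v <= 1) -> forall u, q f u <= 1.
Proof. by move=> f0 u; rewrite -(mk1 mq u); exact: mk_mono. Qed.

Lemma mk_sum (I : Type) (s : seq I) (F : I -> V -> R) u :
  q (fun v => \sum_(i <- s) F i v) u = \sum_(i <- s) q (F i) u.
Proof.
elim: s => [|i s IH]; first by rewrite big_nil -[RHS](mk0 u); congr (q _ u); apply/funext => v; rewrite big_nil.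
rewrite big_cons -IH -(mkD mq); congr (q _ u); apply/funext => v; by rewrite big_cons.
Qed.

Lemma iter_ge0 f n v : (forall v, 0 <= f v) -> 0 <= iter n q f v.
Proof. by move=> f0; elim: n v => //= n IH v; exact: mk_ge0. Qed.

End Linearity.

Section OneOperator.
Variable q : (V -> R) -> V -> R.
Hypothesis mq : markov q.

Lemma iter_fix h n : (forall u, q h u = h u) -> iter n q h = h.
Proof. by move=> H; elim: n => //= n ->; exact/funext. Qed.

Lemma limn_dec (a : nat -> R) : (forall n, a n.+1 <= a n) -> (forall n, 0 <= a n) ->
  a @ \oo --> limn a /\ (forall n, limn a <= a n).
Proof.
move=> /nonincreasing_seqP dec a0.
have c : cvgn a by apply: nonincreasing_is_cvgn => //; exists 0 => _ [n _ <-].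
by split => // n; exact: nonincreasing_cvgn_ge.
Qed.

Variable C : set V.

(** [miss n v] is the probability that the walk from [v] avoids [C] at the times
    [0 .. n-1]; time [0] counts for [never], and does not for [noreturn]. *)
Fixpoint miss n : V -> R :=
  if n is m.+1 then fun v => if `[< C v >] then 0 else q (miss m) v else fun=> 1.

Definition never v : R := limn (fun n => miss n v).

Definition noreturn v : R := q never v.

Definition finitely v : R := limn (fun n => iter n q never v).

Definition infinitely v : R := 1 - finitely v.

Let missS n v : miss n.+1 v = if `[< C v >] then 0 else q (miss n) v.
Proof. by []. Qed.

Lemma miss_ge0 n v : 0 <= miss n v.
Proof. by elim: n v => //= n IH v; case: ifP => // _; exact: mk_ge0. Qed.

Lemma miss_le1 n v : miss n v <= 1.
Proof. by elim: n v => //= n IH v; case: ifP => // _; exact: mk_le1. Qed.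

Lemma missS_le n v : miss n.+1 v <= miss n v.
Proof.
elim: n v => [|n IH] v; first exact: miss_le1.
rewrite (missS n.+1) (missS n); case: ifP => // _; exact: (mk_mono mq).
Qed.

Lemma cvg_miss v : (fun n => miss n v) @ \oo --> never v.
Proof. by apply: (limn_dec _ _).1 => n; [exact: missS_le|exact: miss_ge0]. Qed.

Lemma never_le_miss n v : never v <= miss n v.
Proof. by apply: (limn_dec _ _).2 => m; [exact: missS_le|exact: miss_ge0]. Qed.

Lemma never_ge0 v : 0 <= never v.
Proof.
apply: limr_ge; last by apply: nearW => n; exact: miss_ge0.
by apply/cvg_ex; exists (never v); exact: cvg_miss.
Qed.

Lemma never_le1 v : never v <= 1.
Proof. exact: le_trans (never_le_miss 0 v) _. Qed.

Lemma neverE v : never v = if `[< C v >] then 0 else noreturn v.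
Proof.
have := @cvg_miss v; rewrite -cvg_shiftS => c.
suff c' : (fun n => miss n.+1 v) @ \oo --> (if `[< C v >] then 0 else noreturn v).
  exact: (cvg_unique _ c c').
rewrite /=; case: ifP => _; first exact: cvg_cst.
by apply: (mk_lim mq) => x; exact: cvg_miss.
Qed.

Lemma never_in v : C v -> never v = 0.
Proof. by move=> Cv; rewrite neverE asboolT. Qed.

Definition on f v : R := if `[< C v >] then f v else 0.

Lemma noreturnE v : noreturn v = never v + on noreturn v.
Proof. by rewrite neverE /on; case: ifP => _; rewrite ?add0r ?addr0. Qed.

Lemma noreturn_ge0 v : 0 <= noreturn v. Proof. by apply: (mk_ge0 mq) => x; exact: never_ge0. Qed.

Lemma noreturn_le1 v : noreturn v <= 1. Proof. by apply: (mk_le1 mq) => x; exact: never_le1. Qed.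

Lemma never_le_noreturn v : never v <= noreturn v.
Proof. by rewrite noreturnE lerDl /on; case: ifP => // _; exact: noreturn_ge0. Qed.

Let bn n := iter n q never.

Let bn_le1 n v : bn n v <= 1.
Proof. by apply: (mk_le1 (markov_iter n mq)) => x; exact: never_le1. Qed.

Let bnS n v : bn n v <= bn n.+1 v.
Proof.
rewrite /bn iterSr; apply: (mk_mono (markov_iter n mq)); exact: never_le_noreturn.
Qed.

Let bn_mono v : {homo (fun n => bn n v) : n m / (n <= m)%N >-> n <= m}.
Proof. by apply/nondecreasing_seqP => n; exact: bnS. Qed.

Lemma cvg_finitely v : (fun n => iter n q never v) @ \oo --> finitely v.
Proof.
by apply: nondecreasing_is_cvgn; [exact: bn_mono|exists 1 => _ [n _ <-]; exact: bn_le1].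
Qed.

Lemma iter_never_le n v : iter n q never v <= finitely v.
Proof. by apply: nondecreasing_cvgn_le; [exact: bn_mono|exact: cvg_finitely]. Qed.

Lemma never_le_finitely v : never v <= finitely v.
Proof. exact: iter_never_le 0%N v. Qed.

Lemma finitely_le1 v : finitely v <= 1.
Proof.
apply: limr_le; last by apply: nearW => n; exact: bn_le1.
by apply/cvg_ex; exists (finitely v); exact: cvg_finitely.
Qed.

Lemma finitely_ge0 v : 0 <= finitely v.
Proof. exact: le_trans (never_ge0 v) (never_le_finitely v). Qed.

Lemma finitely_harmonic v : q finitely v = finitely v.
Proof.
have c : (fun n => bn n.+1 v) @ \oo --> finitely v.
  by rewrite (cvg_shiftS (fun n => bn n v)); exact: cvg_finitely.
have c' : (fun n => bn n.+1 v) @ \oo --> q finitely v.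
  by apply: (mk_lim mq) => x; exact: cvg_finitely.
by rewrite (cvg_unique _ c c').
Qed.

Lemma infinitely_harmonic v : q infinitely v = infinitely v.
Proof. by rewrite (mkB mq) (mk1 mq) finitely_harmonic. Qed.

Lemma infinitely_ge0 v : 0 <= infinitely v.
Proof. by rewrite subr_ge0; exact: finitely_le1. Qed.

Lemma infinitely_le1 v : infinitely v <= 1.
Proof. by rewrite lerBlDr lerDl; exact: finitely_ge0. Qed.

(** Condition on the time of the last visit before time [n]. *)
Lemma iter_never_sum n v :
  iter n q never v = never v + \sum_(k < n) iter k q (on noreturn) v.
Proof.
elim: n => [|n IH]; first by rewrite big_ord0 addr0.
rewrite big_ord_recr /= addrA -IH -iterS iterSr.
rewrite (_ : q never = fun x => never x + on noreturn x) ?(mkD (markov_iter n mq)) //.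
by apply/funext => x; exact: noreturnE.
Qed.

Let kill f v : R := if `[< C v >] then 0 else q f v.

Let killE f v : kill f v = if `[< C v >] then 0 else q f v.
Proof. by []. Qed.

Let infinitely_first n v : infinitely v <=
  \sum_(k < n) iter k q (on infinitely) v + (miss n v - never v).
Proof.
suff H m x : infinitely x <= \sum_(k < m) iter k kill (on infinitely) x + iter m kill infinitely x.
  apply: le_trans (H n v) _; apply: lerD.
    apply: ler_sum => k _; move: (k : nat) v => {k H} j; elim: j => //= j IH v.
    have on0 x : 0 <= on infinitely x.
      by rewrite /on; case: ifP => // _; exact: infinitely_ge0.
    rewrite {1}/kill; case: ifP => _; first by apply: (mk_ge0 mq) => y; exact: iter_ge0.
    exact: (mk_mono mq).
  elim: n v => [|n IH] v /=; first by rewrite lerD2l lerN2 never_le_finitely.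
  rewrite {1}/kill neverE; case: ifP => _; first by rewrite subr0.
  by rewrite /noreturn -(mkB mq); exact: (mk_mono mq).
elim: m x => [|m IH] x; first by rewrite big_ord0 add0r.
apply: le_trans (IH x) _; rewrite big_ord_recr /= -addrA lerD2l.
suff E k y : iter k kill infinitely y = iter k kill (on infinitely) y + iter k.+1 kill infinitely y by rewrite -E.
elim: k y => [|k IHk] y /=.
  rewrite /on /kill; case: ifP => _; first by rewrite addr0.
  by rewrite add0r infinitely_harmonic.
rewrite !killE; case: ifP => _; first by rewrite addr0.
rewrite -(mkD mq); congr (q _ y); exact/funext.
Qed.

(** From any time on, the first later visit already contributes [infinitely v]:
    there is one on the event of infinitely many visits, and the strong Markov
    property evaluates [infinitely] at the vertex visited. *)
Lemma sum_infinitely_unbounded v b : 0 < infinitely v ->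
  exists n, b <= \sum_(k < n) iter k q (on infinitely) v.
Proof.
move=> a0; set a := infinitely v in a0; pose S n := \sum_(k < n) iter k q (on infinitely) v.
have on0 x : 0 <= on infinitely x by rewrite /on; case: ifP => // _; exact: infinitely_ge0.
(* Half of that contribution is collected by a finite time. *)
have step N : exists n, a / 2 + S N <= S n.
  have c : (fun n => iter N q (fun x => miss n x - never x) v) @ \oo --> (0 : R).
    rewrite -[X in _ --> X](mk0 (markov_iter N mq) v).
    apply: (mk_lim (markov_iter N mq)) => x.
    by rewrite -(subrr (never x)); apply: cvgB; [exact: cvg_miss|exact: cvg_cst].
  have a20 : 0 < a / 2 by lra.
  have [n _ /(_ n (leqnn n)) hn] := cvgr_le _ c _ a20.
  exists (N + n)%N; rewrite addrC /S big_split_ord /= lerD2l.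
  have : a <= iter N q (fun x => \sum_(k < n) iter k q (on infinitely) x + (miss n x - never x)) v.
    rewrite {1}/a -[infinitely v](congr1 (fun f => f v) (iter_fix N infinitely_harmonic)).
    by apply: (mk_mono (markov_iter N mq)) => x; exact: infinitely_first.
  rewrite (mkD (markov_iter N mq)).
  have -> : iter N q (fun x => \sum_(k < n) iter k q (on infinitely) x) v =
      \sum_(i < n) iter (N + i)%N q (on infinitely) v.
    by rewrite (mk_sum (markov_iter N mq)); apply: eq_bigr => i _; rewrite iterD.
  move: hn => /=; lra.
have [m] : exists m : nat, b <= (a / 2) *+ m.
  exists (Num.bound `|b / (a / 2)|); rewrite -[leRHS]mulr_natr mulrC -ler_pdivrMr; last lra.
  apply: le_trans (ler_norm _) _; apply: ltW.
  exact: archi_boundP (normr_ge0 _).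
move=> bm; suff [n hn] : exists n, (a / 2) *+ m <= S n by exists n; exact: le_trans bm hn.
elim: m {bm} => [|m [n hn]]; first by exists 0%N; rewrite mulr0n /S big_ord0.
by have [n' hn'] := step n; exists n'; apply: le_trans hn'; rewrite mulrS lerD2l.
Qed.

Hypothesis irr : forall h, (forall v, 0 <= h v) -> (forall v, q h v = h v) ->
  forall u, h u = 0 -> forall v, h v = 0.

(** Both [finitely] and [infinitely] are harmonic, so by the maximum principle
    each vanishes everywhere as soon as it vanishes at one point. If [infinitely]
    has no zero then there is no last visit, and [finitely] vanishes on [C]. *)
Lemma infinitely_zero_one : C !=set0 ->
  (forall u, C u -> noreturn u * infinitely u = 0) ->
  (forall v, infinitely v = 0) \/ (forall v, never v = 0).
Proof.
move=> [u Cu] H.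
have [a0|] := pselect (exists v, infinitely v = 0).
  by have [v av] := a0; left; apply: irr infinitely_ge0 infinitely_harmonic v av.
move=> na; right.
have l0 x : on noreturn x = 0.
  rewrite /on; case: ifP => // /asboolP Cx; have /eqP := H x Cx.
  by rewrite mulf_eq0 => /orP[/eqP //|/eqP ax]; case: na; exists x.
have bw v : finitely v = never v.
  have := @cvg_finitely v; rewrite (_ : (fun n => _) = (fun=> never v)); last first.
    apply/funext => n; rewrite iter_never_sum big1 ?addr0 // => k _.
    rewrite (_ : on noreturn = fun=> 0); last exact/funext.
    exact: (mk0 (markov_iter k mq) v).
  by move=> c; exact: (cvg_unique _ c (cvg_cst _)).
have bu : finitely u = 0 by rewrite bw never_in.
by move=> v; rewrite -bw; exact: (irr finitely_ge0 finitely_harmonic bu).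
Qed.

End OneOperator.

Section Comparison.
Variable q : (V -> R) -> V -> R.
Hypothesis mq : markov q.

Lemma miss_antimono (A B : set V) n v : A `<=` B -> miss q B n v <= miss q A n v.
Proof.
move=> AB; elim: n v => //= n IH v; case: asboolP => Bv.
  by case: asboolP => // _; apply: (mk_ge0 mq) => x; exact: miss_ge0.
by rewrite asboolF; [exact: (mk_mono mq)|move/AB].
Qed.

Let missE (A : set V) n v : miss q A n.+1 v = if `[< A v >] then 0 else q (miss q A n) v.
Proof. by []. Qed.

Lemma miss_setU (A B : set V) n v :
  miss q A n v + miss q B n v <= 1 + miss q (A `|` B) n v.
Proof.
have le1 := miss_le1 mq; have ge0 := miss_ge0 mq.
elim: n v => [|n IH] v; first by rewrite /=.
have := le1 A n.+1 v; have := le1 B n.+1 v; rewrite !missE.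
case: (asboolP (A v)) => Av; first by rewrite [ `[< (A `|` B) v >]]asboolT; [move=> h _; rewrite add0r addr0|left].
case: (asboolP (B v)) => Bv; first by rewrite [ `[< (A `|` B) v >]]asboolT; [move=> _ h; rewrite !addr0|right].
rewrite [ `[< (A `|` B) v >]]asboolF; last by case.
move=> _ _; rewrite -(mkD mq) -[X in X + _](mk1 mq v) -(mkD mq); exact: (mk_mono mq).
Qed.

Lemma never_antimono (A B : set V) v : A `<=` B -> never q B v <= never q A v.
Proof.
move=> AB; apply: ler_lim.
- by apply/cvg_ex; exists (never q B v); exact: cvg_miss.
- by apply/cvg_ex; exists (never q A v); exact: cvg_miss.
- by apply: nearW => n; exact: miss_antimono.
Qed.

Lemma never_setU (A B : set V) v :
  never q A v + never q B v <= 1 + never q (A `|` B) v.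
Proof.
have c : (fun n => miss q A n v + miss q B n v) @ \oo --> never q A v + never q B v.
  by apply: cvgD; exact: cvg_miss.
have c' : (fun n => 1 + miss q (A `|` B) n v) @ \oo --> 1 + never q (A `|` B) v.
  by apply: cvgD; [exact: cvg_cst|exact: cvg_miss].
apply: (ler_cvg_to c c'); apply: nearW => n; exact: miss_setU.
Qed.

Lemma finitely_antimono (A B : set V) v : A `<=` B -> finitely q B v <= finitely q A v.
Proof.
move=> AB; apply: (ler_cvg_to (@cvg_finitely q mq B v) (@cvg_finitely q mq A v)).
apply: nearW => n; apply: (mk_mono (markov_iter n mq)) => x; exact: never_antimono.
Qed.

Lemma finitely_setU (A B : set V) v :
  finitely q A v + finitely q B v <= 1 + finitely q (A `|` B) v.
Proof.
have c : (fun n => iter n q (never q A) v + iter n q (never q B) v) @ \oo -->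
    finitely q A v + finitely q B v by apply: cvgD; exact: cvg_finitely.
have c' : (fun n => 1 + iter n q (never q (A `|` B)) v) @ \oo -->
    1 + finitely q (A `|` B) v.
  by apply: cvgD; [exact: cvg_cst|exact: cvg_finitely].
apply: (ler_cvg_to c c'); apply: nearW => n /=.
have mn := markov_iter n mq.
rewrite -[X in _ <= X + _](mk1 mn v) -!(mkD mn).
by apply: (mk_mono mn) => x; exact: never_setU.
Qed.

(** Visits at times divisible by [M] from one of [M] consecutive starting times
    make up all visits. *)
Lemma infinitely_iter (C : set V) M : (0 < M)%N ->
  (forall v, infinitely (iter M q) C v = 0) -> forall v, infinitely q C v = 0.
Proof.
move=> M0 H v; set Q := iter M q; have mQ : markov Q := markov_iter M mq.
pose h x := 1 - never Q C x.
pose U x := \sum_(j < M) iter j q h x.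
have h0 x : 0 <= h x by rewrite subr_ge0 never_le1.
have U0 x : 0 <= U x by apply: sumr_ge0 => j _; apply: (iter_ge0 mq).
have hU x : h x <= U x.
  rewrite /U; case: (M) M0 => // m _; rewrite big_ord_recl /= lerDl.
  by apply: sumr_ge0 => j _; exact: (@iter_ge0 q mq h j.+1 x h0).
have Qh x : Q h x <= h x.
  rewrite /h (mkB mQ) (mk1 mQ) lerD2l lerN2; exact: never_le_noreturn.
have qU x : q U x <= U x.
  rewrite /U (mk_sum mq); apply: (@le_trans _ _ (\sum_(j < M) iter j.+1 q h x)) => //.
  have gen k f : (0 < k)%N -> iter k q f x <= f x ->
      \sum_(j < k) iter j.+1 q f x <= \sum_(j < k) iter j q f x.
    case: k => // k _ hk; rewrite big_ord_recr [leRHS]big_ord_recl /= addrC.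
    by apply: lerD => //; apply: ler_sum => j _.
  exact: gen M0 (Qh x).
(* [U] is superharmonic and at least [1] on [C], hence above the probability of
   ever hitting [C]. *)
have missU n x : 1 - miss q C n x <= U x.
  elim: n x => [|n IH] x /=; first by rewrite subrr.
  case: asboolP => Cx.
    by rewrite subr0 (le_trans _ (hU x)) // /h never_in // subr0.
  apply: le_trans (qU x); rewrite -[X in X - _](mk1 mq x) -(mkB mq); exact: (mk_mono mq).
have neverU x : 1 - never q C x <= U x.
  have c : (fun n => 1 - miss q C n x) @ \oo --> 1 - never q C x.
    by apply: cvgB; [exact: cvg_cst|exact: cvg_miss].
  apply: (ler_cvg_to c (cvg_cst (U x))); apply: nearW => n; exact: missU.
apply/eqP; rewrite eq_le infinitely_ge0 // andbT.
have c : (fun k => iter (M * k) q U v) @ \oo --> (0 : R).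
  have -> : (fun k => iter (M * k) q U v) = (fun k => \sum_(j < M) iter j q (iter k Q h) v).
    apply/funext => k; rewrite (mk_sum (markov_iter (M * k) mq)); apply: eq_bigr => j _.
    rewrite -iterD addnC iterD; congr (iter j q _ v).
    by rewrite /Q mulnC; elim: k => //= k IHk; rewrite mulSn iterD IHk.
  have z : forall j x, (fun k => iter j q (iter k Q h) x) @ \oo --> (0 : R).
    move=> j x; rewrite -[X in _ --> X](mk0 (markov_iter j mq) x).
    apply: (mk_lim (markov_iter j mq)) => y.
    rewrite -(H y) /infinitely.
    rewrite (_ : (fun n => _) = (fun n => 1 - iter n Q (never Q C) y)); last first.
      by apply/funext => n; rewrite /h (mkB (markov_iter n mQ)) (mk1 (markov_iter n mQ)).
    by apply: cvgB; [exact: cvg_cst|exact: cvg_finitely].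
  elim: (M) => [|m IH].
    by rewrite (_ : (fun k => _) = fun=> 0); [exact: cvg_cst|apply/funext => k; rewrite big_ord0].
  rewrite (_ : (fun k => _) = (fun k => \sum_(j < m) iter j q (iter k Q h) v + iter m q (iter k Q h) v)).
    by rewrite -[X in _ --> X]addr0; apply: cvgD.
  by apply/funext => k; rewrite big_ord_recr.
apply: (ler_cvg_to (cvg_cst (infinitely q C v)) c); apply: nearW => k /=.
apply: (@le_trans _ _ (1 - iter (M * k) q (never q C) v)).
  by rewrite /infinitely lerD2l lerN2; exact: iter_never_le.
have mk := markov_iter (M * k) mq.
by rewrite -[X in X - _](mk1 mk v) -(mkB mk); exact: (mk_mono mk).
Qed.

Lemma miss_equivariant (g : V -> V) : (forall f u, q f (g u) = q (f \o g) u) ->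
  forall C n u, miss q C n (g u) = miss q (g @^-1` C) n u.
Proof.
move=> qg C; elim=> //= n IH u; rewrite qg.
by rewrite (_ : miss q C n \o g = miss q (g @^-1` C) n) //; exact/funext.
Qed.

Lemma never_equivariant (g : V -> V) : (forall f u, q f (g u) = q (f \o g) u) ->
  forall C u, never q C (g u) = never q (g @^-1` C) u.
Proof.
by move=> qg C u; congr (limn _); apply/funext => n; exact: miss_equivariant.
Qed.

Lemma iter_equivariant (g : V -> V) : (forall f u, q f (g u) = q (f \o g) u) ->
  forall n f u, iter n q f (g u) = iter n q (f \o g) u.
Proof.
move=> qg; elim=> //= n IH f u; rewrite qg; congr (q _ u); apply/funext => v; exact: IH.
Qed.

Lemma noreturn_equivariant (g : V -> V) : (forall f u, q f (g u) = q (f \o g) u) ->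
  forall C u, noreturn q C (g u) = noreturn q (g @^-1` C) u.
Proof.
move=> qg C u; rewrite /noreturn qg; congr (q _ u); apply/funext => v.
exact: never_equivariant.
Qed.

Lemma infinitely_equivariant (g : V -> V) : (forall f u, q f (g u) = q (f \o g) u) ->
  forall C u, infinitely q C (g u) = infinitely q (g @^-1` C) u.
Proof.
move=> qg C u; congr (_ - _); congr (limn _); apply/funext => n; rewrite iter_equivariant //.
congr (iter n q _ u); apply/funext => v; exact: never_equivariant.
Qed.

End Comparison.
End MarkovTheory.

(** * Finite sums and thinned sequences *)

Section FiniteSums.
Variables (R : numDomainType) (V : choiceType).

Lemma sum_uniq_sub (s t : seq V) (F : V -> R) : uniq s -> uniq t ->
  {subset s <= t} -> (forall v, v \in t -> v \notin s -> F v = 0) ->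
  \sum_(v <- s) F v = \sum_(v <- t) F v.
Proof.
move=> us ut st F0; rewrite [RHS](bigID (mem s)) /= [X in _ + X]big1_seq ?addr0; last first.
  by move=> v /andP[vs vt]; exact: F0.
rewrite -[RHS]big_filter; apply: perm_big; apply: uniq_perm => //; first exact: filter_uniq.
by move=> v; rewrite mem_filter /=; case: (boolP (v \in s)) => // /st ->.
Qed.

Lemma sum_eq_mem (s : seq V) v : uniq s -> \sum_(z <- s) (z == v)%:R = (v \in s)%:R :> R.
Proof.
move=> us; rewrite -natr_sum; congr (_%:R).
by rewrite -(count_uniq_mem _ us) -sum1_count [RHS]big_mkcond; apply: eq_bigr => z _ /=; case: eqP.
Qed.

Lemma sum_mem_swap (s t : seq V) (F : V -> R) : uniq s -> uniq t ->
  \sum_(u <- s | u \in t) F u = \sum_(u <- t | u \in s) F u.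
Proof.
move=> us ut; rewrite -[LHS]big_filter -[RHS]big_filter; apply: perm_big; apply: uniq_perm; rewrite ?filter_uniq //.
by move=> v; rewrite !mem_filter andbC.
Qed.

Lemma sum_le_sub (s t : seq V) (F : V -> R) : uniq s -> uniq t -> {subset s <= t} ->
  (forall v, 0 <= F v) -> \sum_(v <- s) F v <= \sum_(v <- t) F v.
Proof.
move=> us ut st F0; rewrite big_seq (big_mkcond (fun v => v \in s)) /=.
rewrite (@sum_uniq_sub s t) //; last by move=> v _ /negbTE ->.
by apply: ler_sum => v _; case: ifP.
Qed.

End FiniteSums.

Section Thinning.
Variable V : Type.

(** Keeping one vertex in [M] leaves enough of them to be hit by recurrent sets,
    while dividing the number of reference points by [M]. *)
Fixpoint thin (M j : nat) (s : seq V) : seq V :=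
  if s is x :: s' then if j is i.+1 then thin M i s' else x :: thin M M.-1 s'
  else [::].

Lemma size_thin M j s : (j < M)%N -> (M * size (thin M j s) + j <= size s + M.-1)%N.
Proof.
elim: s j => [|x s IH] j jM; first by rewrite muln0 /= -ltnS prednK //; case: M jM.
case: j jM => [|j] jM.
  have := IH M.-1; rewrite prednK // leqnn => /(_ isT) /=; rewrite mulnS; lia.
have := IH j (ltnW jM); rewrite /=; lia.
Qed.

End Thinning.

(** * The simple random walk *)

Section Average.
Variables (R : realType) (V : pointedType) (G : sgraph V) (dg : nat).
Hypotheses (Glf : locally_finite G) (deg : forall u, degree G u = dg) (dg0 : (0 < dg)%N).
Implicit Types (f : V -> R).

Definition avg f u : R := dg%:R^-1 * \sum_(v <- nbr G u) f v.

Let dgR : (dg%:R : R) != 0. Proof. by rewrite pnatr_eq0 -lt0n. Qed.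

Let dgi0 : 0 < (dg%:R : R)^-1. Proof. by rewrite invr_gt0 ltr0n. Qed.

Lemma markov_avg : markov avg.
Proof.
split.
- by move=> f g u; rewrite /avg big_split mulrDr.
- by move=> c f u; rewrite /avg -mulr_sumr mulrCA.
- by move=> u; rewrite /avg big_const_seq count_predT iter_addr_0 size_nbr deg mulVf.
- by move=> f g fg u; rewrite /avg ler_pM2l //; exact: ler_sum.
- move=> f g fg u; apply: cvgMr; elim: (nbr G u) => [|v s IH].
    rewrite big_nil (_ : (fun n => _) = fun=> 0); first exact: cvg_cst.
    by apply/funext => n; rewrite big_nil.
  rewrite big_cons (_ : (fun n => _) = fun n => f n v + \sum_(j <- s) f n j).
    by apply: cvgD; [exact: fg|exact: IH].
  by apply/funext => n; rewrite big_cons.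
Qed.

Lemma avg_equivariant g : aut G g -> forall f u, avg f (g u) = avg (f \o g) u.
Proof.
by move=> gA f u; rewrite /avg (perm_big _ (nbr_aut Glf u gA)) big_map.
Qed.

Definition single (v x : V) : R := (x == v)%:R.

Lemma avg_single v : avg (single v) = fun x => dg%:R^-1 * \sum_(y <- nbr G v) single y x.
Proof.
apply/funext => x; congr (_ * _); rewrite /single sum_eq_mem ?nbr_uniq //.
under eq_bigr do rewrite eq_sym.
by rewrite sum_eq_mem ?nbr_uniq // !mem_nbr // adj_sym.
Qed.

(** The walk on a regular graph is reversible. *)
Lemma single_sym k u v : iter k avg (single v) u = iter k avg (single u) v.
Proof.
elim: k u v => [|k IH] u v; first by rewrite /= /single eq_sym.
have mk := markov_iter k markov_avg.
rewrite iterSr avg_single (mkZ mk) (mk_sum mk) iterS /avg; congr (_ * _).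
by apply: eq_bigr => y _; exact: IH.
Qed.

Lemma single_support k u v : v \notin ball G k u -> iter k avg (single v) u = 0.
Proof.
elim: k u => [|k IH] u; first by rewrite inE /= /single eq_sym => /negbTE ->.
move=> vu; rewrite /= /avg big1_seq ?mulr0 // => x /=; rewrite mem_nbr // => ux.
apply: IH; apply: contra vu => vx; apply/ballSP => //; right; by exists x.
Qed.

Lemma single_ge0 k u v : 0 <= iter k avg (single v) u.
Proof. by apply: (iter_ge0 markov_avg) => x; rewrite /single ler0n. Qed.

Lemma iter_avg_sum k f u :
  iter k avg f u = \sum_(v <- undup (ball G k u)) iter k avg (single v) u * f v.
Proof.
elim: k u => [|k IH] u; first by rewrite /= big_seq1 /single eqxx mul1r.
rewrite iterS {1}/avg.
under [in RHS]eq_bigr do rewrite iterS /avg -mulrA mulr_suml.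
rewrite -mulr_sumr exchange_big; congr (_ * _); apply: eq_big_seq => x.
rewrite mem_nbr // => ux; rewrite IH; apply: sum_uniq_sub; rewrite ?undup_uniq //.
  by move=> v; rewrite !mem_undup => vx; apply/ballSP => //; right; exists x.
by move=> v _; rewrite mem_undup => vx; rewrite single_support ?mul0r.
Qed.

Lemma avg_ge_neighbor h u v : (forall x, 0 <= h x) -> adj G u v -> dg%:R^-1 * h v <= avg h u.
Proof.
move=> h0 uv; rewrite /avg ler_pM2l // (big_rem v) ?mem_nbr //= lerDl.
by apply: sumr_ge0.
Qed.

Lemma iter_odd_avg_ge m h u v : (forall x, 0 <= h x) -> adj G u v ->
  dg%:R^-1 ^+ (m.*2.+1) * h v <= iter (m.*2.+1) avg h u.
Proof.
move=> h0 uv; elim: m => [|m IH]; first by rewrite expr1; exact: avg_ge_neighbor.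
have i0 k x : 0 <= iter k avg h x by apply: (iter_ge0 markov_avg).
rewrite doubleS; apply: le_trans (avg_ge_neighbor (i0 m.*2.+2) uv).
rewrite exprS -mulrA ler_pM2l //.
have vu : adj G v u by rewrite adj_sym.
apply: le_trans (avg_ge_neighbor (i0 m.*2.+1) vu).
by rewrite exprS -mulrA ler_pM2l.
Qed.

(** Odd powers of the walk still move from each vertex to its neighbours, so the
    maximum principle holds even on bipartite graphs. *)
Lemma odd_avg_irreducible M : odd M -> connected_graph G ->
  forall h, (forall v, 0 <= h v) -> (forall v, iter M avg h v = h v) ->
  forall u, h u = 0 -> forall v, h v = 0.
Proof.
move=> oM Gc h h0 hh u hu v; move: (Gc u v) hu.
elim=> [x y xy hx|//|x y z _ IH _ IH' /IH/IH' //].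
have [m eM] : exists m, M = m.*2.+1.
  by exists M./2; rewrite -[LHS]odd_double_half oM.
have := iter_odd_avg_ge m h0 xy; rewrite -eM hh hx => hy.
apply/eqP; rewrite eq_le h0 andbT.
by move: hy; rewrite pmulr_rle0 // exprn_gt0.
Qed.

(** ** Expectations over finite trajectories *)

(** Expectation of [g] over the walk from [u] observed at the times [0 .. n]. *)
Fixpoint Ew (n : nat) (u : V) (g : seq V -> R) : R :=
  if n is m.+1 then avg (fun v => Ew m v (fun s => g (u :: s))) u else g [:: u].

Lemma EwD n u g h : Ew n u (fun s => g s + h s) = Ew n u g + Ew n u h.
Proof.
elim: n u g h => //= n IH u g h; rewrite -(mkD markov_avg); congr (avg _ u).
by apply/funext => v; exact: IH.
Qed.

Lemma EwZ n u c g : Ew n u (fun s => c * g s) = c * Ew n u g.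
Proof.
elim: n u g => //= n IH u g; rewrite -(mkZ markov_avg); congr (avg _ u).
by apply/funext => v; exact: IH.
Qed.

Lemma Ew_cst n u c : Ew n u (fun=> c) = c.
Proof.
elim: n u => //= n IH u; rewrite (_ : (fun v => _) = fun=> c * 1).
  by rewrite (mkZ markov_avg _ (fun=> 1)) (mk1 markov_avg) mulr1.
by apply/funext => v; rewrite IH mulr1.
Qed.

Lemma Ew_le n u g h : (forall s, size s = n.+1 -> g s <= h s) -> Ew n u g <= Ew n u h.
Proof.
elim: n u g h => [|n IH] u g h gh /=; first exact: gh.
by apply: (mk_mono markov_avg) => v; apply: IH => s ss; apply: gh; rewrite /= ss.
Qed.

Lemma Ew_ge0 n u g : (forall s, 0 <= g s) -> 0 <= Ew n u g.
Proof. by move=> g0; rewrite -(Ew_cst n u 0); apply: Ew_le => s _. Qed.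

Lemma Ew_equivariant p : aut G p -> forall n u g, Ew n (p u) g = Ew n u (g \o map p).
Proof.
move=> pA; elim=> //= n IH u g; rewrite avg_equivariant //; congr (avg _ u).
by apply/funext => v /=; rewrite IH.
Qed.

Lemma Ew_notin n u v : Ew n v (fun s => (u \notin s)%:R) = miss avg [set u] n.+1 v.
Proof.
have E (b : bool) x : (if `[< [set u] x >] then 0 else b%:R) = ((x != u) && b)%:R :> R.
  by case: asboolP => [-> |]; rewrite ?eqxx //; case: eqP.
elim: n v => [|n IH] v.
  rewrite -[RHS]/(if _ then _ else avg (fun=> 1) v) (mk1 markov_avg) /=.
  by rewrite (E true) inE andbT eq_sym.
rewrite -[RHS]/(if _ then _ else avg (miss avg [set u] n.+1) v).
rewrite (_ : miss avg [set u] n.+1 = fun v => Ew n v (fun s => (u \notin s)%:R)); last first.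
  by apply/funext => x; rewrite IH.
case: asboolP => [-> |vu] /=.
  rewrite (_ : (fun v => _) = fun=> 0); first exact: (mk0 markov_avg).
  apply/funext => x; rewrite -[RHS](Ew_cst n x 0); congr (Ew n x _); apply/funext => s.
  by rewrite inE eqxx.
congr (avg _ v); apply/funext => x; congr (Ew n x _); apply/funext => s.
rewrite inE negb_or; suff -> : u != v by [].
by apply/eqP => uv; apply: vu; rewrite uv.
Qed.

(** Counting each visited vertex at its last visit, the number of distinct
    vertices grows linearly if each visit is the last one with probability
    bounded below. *)
Lemma Ew_range_ge c n u : (forall v, c <= noreturn avg [set v] v) -> c <= 1 ->
  c * n.+1%:R <= Ew n u (fun s => (size (undup s))%:R).
Proof.
move=> hc c1; elim: n u => [|n IH] u; first by rewrite mulr1 /=.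
have -> : Ew n.+1 u (fun s => (size (undup s))%:R) =
    avg (fun v => Ew n v (fun s => (u \notin s)%:R) + Ew n v (fun s => (size (undup s))%:R)) u.
  rewrite /=; congr (avg _ u); apply/funext => v; rewrite -EwD; congr (Ew n v _).
  by apply/funext => s /=; case: ifP => _; rewrite ?add0r //= -natr1 addrC.
rewrite (mkD markov_avg) -natr1 mulrDr mulr1 addrC; apply: lerD.
  apply: le_trans (hc u) _; apply: (mk_mono markov_avg) => v.
  by rewrite Ew_notin; apply: never_le_miss; exact: markov_avg.
rewrite -[X in X <= _](Ew_cst 1 u (c * n.+1%:R)) /=.
by apply: (mk_mono markov_avg) => v; exact: IH.
Qed.

(** Observed at the times [j], [j + M], ..., the walk is the walk of [iter M avg]
    started after [j] steps. *)
Lemma Ew_thin_miss M (C : set V) k j n u : (0 < M)%N -> (j + M * k <= n)%N ->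
  Ew n u (fun s => (~~ has (fun x => `[< C x >]) (thin M j s))%:R) <=
  iter j avg (miss (iter M avg) C k) u.
Proof.
move=> M0; elim: k j n u => [|k IHk] j n u.
  move=> _; rewrite (mk1 (markov_iter j markov_avg)) -[leRHS](Ew_cst n u 1).
  by apply: Ew_le => s _; rewrite lern1; case: has.
have base n' v : (M * k.+1 <= n')%N ->
    Ew n' v (fun s => (~~ has (fun x => `[< C x >]) (thin M 0 s))%:R) <=
    miss (iter M avg) C k.+1 v.
  case: n' => [|n']; first by rewrite leqn0 muln_eq0 gtn_eqF.
  move=> Mn /=; case: asboolP => Cv.
    rewrite (_ : (fun x => _) = fun=> 0) ?(mk0 markov_avg) //.
    by apply/funext => x; rewrite -[RHS](Ew_cst n' x 0).
  rewrite -(prednK M0) iterS; apply: (mk_mono markov_avg) => x.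
  by rewrite prednK //; apply: IHk; move: Mn M0; rewrite mulnS; lia.
elim: j n u => [|j IHj] n u; first exact: base.
case: n => [|n]; first by rewrite addSn ltn0.
rewrite addSn ltnS => jn; rewrite iterS /=; apply: (mk_mono markov_avg) => x.
exact: IHj.
Qed.

End Average.

(** * Isoperimetry and transience *)

Section Isoperimetry.
Variables (R : realType) (V : pointedType) (G : sgraph V) (dg : nat).
Hypotheses (Glf : locally_finite G) (deg : forall u, degree G u = dg) (dg0 : (0 < dg)%N).

Definition bdry (L : seq V) := [seq v <- L | has (fun u => u \notin L) (nbr G v)].

Variable e : R.
Hypothesis e0 : 0 < e.
Hypothesis iso : forall L, uniq L -> e * (size L)%:R <= (size (bdry L))%:R.

Let pos (x : R) := Num.max 0 x.

(** Peel off the lowest positive level of [f]: on its support the isoperimetric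
    inequality applies, and each boundary vertex has an edge leaving the support. *)
Lemma coarea (L : seq V) (f : V -> R) : uniq L -> (forall v, 0 <= f v) ->
  (forall v, v \notin L -> f v = 0) ->
  e * \sum_(v <- L) f v <= \sum_(v <- L) \sum_(u <- nbr G v) pos (f v - f u).
Proof.
move=> uL; have [n] := ubnP (count (fun v => 0 < f v) L).
elim: n f => // n IH f cn f0 fL.
pose S := [seq v <- L | 0 < f v].
have uS : uniq S by exact: filter_uniq.
have inS v : (v \in S) = (0 < f v).
  rewrite mem_filter; case: (boolP (v \in L)) => [|/fL ->]; rewrite ?andbT ?ltxx //.
have notS v : v \notin S -> f v = 0.
  by rewrite inS -leNgt => h; apply/eqP; rewrite eq_le h f0.
have [S0|] := eqVneq S [::].
  have fz v : f v = 0 by apply: notS; rewrite S0.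
  rewrite big1 ?mulr0; last by move=> v _; exact: fz.
  rewrite big1 // => v _; rewrite big1 // => u _.
  by rewrite !fz subrr /pos maxxx.
move=> Sn0.
have exm : forall s : seq V, s != [::] ->
    exists2 m, (exists2 x, x \in s & f x = m) & forall v, v \in s -> m <= f v.
  elim=> // y s IHs _.
  have [->|/IHs[m [x xs fx] ms]] := eqVneq s [::].
    by exists (f y); [exists y; rewrite ?inE|move=> v; rewrite inE => /eqP ->].
  have [h|h] := leP (f y) m.
    exists (f y); first by exists y; rewrite ?mem_head.
    by move=> v; rewrite inE => /orP[/eqP -> //|/ms]; exact: le_trans.
  exists m; first by exists x => //; rewrite inE xs orbT.
  by move=> v; rewrite inE => /orP[/eqP ->|/ms //]; exact: ltW.
have [m [x xS mx] mS] := exm _ Sn0.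
have m0 : 0 < m by rewrite -mx -inS.
pose f' v := if v \in S then f v - m else 0.
have f'0 v : 0 <= f' v by rewrite /f'; case: ifP => // /mS; rewrite subr_ge0.
have f'L v : v \notin L -> f' v = 0.
  by move=> vL; rewrite /f' inS fL // ltxx.
have sub : {subset S <= L} by move=> v; rewrite inS; apply: contraTT => /fL ->; rewrite ltxx.
have h1 : e * \sum_(v <- L) f' v <= \sum_(v <- L) \sum_(u <- nbr G v) pos (f' v - f' u).
  apply: IH => //; rewrite -ltnS; apply: leq_trans cn.
  have xL := sub _ xS.
  rewrite ltnS (_ : count (fun v => (0 < f v)%R) L = ((count (fun v => (0 < f v)%R) (rem x L)).+1)%N); last first.
    by rewrite (permP (perm_to_rem xL)) /= -inS xS.
  rewrite (permP (perm_to_rem xL)) /= {1}/f' xS mx subrr ltxx add0n ltnS.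
  apply: sub_count => v /=; rewrite /f' inS; case: ifP => //; by rewrite ltxx.
have h2 : \sum_(v <- L) f v = \sum_(v <- L) f' v + m * (size S)%:R.
  have -> : m * (size S)%:R = \sum_(v <- S) m.
    by rewrite big_const_seq count_predT iter_addr_0 mulr_natr.
  rewrite -(sum_uniq_sub (s := S) (F := f)) //; last by move=> v _; exact: notS.
  rewrite -(sum_uniq_sub (s := S) (F := f')) //; last by move=> v _; rewrite /f' => /negbTE ->.
  rewrite -big_split; apply: eq_big_seq => v vS.
  by rewrite /f' vS /= subrK.
have h3 : m * (size (bdry S))%:R + \sum_(v <- L) \sum_(u <- nbr G v) pos (f' v - f' u) <=
    \sum_(v <- L) \sum_(u <- nbr G v) pos (f v - f u).
  have -> : m * (size (bdry S))%:R = \sum_(v <- L) (if (v \in S) && has (fun u => u \notin S) (nbr G v) then m else 0).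
    rewrite -big_mkcond big_const_seq iter_addr_0 mulr_natr; congr (_ *+ _).
    rewrite -size_filter; apply: perm_size; apply: uniq_perm; rewrite ?filter_uniq // => v.
    by rewrite !mem_filter; case: (0 < f v); case: (v \in L); case: (has _ _).
  rewrite -big_split; apply: ler_sum => v _ /=.
  have [vS|vS] /= := boolP (v \in S); last first.
    rewrite add0r; apply: ler_sum => u _; rewrite /f' (negbTE vS) (notS _ vS) !sub0r.
    rewrite /pos !max_l ?oppr_le0 //; exact: f'0.
  have term u : pos (f' v - f' u) + (if u \notin S then m else 0) <= pos (f v - f u).
    rewrite /f' vS; have [uS'|uS'] /= := boolP (u \in S).
      by rewrite addr0 opprB addrA subrK.
    rewrite (notS _ uS') !subr0 /pos !max_r ?subrK // ?subr_ge0 ?mS //.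
  apply: le_trans (ler_sum _ (fun u _ => term u)); rewrite big_split /= addrC lerD2l.
  have [/hasP[u un uS']|_] := boolP (has _ _); last first.
    by apply: sumr_ge0 => w _; case: ifP => // _; exact: ltW.
  rewrite (big_rem u) //= uS' lerDl.
  by apply: sumr_ge0 => w _; case: ifP => // _; exact: ltW.
rewrite h2 mulrDr; apply: le_trans h3; rewrite addrC; apply: lerD => //.
by rewrite mulrCA ler_pM2l //; exact: iso.
Qed.

Let dgR : 0 < (dg%:R : R). Proof. by rewrite ltr0n. Qed.

Lemma sum_neighbors_le (L : seq V) (F : V -> R) : uniq L -> (forall v, 0 <= F v) ->
  (forall v, v \notin L -> F v = 0) ->
  \sum_(v <- L) \sum_(u <- nbr G v) F u <= dg%:R * \sum_(v <- L) F v.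
Proof.
move=> uL F0 FL.
have -> : \sum_(v <- L) \sum_(u <- nbr G v) F u =
    \sum_(u <- L) \sum_(v <- L | v \in nbr G u) F u.
  rewrite [RHS](exchange_big_dep predT) //=; apply: eq_bigr => v _.
  rewrite (bigID (mem L)) /= [X in _ + X]big1 ?addr0; last by move=> u; exact: FL.
  rewrite sum_mem_swap ?nbr_uniq //; apply: eq_bigl => u.
  by rewrite !mem_nbr // adj_sym.
rewrite mulr_sumr; apply: ler_sum => u _.
rewrite big_const_seq iter_addr_0 -[leLHS]mulr_natl; apply: ler_wpM2r => //.
rewrite ler_nat -(deg u) -size_nbr -size_filter; apply: uniq_leq_size; first exact: filter_uniq.
by move=> v; rewrite mem_filter => /andP[].
Qed.

Lemma sum_self_neighbors (L : seq V) (F : V -> R) :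
  \sum_(v <- L) \sum_(u <- nbr G v) F v = dg%:R * \sum_(v <- L) F v.
Proof.
rewrite mulr_sumr; apply: eq_bigr => v _.
by rewrite big_const_seq count_predT iter_addr_0 size_nbr deg mulr_natl.
Qed.

(** Cheeger's inequality applied to the Green function stopped at time [n]: its
    energy is at most its value at [o], its square norm at least the square. *)
Lemma green_bounded n (o : V) :
  \sum_(k < n) iter k (avg G dg) (single R o) o <= (4 * dg%:R / e) ^+ 2 / 2.
Proof.
pose A := avg (R := R) G dg; have mA : markov A by exact: markov_avg.
pose f v := \sum_(k < n) iter k A (single R o) v.
pose L := undup (ball G n o).
have uL : uniq L by exact: undup_uniq.
have f0 v : 0 <= f v by apply: sumr_ge0 => k _; exact: single_ge0.
have fL v : v \notin L -> f v = 0.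
  rewrite mem_undup => vL; rewrite /f big1 // => k _; apply: single_support => //.
  apply: contra vL; rewrite ball_sym //; apply: ball_le => //; exact: ltnW.
have oL : o \in L by rewrite mem_undup ball_center.
rewrite -/(f o); set F := f o.
have Af v : f v - A f v <= single R o v.
  have -> : A f v = \sum_(k < n) iter k.+1 A (single R o) v by rewrite /f (mk_sum mA).
  have -> : f v = single R o v - iter n A (single R o) v + \sum_(k < n) iter k.+1 A (single R o) v.
    rewrite /f; elim: (n) => [|j IHj]; first by rewrite !big_ord0 subrr add0r.
    by rewrite big_ord_recr IHj /= [in RHS]big_ord_recr /= addrA -!addrA; congr (_ + _); rewrite addrC; lra.
  rewrite addrK lerBlDr lerDl; exact: single_ge0.
pose N2 := \sum_(v <- L) f v ^+ 2.
have f20 v : 0 <= f v ^+ 2 by exact: sqr_ge0.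
have f2L v : v \notin L -> f v ^+ 2 = 0 by move=> /fL ->; rewrite expr0n.
have nb := sum_neighbors_le uL f20 f2L.
have co := coarea uL f20 f2L.
have N2F : F ^+ 2 <= N2.
  by rewrite /N2 (big_rem o) //= lerDl; apply: sumr_ge0.
(* The weight [s] is such that the sum over edges of squared sums, at most
   [4 * dg * N2], is half of the left-hand side [2 * s * e * N2]. *)
pose s := 4 * dg%:R / e; have s0 : 0 < s by rewrite divr_gt0 // mulr_gt0.
have pt a b : 2 * s * pos (a ^+ 2 - b ^+ 2) <= s ^+ 2 * (a - b) ^+ 2 + (a + b) ^+ 2.
  rewrite /pos; case: (leP 0 (a ^+ 2 - b ^+ 2)) => _.
    by have := sqr_ge0 (s * (a - b) - (a + b)); rewrite !expr2; lra.
  by rewrite mulr0; apply: addr_ge0; [apply: mulr_ge0|]; exact: sqr_ge0.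
pose E1 := \sum_(v <- L) \sum_(u <- nbr G v) (f v - f u) ^+ 2.
pose E2 := \sum_(v <- L) \sum_(u <- nbr G v) (f v + f u) ^+ 2.
have h1 : 2 * s * (e * N2) <= s ^+ 2 * E1 + E2.
  have s20 : 0 <= 2 * s by lra.
  apply: le_trans (ler_wpM2l s20 co) _; rewrite /E1 /E2 !mulr_sumr -big_split.
  apply: ler_sum => v _; rewrite !mulr_sumr -big_split; apply: ler_sum => u _; exact: pt.
have h2 : E2 <= 4 * dg%:R * N2.
  apply: (@le_trans _ _ (2 * (dg%:R * N2) + 2 * (dg%:R * N2))); last lra.
  rewrite /N2 -{1}sum_self_neighbors; apply: (@le_trans _ _ (2 * (\sum_(v <- L) \sum_(u <- nbr G v) f v ^+ 2) +
     2 * \sum_(v <- L) \sum_(u <- nbr G v) f u ^+ 2)); last by rewrite lerD2l ler_pM2l.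
  rewrite !mulr_sumr -big_split; apply: ler_sum => v _; rewrite !mulr_sumr -big_split.
  by apply: ler_sum => u _ /=; have := sqr_ge0 (f v - f u); rewrite sqrrB sqrrD; lra.
have h3 : E1 <= 2 * dg%:R * F.
  have : E1 <= 2 * dg%:R * \sum_(v <- L) f v * (f v - A f v).
    have -> : 2 * dg%:R * \sum_(v <- L) f v * (f v - A f v) =
        dg%:R * N2 - 2 * (\sum_(v <- L) \sum_(u <- nbr G v) f v * f u) + dg%:R * N2.
      have -> : \sum_(v <- L) \sum_(u <- nbr G v) f v * f u = dg%:R * \sum_(v <- L) f v * A f v.
        rewrite mulr_sumr; apply: eq_bigr => v _; rewrite -mulr_sumr mulrCA; congr (_ * _).
        by rewrite /A /avg mulVKf // gt_eqF.
      rewrite (_ : \sum_(v <- L) f v * (f v - A f v) = N2 - \sum_(v <- L) f v * A f v); last first.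
        by rewrite /N2 -sumrB; apply: eq_bigr => v _; rewrite mulrBr.
      by rewrite mulrBr; lra.
    apply: (@le_trans _ _ (dg%:R * N2 - 2 * (\sum_(v <- L) \sum_(u <- nbr G v) f v * f u) +
      \sum_(v <- L) \sum_(u <- nbr G v) f u ^+ 2)); last by rewrite lerD2l.
    rewrite /N2 -sum_self_neighbors mulr_sumr -sumrB -big_split; apply: ler_sum => v _.
    rewrite mulr_sumr -sumrB -big_split; apply: ler_sum => u _ /=.
    by rewrite sqrrB; lra.
  move=> h; apply: le_trans h _; rewrite ler_pM2l ?mulr_gt0 //.
  apply: (@le_trans _ _ (\sum_(v <- L) f v * single R o v)).
    by apply: ler_sum => v _; rewrite ler_wpM2l.
  rewrite (big_rem o) //= /single eqxx mulr1 big1_seq ?addr0 // => v /=.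
  by rewrite mem_rem_uniq // inE => /andP[/negbTE -> _]; rewrite mulr0.
have F0 : 0 <= F by exact: f0.
have es : s * e = 4 * dg%:R by rewrite /s mulfVK // gt_eqF.
have h4 : 2 * N2 <= s ^+ 2 * F.
  rewrite -(ler_pM2l dgR); have := ler_wpM2l (sqr_ge0 s) h3.
  have : 2 * s * (e * N2) = 2 * (s * e) * N2 by rewrite !mulrA.
  by rewrite es => h5; move: h1 h2; rewrite h5; lra.
have [->|Fn0] := eqVneq F 0; first by rewrite mulr_ge0 ?sqr_ge0.
have Fp : 0 < F by rewrite lt_def Fn0.
by rewrite -/s -(ler_pM2r Fp) -expr2; move: h4 N2F; lra.
Qed.

End Isoperimetry.

(** * Mass transport *)

Section MassTransport.
Variables (R : realType) (V : pointedType) (G : sgraph V).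
Hypothesis Glf : locally_finite G.

Lemma count_card_eq (B : seq V) (A A' : set V) : uniq B ->
  (forall v, A v -> v \in B) -> (forall v, A' v -> v \in B) -> (A #= A')%card ->
  count (fun v => `[< A v >]) B = count (fun v => `[< A' v >]) B.
Proof.
move=> uB AB AB' AA.
have cE (C : set V) : (forall v, C v -> v \in B) ->
    count (fun v => `[< C v >]) B = size (fset_set C : seq V).
  move=> CB; rewrite -size_filter; apply: perm_size; apply: uniq_perm.
  - exact: filter_uniq.
  - exact: fset_uniq.
  move=> v; rewrite mem_filter in_fset_set; last exact: finite_subset_seq CB.
  apply/andP/idP => [[/asboolP Cv _]|]; first by rewrite inE.
  by move=> /set_mem Cv; split; [exact/asboolP|exact: CB].
rewrite !cE //; apply/fcard_eq => //; [exact: finite_subset_seq AB|exact: finite_subset_seq AB'].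
Qed.

(** The pairs [(v, o)] and [(o, w)] lying in one orbit carry the same mass, and by
    the equality of stabilizer orbits each [v] has as many partners [w] as there
    are vertices in its own orbit under the stabilizer of [o]; spreading the mass
    evenly over partners gives both sides. *)
Lemma mass_transport (Gam : set (V -> V)) (F : V -> V -> R) o n :
  aut_subgroup G Gam -> transitive_on_vertices Gam ->
  (forall u v, (stab_orbit Gam v u #= stab_orbit Gam u v)%card) ->
  (forall g u v, Gam g -> F (g u) (g v) = F u v) ->
  \sum_(v <- undup (ball G n o)) F o v = \sum_(v <- undup (ball G n o)) F v o.
Proof.
move=> [Gaut Gid Gcomp Ginv] Gt Gcard GF.
set B := undup (ball G n o); have uB : uniq B by exact: undup_uniq.
have inB v : (v \in B) = (v \in ball G n o) by rewrite mem_undup.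
pose S v := stab_orbit Gam o v.
pose N v w := exists g, [/\ Gam g, g v = o & g o = w].
have SB v x : v \in B -> S v x -> x \in B.
  move=> vB [f [Gf /= fo] <-]; rewrite inB -{1}fo ball_aut -?inB //; exact: Gaut.
have NB v w : v \in B -> N v w -> w \in B.
  move=> vB [g [Gg gv <-]]; rewrite inB ball_sym // -{1}gv ball_aut -?inB //; exact: Gaut.
have Sv v : S v v by exists id.
have Ssym v x : S v x -> S x v.
  move=> [f [Gf /= fo] <-]; have [g [Gg fg gf]] := Ginv f Gf.
  by exists g; rewrite ?fg //; split=> //=; rewrite -{1}fo fg.
have Strans v x y : S v x -> S x y -> S v y.
  move=> [f [Gf /= fo] <-] [g [Gg /= go] <-]; exists (g \o f) => //=.
  by split; [exact: Gcomp|rewrite /= fo].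
have Seq v x : S v x -> S x = S v.
  move=> vx; apply/seteqP; split=> y; first exact: Strans vx.
  by apply: Strans; exact: Ssym.
have NS v x w : N v w -> S v x <-> N x w.
  move=> [g [Gg gv gw]]; split=> [[f [Gf /= fo] <-]|[f [Gf fx fw]]].
    have [f' [Gf' ff' f'f]] := Ginv f Gf; exists (g \o f'); split=> /=.
    - exact: Gcomp.
    - by rewrite ff'.
    - by rewrite -{1}fo ff'.
  have [f' [Gf' ff' f'f]] := Ginv f Gf; exists (f' \o g); last by rewrite /= gv -fx ff'.
  by split; [exact: Gcomp|rewrite /= gw -fw ff'].
pose c v := count (fun x => `[< S v x >]) B.
have cN v : v \in B -> count (fun w => `[< N v w >]) B = c v.
  move=> vB; have [g Gg gv] := Gt v o; have [g' [Gg' gg' g'g]] := Ginv g Gg.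
  apply: count_card_eq => //; [by move=> w; exact: NB|by move=> x; exact: SB|].
  apply: card_eq_trans (Gcard o v).
  have -> : N v = g @` stab_orbit Gam v o.
    apply/seteqP; split=> [w [f [Gf fv fw]]|w [x [f [Gf /= fv] <-] <-]].
      exists (g' w); last by rewrite g'g.
      exists (g' \o f); last by rewrite /= fw.
      by split; [exact: Gcomp|rewrite /= fv -gv gg'].
    by exists (g \o f); split => //; [exact: Gcomp|rewrite /= fv].
  apply: inj_card_eq => x y _ _; exact: (can_inj gg').
have c0 v : v \in B -> (c v)%:R != 0 :> R.
  move=> vB; rewrite pnatr_eq0 -lt0n -has_count; apply/hasP; exists v => //.
  exact/asboolP/Sv.
have sum_count (A : set V) : \sum_(v <- B) (`[< A v >])%:R = (count (fun v => `[< A v >]) B)%:R :> R.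
  rewrite -natr_sum; congr (_%:R); rewrite -sum1_count [RHS]big_mkcond.
  by apply: eq_bigr => v _; case: asboolP.
transitivity (\sum_(v <- B) \sum_(w <- B) (`[< N v w >])%:R / (c v)%:R * F o v).
  apply: eq_big_seq => v vB; rewrite -mulr_suml -mulr_suml sum_count cN // divff ?mul1r //.
  exact: c0.
rewrite exchange_big; apply: eq_big_seq => w wB.
transitivity (\sum_(v <- B) (`[< N v w >])%:R / (c v)%:R * F w o).
  apply: eq_bigr => v _; case: asboolP => [[g [Gg gv gw]]|_]; last by rewrite !mul0r.
  by rewrite -(GF g o v Gg) gv gw.
rewrite -mulr_suml; have [g Gg gw] := Gt o w; have [g' [Gg' gg' g'g]] := Ginv g Gg.
pose v0 := g' o; have N0 : N v0 w by exists g; split => //; rewrite /v0 g'g.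
have v0B : v0 \in B.
  rewrite inB -(ball_aut Glf n o v0 (Gaut _ Gg)) /v0 g'g gw ball_sym // -inB //.
rewrite (eq_bigr (fun v => (`[< S v0 v >])%:R / (c v0)%:R)); last first.
  move=> v _; have [h1 h2] := NS _ v _ N0.
  case: (asboolP (S v0 v)) => [sv|nsv]; last first.
    by rewrite asboolF ?mul0r // => /h2.
  by rewrite asboolT ?mul1r; [rewrite /c (Seq _ _ sv)|exact: h1].
by rewrite -mulr_suml sum_count -/(c v0) divff ?mul1r //; exact: c0.
Qed.

End MassTransport.

(** * Events and expectations *)

Section Expectation.
Variables (R : realType) (d : measure_display) (T : measurableType d).
Variable mu : probability T R.
Implicit Types (P Q : T -> Prop) (f g : T -> R).

Definition mP P := measurable [set w | P w].
Definition pr P : R := fine (mu [set w | P w]).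
Definition ind P (w : T) : R := (`[< P w >])%:R.

Lemma mP_not P : mP P -> mP (fun w => ~ P w).
Proof. by move=> h; rewrite /mP -[X in measurable X]/(~` [set w | P w]); exact: measurableC. Qed.

Lemma mP_and P Q : mP P -> mP Q -> mP (fun w => P w /\ Q w).
Proof. by move=> h k; exact: measurableI. Qed.

Lemma mP_or P Q : mP P -> mP Q -> mP (fun w => P w \/ Q w).
Proof. by move=> h k; exact: measurableU. Qed.

Lemma mP_cst (P : Prop) : mP (fun=> P).
Proof.
have [p|p] := pselect P.
  by rewrite /mP (_ : [set _ | _] = setT) //; apply/seteqP; split.
by rewrite /mP (_ : [set _ | _] = set0) //; apply/seteqP; split.
Qed.

Lemma mP_eq P Q : (forall w, P w <-> Q w) -> mP P -> mP Q.
Proof.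
by move=> PQ; rewrite /mP (_ : [set w | Q w] = [set w | P w]) //; apply/seteqP; split=> w /PQ.
Qed.

Lemma mP_imp P Q : mP P -> mP Q -> mP (fun w => P w -> Q w).
Proof.
move=> h k; apply: (@mP_eq (fun w => ~ P w \/ Q w)); last exact: mP_or (mP_not h) k.
by move=> w; split=> [[//|//]|PQ]; have [/PQ|] := pselect (P w); [right|left].
Qed.

Lemma mP_ex (I : Type) (e : nat -> I) (F : I -> T -> Prop) : (forall i, exists n, e n = i) ->
  (forall i, mP (F i)) -> mP (fun w => exists i, F i w).
Proof.
move=> es h; rewrite /mP (_ : [set _ | _] = \bigcup_n [set w | F (e n) w]).
  by apply: bigcupT_measurable => n; exact: h.
apply/seteqP; split=> [w [i]|w [n _]] /=; last by exists (e n).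
by have [n <-] := es i; exists n.
Qed.

Lemma mP_exn (F : nat -> T -> Prop) : (forall i, mP (F i)) -> mP (fun w => exists i, F i w).
Proof. by apply: (@mP_ex _ id) => i; exists i. Qed.

Lemma mP_all (I : Type) (e : nat -> I) (F : I -> T -> Prop) : (forall i, exists n, e n = i) ->
  (forall i, mP (F i)) -> mP (fun w => forall i, F i w).
Proof.
move=> es h; apply: (@mP_eq (fun w => ~ exists i, ~ F i w)).
  move=> w; split=> [nF i|F' [i]]; last by apply; exact: F'.
  by apply: contrapT => nFi; apply: nF; exists i.
by apply: mP_not; apply: mP_ex es _ => i; exact: mP_not.
Qed.

Lemma mP_alln (F : nat -> T -> Prop) : (forall i, mP (F i)) -> mP (fun w => forall i, F i w).
Proof. by apply: (@mP_all _ id) => i; exists i. Qed.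

Lemma mP_all_seq (I : eqType) (s : seq I) (F : I -> T -> Prop) :
  (forall i, mP (F i)) -> mP (fun w => forall i, i \in s -> F i w).
Proof.
move=> h; elim: s => [|x s IH].
  by apply: (mP_eq _ (mP_cst True)) => w; split.
apply: (mP_eq _ (mP_and (h x) IH)) => w; split=> [[hx hs] i|H].
  by rewrite inE => /orP[/eqP ->|/hs].
by split=> [|i iS]; apply: H; rewrite inE ?eqxx // iS orbT.
Qed.

Lemma pr_ge0 P : 0 <= pr P.
Proof. exact/fine_ge0/measure_ge0. Qed.

Lemma prE P : mP P -> mu [set w | P w] = (pr P)%:E.
Proof. by move=> h; rewrite fineK // fin_num_measure. Qed.

Lemma pr_le P Q : mP P -> mP Q -> (forall w, P w -> Q w) -> pr P <= pr Q.
Proof.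
move=> h k PQ; rewrite -lee_fin -!prE //; apply: le_measure; rewrite ?inE //.
Qed.

Lemma pr_le1 P : mP P -> pr P <= 1.
Proof. by move=> h; rewrite -lee_fin -prE //; exact: probability_le1. Qed.

Lemma pr_eq0 P : mP P -> pr P = 0 -> mu [set w | P w] = 0%E.
Proof. by move=> h p0; rewrite prE // p0. Qed.

Definition bnd f := measurable_fun setT f /\ exists c, forall w, `|f w| <= c.

Lemma bnd_cst c : bnd (fun=> c).
Proof. by split; [exact: measurable_cst|exists `|c|]. Qed.

Lemma bndD f g : bnd f -> bnd g -> bnd (fun w => f w + g w).
Proof.
move=> [mf [c fc]] [mg [c' gc]]; split; first exact: measurable_funD.
by exists (c + c') => w; apply: le_trans (ler_normD _ _) _; exact: lerD.
Qed.

Lemma bndM f g : bnd f -> bnd g -> bnd (fun w => f w * g w).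
Proof.
move=> [mf [c fc]] [mg [c' gc]]; split; first exact: measurable_funM.
by exists (c * c') => w; rewrite normrM; apply: ler_pM.
Qed.

Lemma bndZ c f : bnd f -> bnd (fun w => c * f w).
Proof. by move=> h; apply: bndM => //; exact: bnd_cst. Qed.

Lemma bndB f g : bnd f -> bnd g -> bnd (fun w => f w - g w).
Proof.
move=> hf hg; rewrite (_ : (fun w => _) = (fun w => f w + (-1) * g w)).
  by apply: bndD => //; exact: bndZ.
by apply/funext => w; rewrite mulN1r.
Qed.

Lemma bnd_sum (I : eqType) (s : seq I) (F : I -> T -> R) : (forall i, i \in s -> bnd (F i)) ->
  bnd (fun w => \sum_(i <- s) F i w).
Proof.
elim: s => [|x s IH] h.
  by rewrite (_ : (fun w => _) = fun=> 0); [exact: bnd_cst|apply/funext => w; rewrite big_nil].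
rewrite (_ : (fun w => _) = fun w => F x w + \sum_(i <- s) F i w).
  by apply: bndD; [apply: h; rewrite mem_head|apply: IH => i iS; apply: h; rewrite inE iS orbT].
by apply/funext => w; rewrite big_cons.
Qed.

Lemma bnd_ind P : mP P -> bnd (ind P).
Proof.
move=> h; split; last by exists 1 => w; rewrite /ind; case: asboolP; rewrite ?normr1 ?normr0.
rewrite (_ : ind P = \1_[set w | P w]); first exact: measurable_indic.
by apply/funext => w; rewrite /ind indicE; congr (_%:R); apply/asboolP/idP; rewrite inE.
Qed.

Lemma bnd_if P f g : mP P -> bnd f -> bnd g -> bnd (fun w => if `[< P w >] then f w else g w).
Proof.
move=> hP hf hg.
rewrite (_ : (fun w => _) = (fun w => ind P w * f w + ind (fun w => ~ P w) w * g w)).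
  by apply: bndD; apply: bndM => //; apply: bnd_ind => //; exact: mP_not.
apply/funext => w; rewrite /ind; case: asboolP => p; rewrite ?mul1r ?mul0r.
  by rewrite asboolF ?mul0r ?addr0 // => np; exact: np.
by rewrite asboolT // mul1r add0r.
Qed.

Lemma bnd_lim (F : nat -> T -> R) f c : (forall n, bnd (F n)) -> (forall n w, `|F n w| <= c) ->
  (forall w, (fun n => F n w) @ \oo --> f w) -> bnd f.
Proof.
move=> hF Fc Ff; split.
  by apply: (measurable_fun_cvg (fun n => (hF n).1)) => w _; exact: Ff.
exists c => w; have h : (fun n => `|F n w|) @ \oo --> `|f w| by exact: cvg_norm.
by apply: (ler_cvg_to h (cvg_cst c)); exact: nearW.
Qed.

Lemma mP_le f g : bnd f -> bnd g -> mP (fun w => f w <= g w).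
Proof.
move=> [mf _] [mg _]; have h := measurable_fun_ler mf mg.
have := h measurableT [set true] I; rewrite setTI.
by apply: mP_eq => w /=.
Qed.

Lemma mP_eqf f c : bnd f -> mP (fun w => f w = c).
Proof.
move=> hf; have hc := bnd_cst c.
apply: (mP_eq _ (mP_and (mP_le hf hc) (mP_le hc hf))) => w; split=> [[a b]|->] //.
by apply/eqP; rewrite eq_le a b.
Qed.

Lemma mP_neqf f c : bnd f -> mP (fun w => f w != c).
Proof.
move=> h; apply: (mP_eq (P := fun w => ~ (f w = c))); first by move=> w; split=> /eqP.
by apply: mP_not; exact: mP_eqf.
Qed.

Definition Ex f : R := \int[mu]_w f w.

Let bnd_int f : bnd f -> mu.-integrable setT (EFin \o f).
Proof.
move=> [mf [c fc]]; apply: measurable_bounded_integrable => //.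
  by apply: (@le_lt_trans _ _ 1%E); [exact: probability_le1|exact: ltry].
exists c; split; first exact: num_real.
by move=> x cx w _; apply: le_trans (fc w) _; exact: ltW.
Qed.

Lemma ExD f g : bnd f -> bnd g -> Ex (fun w => f w + g w) = Ex f + Ex g.
Proof. by move=> hf hg; exact: RintegralD (bnd_int hf) (bnd_int hg). Qed.

Lemma ExZ c f : bnd f -> Ex (fun w => c * f w) = c * Ex f.
Proof. by move=> hf; exact: RintegralZl (bnd_int hf). Qed.

Lemma Ex_cst c : Ex (fun=> c) = c.
Proof.
rewrite /Ex Rintegral_cst // -[RHS]mulr1 -[1 in RHS]/(fine (1%E : \bar R)).
by congr (_ * fine _); exact: probability_setT.
Qed.

Lemma Ex_sum (I : eqType) (s : seq I) (F : I -> T -> R) : (forall i, i \in s -> bnd (F i)) ->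
  Ex (fun w => \sum_(i <- s) F i w) = \sum_(i <- s) Ex (F i).
Proof.
elim: s => [|x s IH] h.
  rewrite big_nil -[RHS](Ex_cst 0); congr (Ex _); apply/funext => w; by rewrite big_nil.
have hs i : i \in s -> bnd (F i) by move=> iS; apply: h; rewrite inE iS orbT.
rewrite big_cons -IH // -ExD; [|by apply: h; rewrite mem_head|exact: bnd_sum].
by congr (Ex _); apply/funext => w; rewrite big_cons.
Qed.

Lemma Ex_le f g : bnd f -> bnd g -> (forall w, f w <= g w) -> Ex f <= Ex g.
Proof. by move=> hf hg fg; apply: le_Rintegral => //; exact: bnd_int. Qed.

Lemma Ex_ind P : mP P -> Ex (ind P) = pr P.
Proof.
move=> h; rewrite /Ex /Rintegral /pr; congr fine.
rewrite (_ : (fun w => (ind P w)%:E) = (fun w => (\1_[set w | P w] w)%:E)).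
  by rewrite integral_indic // setIT.
by apply/funext => w; congr (_%:E); rewrite /ind indicE; congr (_%:R).
Qed.

Lemma Ex_lim (F : nat -> T -> R) f c : (forall n, bnd (F n)) -> (forall n w, `|F n w| <= c) ->
  (forall w, (fun n => F n w) @ \oo --> f w) -> (fun n => Ex (F n)) @ \oo --> Ex f.
Proof.
move=> hF Fc Ff; have hf := bnd_lim hF Fc Ff.
have [] := @dominated_convergence _ _ _ mu setT measurableT (fun n => EFin \o F n) (EFin \o f)
  (EFin \o cst c).
- by move=> n; apply/measurable_EFinP; case: (hF n).
- by apply/measurable_EFinP; case: hf.
- by apply: aeW => w _ /=; apply: cvg_EFin; [exact: nearW|exact: Ff].
- exact: bnd_int (bnd_cst c).
- by apply: aeW => w n _ /=; rewrite lee_fin.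
move=> _ _ h; rewrite /Ex /Rintegral; apply: fine_cvg.
rewrite fineK; first exact: h.
by apply: integrable_fin_num => //; exact: bnd_int.
Qed.

(** Markov's inequality at every level [b]. *)
Lemma blow_up_null (F : nat -> T -> R) c P : (forall n, bnd (F n)) -> (forall n w, 0 <= F n w) ->
  (forall n w, F n w <= F n.+1 w) -> (forall n, Ex (F n) <= c) -> mP P ->
  (forall w, P w -> forall b, exists n, b <= F n w) -> pr P = 0.
Proof.
move=> hF F0 Finc Fc hP hb.
have F_mono w : {homo (fun n => F n w) : n m / (n <= m)%N >-> n <= m}.
  by apply/nondecreasing_seqP => n; exact: Finc.
have key b : 0 < b -> b * pr P <= c.
  move=> b0; pose A n := [set w | P w /\ b <= F n w].
  have mA n : mP (fun w => P w /\ b <= F n w) by apply: mP_and => //; exact: mP_le (bnd_cst b) _.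
  have UA : \bigcup_n A n = [set w | P w].
    apply/seteqP; split=> [w [n _ []] //|w Pw].
    by have [n bn] := hb w Pw b; exists n.
  have cA : (fun n => pr (fun w => P w /\ b <= F n w)) @ \oo --> pr P.
    rewrite /pr -UA; apply: fine_cvg; rewrite fineK; last by rewrite UA fin_num_measure.
    apply: nondecreasing_cvg_mu => //; first by rewrite UA.
    move=> n m nm; apply/subsetPset => w [Pw bw]; split=> //.
    by apply: le_trans bw _; exact: F_mono.
  have cA' : (fun n => b * pr (fun w => P w /\ b <= F n w)) @ \oo --> b * pr P by exact: cvgMr.
  apply: (ler_cvg_to cA' (cvg_cst c)); apply: nearW => n /=.
  apply: le_trans (Fc n); rewrite -Ex_ind // -ExZ; last exact: bnd_ind.
  apply: Ex_le => //; first by apply: bndZ; exact: bnd_ind.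
  move=> w; rewrite /ind; case: asboolP => [[_ h]|_]; rewrite ?mulr1 ?mulr0 //.
have c0 : 0 <= c by apply: le_trans (key 1 ltr01); rewrite mul1r pr_ge0.
apply/eqP; rewrite eq_le pr_ge0 andbT leNgt; apply/negP => p0.
have : ((c + 1) / pr P) * pr P <= c by apply: key; rewrite divr_gt0 //; lra.
by rewrite mulfVK ?gt_eqF //; lra.
Qed.

Lemma sum_pr_le (I : eqType) (s : seq I) (F : I -> T -> Prop) c : (forall i, mP (F i)) ->
  (forall w, \sum_(i <- s) ind (F i) w <= c) -> \sum_(i <- s) pr (F i) <= c.
Proof.
move=> mF h; rewrite -[leRHS]Ex_cst.
rewrite (eq_bigr (fun i => Ex (ind (F i)))); last by move=> i _; rewrite Ex_ind.
rewrite -Ex_sum; last by move=> i _; exact: bnd_ind.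
apply: Ex_le => //; [apply: bnd_sum => i _; exact: bnd_ind|exact: bnd_cst].
Qed.

Lemma pr_or_le P Q : mP P -> mP Q -> pr (fun w => P w \/ Q w) <= pr P + pr Q.
Proof.
move=> hP hQ; rewrite -!Ex_ind //; last exact: mP_or.
rewrite -ExD; [|exact: bnd_ind..].
apply: Ex_le; [apply: bnd_ind; exact: mP_or|by apply: bndD; exact: bnd_ind|].
move=> w; rewrite /ind; case: (asboolP (P w \/ Q w)) => [[p|q]|_].
- by rewrite [ `[< P w >] ]asboolT // lerDl ler0n.
- by rewrite [ `[< Q w >] ]asboolT // lerDr ler0n.
- by rewrite addr_ge0 ?ler0n.
Qed.

Lemma pr_true : pr (fun=> True) = 1.
Proof.
rewrite -(Ex_ind (mP_cst True)) -[RHS](Ex_cst 1); congr (Ex _).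
by apply/funext => w; rewrite /ind asboolT.
Qed.

Lemma pr_not P : mP P -> pr (fun w => ~ P w) = 1 - pr P.
Proof.
move=> mp; have mn := mP_not mp; apply/eqP; rewrite eq_sym subr_eq -!Ex_ind // -ExD; [|exact: bnd_ind..].
rewrite -[eqbLHS](Ex_cst); apply/eqP; congr (Ex _); apply/funext => w.
rewrite /ind; case: (asboolP (P w)) => p; first by rewrite asboolF ?add0r // => /(_ p).
by rewrite asboolT // addr0.
Qed.

Lemma pr_split (V : eqType) (X : T -> V) (s : seq V) P : uniq s -> mP P ->
  (forall v, mP (fun w => X w = v)) ->
  pr P = \sum_(v <- s) pr (fun w => P w /\ X w = v) + pr (fun w => P w /\ X w \notin s).
Proof.
move=> us mp mX.
have mv v : mP (fun w => P w /\ X w = v) by exact: mP_and.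
have mo : mP (fun w => P w /\ X w \notin s).
  apply: mP_and => //; apply: (mP_eq (P := fun w => forall v, v \in s -> ~ X w = v)).
    move=> w; split=> [h|/negP h v vs e]; first by apply/negP => /h.
    by apply: h; rewrite e.
  by apply: mP_all_seq => v; exact: mP_not.
rewrite (eq_bigr (fun v => Ex (ind (fun w => P w /\ X w = v)))); last by move=> v _; rewrite Ex_ind.
rewrite -!Ex_ind // -Ex_sum; last by move=> v _; exact: bnd_ind.
rewrite -ExD; [|by apply: bnd_sum => v _; exact: bnd_ind|exact: bnd_ind].
congr (Ex _); apply/funext => w; rewrite /ind.
have [p|np] := pselect (P w); last first.
  rewrite asboolF // asboolF ?addr0; last by case.
  by rewrite big1 // => v _; rewrite asboolF // => -[].
rewrite asboolT //; have [xs|xs] := boolP (X w \in s).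
  rewrite (bigD1_seq (X w)) //= asboolT // big1 => [|v /eqP nv]; last first.
    by rewrite asboolF // => -[_ e]; apply: nv.
  by rewrite asboolF ?addr0 // => -[].
rewrite asboolT // big1_seq ?add0r // => v /= vs.
by rewrite asboolF // => -[_ e]; move: xs; rewrite e vs.
Qed.

Lemma pr_ex_null (I : Type) (e : nat -> I) (F : I -> T -> Prop) : (forall i, exists n, e n = i) ->
  (forall i, mP (F i)) -> (forall i, pr (F i) = 0) -> pr (fun w => exists i, F i w) = 0.
Proof.
move=> es mF F0; rewrite /pr.
have -> : mu [set w | exists i, F i w] = 0%E; last by [].
apply/negligibleP; first exact: mP_ex es mF.
rewrite (_ : [set w | _] = \bigcup_n [set w | F (e n) w]).
  apply: negligible_bigcup => n; apply/negligibleP; first exact: mF.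
  exact: pr_eq0.
apply/seteqP; split=> [w [i]|w [n _]] /=; last by exists (e n).
by have [n <-] := es i; exists n.
Qed.

End Expectation.

(** * Measurability of cluster events *)

Section EventMeasurability.
Variables (R : realType) (V : pointedType) (G : sgraph V) (dg : nat) (o : V).
Hypotheses (Glf : locally_finite G) (Gc : connected_graph G).
Hypotheses (deg : forall u, degree G u = dg) (dg0 : (0 < dg)%N).
Variables (d : measure_display) (T : measurableType d).
Implicit Types (rho : T -> V -> V -> Prop) (C : T -> set V).

Local Notation A := (avg (R := R) G dg).

Definition mrel rho := forall u v, mP (fun w => rho w u v).
Definition mset C := forall v, mP (fun w => C w v).
Definition bfun (f : T -> V -> R) := forall v, bnd (fun w => f w v).

Lemma mP_exV (F : V -> T -> Prop) : (forall v, mP (F v)) -> mP (fun w => exists v, F v w).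
Proof. by move=> h; apply: (mP_ex (e := enumV G o)) => // v; exact: enumV_surj. Qed.

Lemma mP_allV (F : V -> T -> Prop) : (forall v, mP (F v)) -> mP (fun w => forall v, F v w).
Proof. by move=> h; apply: (mP_all (e := enumV G o)) => // v; exact: enumV_surj. Qed.

Definition enum_seq (n : nat) : seq V :=
  if @choice.unpickle (seq nat) n is Some s then map (enumV G o) s else [::].

Lemma enum_seq_surj (s : seq V) : exists n, enum_seq n = s.
Proof.
have [f hf] : exists f : V -> nat, forall v, enumV G o (f v) = v.
  by have /choice[f hf] := enumV_surj Glf o Gc; exists f.
exists (choice.pickle (map f s)); rewrite /enum_seq choice.pickleK -map_comp.
by rewrite -[RHS]map_id; apply: eq_map => v /=.
Qed.

Definition enum_pairs (n : nat) : seq (V * V) :=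
  if @choice.unpickle (nat * nat)%type n is Some (a, b) then zip (enum_seq a) (enum_seq b) else [::].

Lemma enum_pairs_surj (s : seq (V * V)) : exists n, enum_pairs n = s.
Proof.
have [a ha] := enum_seq_surj (unzip1 s); have [b hb] := enum_seq_surj (unzip2 s).
by exists (choice.pickle (a, b)); rewrite /enum_pairs choice.pickleK ha hb zip_unzip.
Qed.

(** Connection by a path of given length is a countable combination of events. *)
Fixpoint reach (r : V -> V -> Prop) n u v :=
  if n is m.+1 then exists x, r u x /\ reach r m x v else u = v.

Lemma conn_reach (r : V -> V -> Prop) u v : conn r u v <-> exists n, reach r n u v.
Proof.
split=> [|[n]]; last first.
  elim: n u => [|n IH] u /=; first by move=> ->; exact: conn_refl.
  by move=> [x [ux /IH]]; apply: conn_trans; exact: conn_step.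
elim/conn_ind_l => [|x y xy _ [n yn]]; first by exists 0%N.
by exists n.+1, y.
Qed.

Lemma mrel_conn rho : mrel rho -> mrel (fun w => conn (rho w)).
Proof.
move=> h u v; apply: (mP_eq (P := fun w => exists n, reach (rho w) n u v)).
  by move=> w; rewrite conn_reach.
apply: mP_exn => n; elim: n u => [|n IH] u /=; first exact: mP_cst.
by apply: mP_exV => x; apply: mP_and.
Qed.

Lemma mrel_avoid rho B : mrel rho -> mrel (fun w => avoid (rho w) B).
Proof.
move=> h u v; apply: (mP_eq (P := fun w => rho w u v /\ (u \notin B /\ v \notin B))).
  by move=> w; split=> [[? []]|[]].
by apply: mP_and => //; exact: mP_cst.
Qed.

Lemma mrel_cut rho F : mrel rho -> mrel (fun w => cut (rho w) F).
Proof.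
move=> h u v.
apply: (mP_eq (P := fun w => rho w u v /\ ((u, v) \notin F /\ (v, u) \notin F))).
  by move=> w; split=> [[? []]|[]].
by apply: mP_and => //; exact: mP_cst.
Qed.

Lemma mset_clus rho v : mrel rho -> mset (fun w => clus (rho w) v).
Proof. by move=> h u; exact: mrel_conn. Qed.

Lemma bfun_avg f : bfun f -> bfun (fun w => A (f w)).
Proof. by move=> h v; apply: bndZ; apply: bnd_sum => x _; exact: h. Qed.

Lemma bfun_iter n f : bfun f -> bfun (fun w => iter n A (f w)).
Proof. by move=> h; elim: n => //= n IH; exact: bfun_avg. Qed.

Section Hitting.
Variables (M : nat) (C : T -> set V).
Hypothesis mC : mset C.
Let Q := iter M A.
Let mQ : markov Q. Proof. by apply: markov_iter; exact: markov_avg. Qed.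

Lemma bfun_miss n : bfun (fun w => miss Q (C w) n).
Proof.
elim: n => [|n IH] v /=; first exact: bnd_cst.
by apply: bnd_if => //; [exact: bnd_cst|exact: bfun_iter].
Qed.

Lemma bfun_never : bfun (fun w => never Q (C w)).
Proof.
move=> v; apply: (bnd_lim (c := 1) (fun n => bfun_miss n v)) => [n w|w].
  by rewrite ger0_norm ?miss_le1 // miss_ge0.
exact: cvg_miss.
Qed.

Lemma bfun_noreturn : bfun (fun w => noreturn Q (C w)).
Proof. exact: bfun_iter bfun_never. Qed.

Lemma bfun_finitely : bfun (fun w => finitely Q (C w)).
Proof.
move=> v; apply: (bnd_lim (F := fun n w => iter n Q (never Q (C w)) v) (c := 1)) => [n|n w|w].
- move: v; change (bfun (fun w => iter n Q (never Q (C w)))).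
  elim: n => [|n IH]; first exact: bfun_never.
  exact: (@bfun_iter M _ IH).
- have mn := markov_iter n mQ.
  rewrite ger0_norm; first by apply: (mk_le1 mn) => x; exact: never_le1.
  by apply: (mk_ge0 mn) => x; exact: never_ge0.
exact: cvg_finitely.
Qed.

Lemma bfun_infinitely : bfun (fun w => infinitely Q (C w)).
Proof. by move=> v; apply: bndB; [exact: bnd_cst|exact: bfun_finitely]. Qed.

End Hitting.

Lemma infinite_setE (B : set V) : infinite_set B <-> forall s : seq V, exists v, B v /\ v \notin s.
Proof.
split=> [iB s|h fB]; first by have [v Bv vs] := infinite_notin s iB; exists v.
have [v [Bv]] := h (fset_set B : seq V); rewrite in_fset_set // => /negP; apply; exact: mem_set.
Qed.

Lemma mP_infinite C : mset C -> mP (fun w => infinite_set (C w)).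
Proof.
move=> h; apply: (mP_eq (P := fun w => forall s : seq V, exists v, C w v /\ v \notin s)).
  by move=> w; rewrite infinite_setE.
apply: (mP_all enum_seq_surj) => s; apply: mP_exV => v.
by apply: mP_and => //; exact: mP_cst.
Qed.

Definition small (B : set V) := forall v, infinitely A B v = 0.
(** Odd multiples suffice for thinning, and unlike even ones they do not confine the
    walk to one side of a bipartite graph. *)
Definition recurrent (B : set V) :=
  forall M, odd M -> forall v, never (iter M A) B v = 0.

Lemma mP_small C : mset C -> mP (fun w => small (C w)).
Proof. by move=> h; apply: mP_allV => v; apply: mP_eqf; exact: (@bfun_infinitely 1%N C h). Qed.

Lemma mP_recurrent C : mset C -> mP (fun w => recurrent (C w)).
Proof.
move=> h; apply: mP_alln => M; apply: mP_imp; first exact: mP_cst.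
by apply: mP_allV => v; apply: mP_eqf; exact: bfun_never.
Qed.

Lemma mP_open_ball rho r x : mrel rho -> mP (fun w => open_ball G (rho w) r x).
Proof.
move=> h; apply: mP_allV => u; apply: mP_allV => v.
by do 3 (apply: mP_imp; first exact: mP_cst).
Qed.

Lemma mP_trif rho r big S v : mrel rho -> (forall C, mset C -> mP (fun w => big (C w))) ->
  mP (fun w => trif G (rho w) r big S v).
Proof.
move=> h hb; apply: mP_and; first exact: mP_open_ball.
apply: (mP_ex enum_pairs_surj) => F; apply: mP_and; first exact: mP_cst.
have hc := mrel_cut F h; have hC c := mset_clus c hc.
apply: mP_exV => c1; apply: mP_exV => c2; apply: mP_exV => c3.
apply: mP_and; first exact: mP_cst.
apply: mP_and.
  apply: (mP_eq (P := fun w => conn (rho w) v c1 /\ (conn (rho w) v c2 /\ conn (rho w) v c3))).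
    by move=> w; split=> [[? []]|[]].
  by do !apply: mP_and; exact: mrel_conn.
apply: mP_and.
  apply: (mP_eq (P := fun w => big (clus (cut (rho w) F) c1) /\
    (big (clus (cut (rho w) F) c2) /\ big (clus (cut (rho w) F) c3)))).
    by move=> w; split=> [[? []]|[]].
  by do !apply: mP_and; exact: hb.
apply: (mP_eq (P := fun w => ~ conn (cut (rho w) F) c1 c2 /\
    (~ conn (cut (rho w) F) c1 c3 /\ ~ conn (cut (rho w) F) c2 c3))).
  by move=> w; split=> [[? []]|[]].
by do !apply: mP_and; apply: mP_not; exact: mrel_conn.
Qed.

Section Furcations.
Variables (rho : T -> V -> V -> Prop) (r : nat).
Hypothesis mrho : mrel rho.
Hypothesis rhoS : forall w, symm (rho w).

Let mbranch x s : mset (fun w => branch G (rho w) r x s).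
Proof. exact: mset_clus (mrel_avoid _ mrho). Qed.

Lemma mP_below x s : mP (fun w => below G (rho w) r small x s).
Proof.
apply: (mP_eq (P := fun w => s \notin ball G r x /\
    (conn (rho w) x s /\ small (branch G (rho w) r x s)))).
  by move=> w; split=> [[? []]|[]].
by do !apply: mP_and; [exact: mP_cst|exact: mrel_conn|exact: mP_small].
Qed.

Lemma mP_furcation x : mP (fun w => furcation G (rho w) r small x).
Proof.
apply: (mP_eq (P := fun w => open_ball G (rho w) r x /\ (~ small (clus (rho w) x) /\
  exists a1 a2, below G (rho w) r small x a1 /\ (below G (rho w) r small x a2 /\
   (infinite_set (branch G (rho w) r x a1) /\ (infinite_set (branch G (rho w) r x a2) /\
   ~ branch G (rho w) r x a1 a2)))))).
  move=> w; split=> [[? [? [a1 [a2 [? [? [? []]]]]]]]|[? ? [a1 [a2 []]]]].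
    by split=> //; exists a1, a2.
  by do 2 split=> //; exists a1, a2.
apply: mP_and; first exact: mP_open_ball.
apply: mP_and; first by apply: mP_not; apply: mP_small; exact: mset_clus.
apply: mP_exV => a1; apply: mP_exV => a2.
do 2 (apply: mP_and; first exact: mP_below).
do 2 (apply: mP_and; first exact: mP_infinite).
by apply: mP_not; exact: mbranch.
Qed.

Lemma mP_between u x z : mP (fun w => between G (rho w) r small u x z).
Proof.
apply: (mP_eq (P := fun w => furcation G (rho w) r small z /\
   (below G (rho w) r small z u /\ below G (rho w) r small x z))).
  by move=> w; split=> [[? []]|[]].
by do !apply: mP_and; [exact: mP_furcation|exact: mP_below|exact: mP_below].
Qed.

Definition hangs u x w := furcation G (rho w) r small x /\ below G (rho w) r small x u.

Lemma mP_hangs u x : mP (hangs u x).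
Proof. by apply: mP_and; [exact: mP_furcation|exact: mP_below]. Qed.

(** The weight given by [u] to a furcation [x]; summed over [u] it is large, summed
    over [x] it is bounded. *)
Definition hang_weight (l : R) u x w : R :=
  if `[< hangs u x w >] then l ^+ rank G (rho w) r small u x else 0.

Hypothesis small_sub : forall B B', B `<=` B' -> small B' -> small B.
Hypothesis small_setU : forall B B', small B -> small B' -> small (B `|` B').

Let mP_rank_ge k u x :
  mP (fun w => hangs u x w /\ (k <= rank G (rho w) r small u x)%N).
Proof.
apply: (mP_eq (P := fun w => hangs u x w /\ exists s : seq V, (uniq s /\ size s = k) /\
    forall z, z \in s -> between G (rho w) r small u x z)); last first.
  apply: mP_and; first exact: mP_hangs.
  apply: (mP_ex enum_seq_surj) => s; apply: mP_and; first exact: mP_cst.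
  by apply: mP_all_seq => z; exact: mP_between.
move=> w; split=> [[[fx [nx xu bx]] [s [[us ss] hs]]]|[[fx [nx xu bx]] kr]]; split=> //.
  rewrite -ss; apply: uniq_leq_size => // z /hs bz.
  by rewrite in_between //; exact/asboolP.
exists (take k (fset_set [set z | between G (rho w) r small u x z] : seq V)); split.
  by rewrite take_uniq ?fset_uniq // size_takel.
by move=> z /mem_take; rewrite in_between // => /asboolP.
Qed.

Lemma bnd_hang_weight l u x : 0 <= l <= 1 -> bnd (hang_weight l u x).
Proof.
move=> /andP[l0 l1].
(* The event of rank at least [k] only asks for [k] distinct furcations in between. *)
pose E k w := hangs u x w /\ rank G (rho w) r small u x = k.
have mE k : mP (E k).
  apply: (mP_eq (P := fun w => (hangs u x w /\ (k <= rank G (rho w) r small u x)%N) /\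
     ~ (hangs u x w /\ (k.+1 <= rank G (rho w) r small u x)%N))); last first.
    by apply: mP_and => //; exact: mP_not.
  move=> w; split=> [[[h1 h2] h3]|[h ->]]; last by rewrite ltnn leqnn; split=> // -[].
  split=> //; apply/eqP; rewrite eqn_leq h2 andbT leqNgt; apply/negP => h4; apply: h3.
  by split.
have partial K w : \sum_(k <- iota 0 K) l ^+ k * ind R (E k) w =
    if `[< hangs u x w >] && (rank G (rho w) r small u x < K)%N then l ^+ rank G (rho w) r small u x else 0.
  case: asboolP => h /=; last first.
    by rewrite big1_seq // => k _; rewrite /ind asboolF ?mulr0 // => -[].
  case: ltnP => hK; last first.
    rewrite big1_seq // => k /andP[_]; rewrite mem_iota add0n => /andP[_ kK].
    by rewrite /ind asboolF ?mulr0 // => -[_ e]; move: kK; rewrite -e ltnNge hK.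
  rewrite (bigD1_seq (rank G (rho w) r small u x)) ?mem_iota ?iota_uniq //=.
  rewrite /ind asboolT // mulr1 big1 ?addr0 // => k /eqP nk.
  by rewrite asboolF ?mulr0 // => -[_ e]; apply: nk.
apply: (bnd_lim (F := fun K w => \sum_(k <- iota 0 K) l ^+ k * ind R (E k) w) (c := 1)).
- by move=> K; apply: bnd_sum => k _; apply: bndZ; exact: bnd_ind.
- move=> K w; rewrite partial; case: ifP => _; last by rewrite normr0.
  by rewrite ger0_norm ?exprn_ge0 // exprn_ile1.
move=> w; apply: cvg_near_cst; exists (rank G (rho w) r small u x).+1 => // K /= hK.
by rewrite partial /hang_weight hK andbT.
Qed.

End Furcations.

End EventMeasurability.

(** * Equivariance under automorphisms *)

Section Equivariance.
Variables (R : realType) (V : pointedType) (G : sgraph V) (dg : nat).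
Hypotheses (Glf : locally_finite G) (deg : forall u, degree G u = dg) (dg0 : (0 < dg)%N).
Variable g : V -> V.
Hypothesis gA : aut G g.
Implicit Types (rho : V -> V -> Prop).

Local Notation A := (avg (R := R) G dg).

Definition pull rho u v := rho (g u) (g v).

Lemma conn_pull rho u v : conn (pull rho) u v = conn rho (g u) (g v) :> Prop.
Proof.
have [h [hA gh hg]] := aut_inv gA; apply/propext; split.
  elim=> [x y xy|x|x y z _ xy _ yz]; [exact: conn_step|exact: conn_refl|exact: conn_trans xy yz].
suff H x y : conn rho x y -> conn (pull rho) (h x) (h y) by move=> /H; rewrite !gh.
elim=> [a b ab|a|a b c _ ab _ bc]; [|exact: conn_refl|exact: conn_trans ab bc].
by apply: conn_step; rewrite /pull !hg.
Qed.

Lemma clus_pull rho v : clus (pull rho) v = g @^-1` clus rho (g v).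
Proof. by apply/funext => u; rewrite /clus /= /mkset conn_pull. Qed.

Lemma avoid_pull rho r x : avoid (pull rho) (ball G r x) = pull (avoid rho (ball G r (g x))).
Proof.
apply/funext => u; apply/funext => v; apply/propext.
by rewrite /pull /avoid !ball_aut.
Qed.

Lemma open_ball_pull rho r x : open_ball G (pull rho) r x = open_ball G rho r (g x) :> Prop.
Proof.
have [h [hA gh hg]] := aut_inv gA; apply/propext; split=> op u v ux vx uv.
  have := op (h u) (h v); rewrite /pull !hg; apply.
  - by rewrite -(ball_aut Glf r x (h u) gA) hg.
  - by rewrite -(ball_aut Glf r x (h v) gA) hg.
  - by rewrite -(aut_adj (h u) (h v) gA) !hg.
by apply: op; rewrite ?ball_aut ?aut_adj.
Qed.

Lemma avg_g f u : A f (g u) = A (f \o g) u.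
Proof. exact: avg_equivariant. Qed.

Lemma small_preimage (B : set V) : small R G dg (g @^-1` B) = small R G dg B :> Prop.
Proof.
have [h [hA gh hg]] := aut_inv gA; apply/propext; split=> H v.
  by rewrite -(hg v) infinitely_equivariant //; exact: avg_g.
by rewrite -infinitely_equivariant //; exact: avg_g.
Qed.

Lemma recurrent_preimage (B : set V) : recurrent R G dg (g @^-1` B) <-> recurrent R G dg B.
Proof.
have [h [hA gh hg]] := aut_inv gA.
have e M f u : iter M A f (g u) = iter M A (f \o g) u by apply: iter_equivariant; exact: avg_g.
split=> H M oM v; first by rewrite -(hg v) never_equivariant //; exact: H.
by rewrite -never_equivariant //; exact: H.
Qed.

Lemma infinite_preimage (B : set V) : infinite_set (g @^-1` B) = infinite_set B :> Prop.
Proof.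
have [h [hA gh hg]] := aut_inv gA; apply/propext; split=> i f; apply: i.
  suff -> : g @^-1` B = h @` B by exact: finite_image.
  by apply/seteqP; split=> [x Bx|_ [y By <-]] /=; [exists (g x)|rewrite hg].
suff -> : B = g @` (g @^-1` B) by exact: finite_image.
by apply/seteqP; split=> [x Bx|_ [y By <-]] //; exists (h x); rewrite /= ?hg.
Qed.

Lemma branch_pull rho r x s : branch G (pull rho) r x s = g @^-1` branch G rho r (g x) (g s).
Proof. by rewrite /branch avoid_pull clus_pull. Qed.

Local Notation small := (small R G dg).

Lemma below_pull rho r x s : below G (pull rho) r small x s = below G rho r small (g x) (g s) :> Prop.
Proof. by rewrite /below branch_pull small_preimage conn_pull ball_aut. Qed.

Lemma furcation_pull rho r x : furcation G (pull rho) r small x = furcation G rho r small (g x) :> Prop.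
Proof.
have [h [hA gh hg]] := aut_inv gA.
rewrite /furcation open_ball_pull clus_pull small_preimage.
apply/propext; split=> -[op ns [a1 [a2 [b1 b2 i1 i2 n]]]]; split=> //.
  exists (g a1), (g a2); move: b1 b2 i1 i2 n; by rewrite !below_pull !branch_pull !infinite_preimage.
exists (h a1), (h a2); rewrite !below_pull !branch_pull !infinite_preimage !hg; split=> //.
by rewrite /preimage /= hg.
Qed.

Lemma between_pull rho r u x z :
  between G (pull rho) r small u x z = between G rho r small (g u) (g x) (g z) :> Prop.
Proof. by rewrite /between furcation_pull !below_pull. Qed.

Lemma rank_pull rho r u x : finite_set [set z | between G (pull rho) r small u x z] ->
  rank G (pull rho) r small u x = rank G rho r small (g u) (g x).
Proof.
move=> fS; have [h [hA gh hg]] := aut_inv gA.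
rewrite /rank -[LHS](size_map g); apply: perm_size; apply: uniq_perm.
- by rewrite map_inj_uniq ?fset_uniq //; exact: aut_inj gA.
- exact: fset_uniq.
have E : [set z | between G rho r small (g u) (g x) z] = g @` [set z | between G (pull rho) r small u x z].
  apply/seteqP; split=> [z bz|_ [z bz <-]]; last by rewrite /= -between_pull.
  by exists (h z); rewrite ?hg //= between_pull hg.
move=> z; rewrite E in_fset_set; last exact: finite_image.
apply/mapP/idP => [[y]|]; first by rewrite in_fset_set // => /set_mem by' ->; apply: mem_set; exists y.
by move=> /set_mem[y by' <-]; exists y => //; rewrite in_fset_set //; exact: mem_set.
Qed.

Lemma trif_pull rho r big (S : set V) v : (forall B, big (g @^-1` B) -> big B) ->
  trif G (pull rho) r big S v -> trif G rho r big (g @` S) (g v).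
Proof.
move=> hb; rewrite /trif open_ball_pull => -[op [F [hF [c1 [c2 [c3 [[s1 s2 s3] [cc [bb nn]]]]]]]]].
split=> //; pose F' := [seq (g e.1, g e.2) | e <- F].
have inF' a b : ((g a, g b) \in F') = ((a, b) \in F).
  apply/mapP/idP => [[[x y] xyF [/(aut_inj gA) -> /(aut_inj gA) ->]] //|abF].
  by exists (a, b).
have E : cut (pull rho) F = pull (cut rho F').
  by apply/funext => a; apply/funext => b; apply/propext; rewrite /pull /cut !inF'.
exists F'; split.
  by move=> e /mapP[e' /hF[h1 h2] ->]; rewrite !ball_aut.
exists (g c1), (g c2), (g c3); split; first by split; [exists c1|exists c2|exists c3].
move: cc bb nn; rewrite E !clus_pull !conn_pull => -[? ? ?] [b1 b2 b3] nn.
by do !split => //; exact: hb.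
Qed.

End Equivariance.

(** * The random subgraph *)

Section Configurations.
Variables (V : pointedType) (G : sgraph V).
Hypothesis Glf : locally_finite G.
Implicit Types (w : config G).

Definition opn w : V -> V -> Prop := open_adj (w : edge G -> bool).

Lemma edge_adj (e : edge G) u v : sval e = [set u; v] -> adj G u v.
Proof.
case: e => s [a [b [ab es]]] /= suv; move: es; rewrite suv => E.
have au : [set u; v] a by rewrite E; left.
have bu : [set u; v] b by rewrite E; right.
have ua : [set a; b] u by rewrite -E; left.
have va : [set a; b] v by rewrite -E; right.
case: (au : a = u \/ a = v) => ea; case: (bu : b = u \/ b = v) => eb;
  move: ab; rewrite ea eb ?adj_irr // => ab; by rewrite adj_sym.
Qed.

Lemma opn_adj w u v : opn w u v -> adj G u v.
Proof. by move=> [e /edge_adj]. Qed.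

Lemma opn_sym w : symm (opn w).
Proof. by move=> u v [e es we]; exists e; rewrite // es setUC. Qed.

Definition edge_of u v (uv : adj G u v) : edge G :=
  exist _ [set u; v] (ex_intro _ u (ex_intro _ v (conj uv erefl))).

Lemma edge_eq (e e' : edge G) : sval e = sval e' -> e = e'.
Proof.
case: e e' => [s hs] [s' hs'] /= E; subst s'; congr (exist _ s _).
exact: Prop_irrelevance.
Qed.

Lemma opn_edge w u v (uv : adj G u v) : opn w u v <-> w (edge_of uv).
Proof.
split=> [[e es we]|we]; last by exists (edge_of uv).
by rewrite (_ : edge_of uv = e) //; exact: edge_eq.
Qed.

Lemma measurable_cylinder e (U : set bool) : measurable [set w : config G | U (w e)].
Proof. by apply: sub_sigma_algebra; exists e, U. Qed.

Lemma mrel_opn : mrel opn.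
Proof.
move=> u v; have [uv|nuv] := boolP (adj G u v).
  apply: (mP_eq (P := fun w : config G => w (edge_of uv))).
    by move=> w; exact: iff_sym (opn_edge w uv).
  exact: (measurable_cylinder (edge_of uv) [set b | b]).
by apply: (mP_eq (P := fun=> False)); [move=> w; split=> // /opn_adj; rewrite (negbTE nuv)|exact: mP_cst].
Qed.

Lemma measurable_config_map d (T : measurableType d) (f : T -> config G) :
  (forall e, mP (fun x => f x e)) -> measurable_fun setT f.
Proof.
move=> h; apply: (@measurability _ _ _ _ setT f (@cylinders (edge G) bool)) => //.
move=> _ [_ [e [U ->]] <-]; rewrite setTI.
have -> : f @^-1` [set w | U (w e)] = [set x | (f x e /\ U true) \/ (~ f x e /\ U false)].
  apply/seteqP; split=> x /=; first by case: (f x e) => h1; [left|right].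
  by case: (f x e) => -[] [].
by apply: mP_or; apply: mP_and; try exact: mP_cst; try exact: mP_not; exact: h.
Qed.

Lemma measurable_translate f (fA : aut G f) :
  measurable_fun setT (translate fA : config G -> config G).
Proof.
by apply: measurable_config_map => e; exact: (measurable_cylinder (edge_map fA e) [set b | b]).
Qed.

Lemma measurable_insert (F : set (edge G)) :
  measurable_fun setT (insert_edges F : config G -> config G).
Proof.
apply: measurable_config_map => e; rewrite /insert_edges.
apply: (mP_eq (P := fun w : config G => w e \/ F e)).
  by move=> w; split=> [[->//|Fe]|/orP[|/asboolP]]; [rewrite asboolT ?orbT|left|right].
by apply: mP_or; [exact: (measurable_cylinder e [set b | b])|exact: mP_cst].
Qed.

Lemma opn_translate f (fA : aut G f) w : opn (translate fA w) = pull f (opn w).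
Proof.
apply/funext => u; apply/funext => v; apply/propext; split=> [[e es we]|].
  by exists (edge_map fA e) => //; rewrite /= es image_setU !image_set1.
move=> h; have uv : adj G u v by rewrite -(aut_adj _ _ fA); exact: opn_adj h.
move: h; have fuv : adj G (f u) (f v) by rewrite aut_adj.
move=> /(opn_edge w fuv) we; exists (edge_of uv) => //.
rewrite /translate (_ : edge_map fA _ = edge_of fuv) //.
by apply: edge_eq; rewrite /= image_setU !image_set1.
Qed.

Definition ball_edges r x : set (edge G) := [set e | exists u v,
  [/\ u \in ball G r x, v \in ball G r x & sval e = [set u; v]]].

Lemma finite_ball_edges r x : finite_set (ball_edges r x).
Proof.
pose f (p : V * V) : set (edge G) := [set e | sval e = [set p.1; p.2]].
pose s := [seq (u, v) | u <- ball G r x, v <- ball G r x].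
apply: (@sub_finite_set _ _ (\bigcup_(p in [set` s]) f p)).
  move=> e [u [v [ux vx es]]]; exists (u, v) => //=.
  by apply/allpairsP; exists (u, v).
apply: bigcup_finite; first exact: finite_seq.
move=> p _; have [[e ee]|ne] := pselect (exists e, f p e).
  apply: (@sub_finite_set _ _ [set e]); last exact: finite_set1.
  by move=> e' ee'; apply: edge_eq; rewrite ee ee'.
by apply: (@sub_finite_set _ _ set0); [move=> e ee; case: ne; exists e|exact: finite_set0].
Qed.

Lemma opn_insert_ball r x w u v : opn (insert_edges (ball_edges r x) w) u v <->
  opn w u v \/ [/\ adj G u v, u \in ball G r x & v \in ball G r x].
Proof.
split=> [[e es /orP[we|/asboolP[a [b [ax bx es']]]]]|[[e es we]|[uv ux vx]]].
- by left; exists e.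
- right; split; first exact: edge_adj es.
  + have : [set a; b] u by rewrite -es' es; left.
    by case=> ->.
  + have : [set a; b] v by rewrite -es' es; right.
    by case=> ->.
- by exists e => //; apply/orP; left.
- exists (edge_of uv) => //; apply/orP; right; apply/asboolP; by exists u, v.
Qed.

End Configurations.

Section Law.
Variables (R : realType) (V : pointedType) (G : sgraph V).
Variable mu : probability (config G) R.

Lemma pr_translate f (fA : aut G f) (P : config G -> Prop) : automorphism_invariant mu ->
  mP P -> pr mu (fun w => P (translate fA w)) = pr mu P.
Proof. by move=> inv mp; rewrite /pr -(inv f fA [set w | P w] mp). Qed.

Lemma Ex_translate f (fA : aut G f) (X : config G -> R) : automorphism_invariant mu ->
  bnd X -> (forall w, 0 <= X w) -> Ex mu (fun w => X (translate fA w)) = Ex mu X.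
Proof.
move=> inv [mX _] X0; rewrite /Ex /Rintegral; congr fine.
have mt := measurable_translate fA.
have e1 := @ge0_integral_pushforward _ _ _ _ R _ mt mu setT (EFin \o X) measurableT.
rewrite -[LHS](e1 _ _); last by move=> w _; rewrite /= lee_fin.
  apply: (@eq_measure_integral _ _ _ _ mu) => A mA _; exact: inv.
exact/measurable_EFinP.
Qed.

Lemma pr_insert_pos (F : set (edge G)) (P Q : config G -> Prop) : insertion_tolerant mu ->
  finite_set F -> mP P -> mP Q -> (forall w, P w -> Q (insert_edges F w)) ->
  pr mu P != 0 -> pr mu Q != 0.
Proof.
move=> ins fF mp mq PQ; apply: contraNN => /eqP q0.
have nQ : mu.-null_set [set w | Q w] by apply/measure0_null_setP => //; exact: pr_eq0.
have h := ins F fF _ nQ _ mq (subset_refl _).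
have mi : mP (fun w : config G => Q (insert_edges F w)).
  by have := @measurable_insert V G F measurableT _ mq; rewrite setTI.
rewrite eq_le pr_ge0 andbT; apply: le_trans (pr_le mu mp mi PQ) _.
by rewrite /pr; move: h; rewrite /pushforward => ->.
Qed.

(** To see that an equivariant family of events has constant probability along an
    orbit, one inclusion for every automorphism is enough. *)
Lemma pr_invariant (P : V -> config G -> Prop) : automorphism_invariant mu ->
  (forall v, mP (P v)) ->
  (forall f (fA : aut G f) v w, P v (translate fA w) -> P (f v) w) ->
  forall f, aut G f -> forall v, pr mu (P (f v)) = pr mu (P v).
Proof.
move=> inv mp eq f fA v; have H g (gA : aut G g) u : pr mu (P u) <= pr mu (P (g u)).
  rewrite -(pr_translate gA inv (mp u)); apply: pr_le => //; last by move=> w; exact: eq.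
  by have := @measurable_translate V G g gA measurableT _ (mp u); rewrite setTI.
have [g [gA fg gf]] := aut_inv fA.
by apply/eqP; rewrite eq_le (H f fA v) andbT; have := H g gA (f v); rewrite fg.
Qed.

End Law.

(** * A zero-one law for clusters *)

Section ZeroOne.
Variables (R : realType) (V : pointedType) (G : sgraph V) (dg : nat) (o : V).
Hypotheses (Glf : locally_finite G) (Gc : connected_graph G) (Gunim : unimodular G).
Hypotheses (deg : forall u, degree G u = dg) (dg0 : (0 < dg)%N).
Variable mu : probability (config G) R.
Hypothesis inv : automorphism_invariant mu.

Local Notation A := (avg (R := R) G dg).
Local Notation K w u := (clus (opn w) u).

Let mA : markov A. Proof. exact: markov_avg. Qed.

Section OneThinning.
Variable M : nat.
Let q := iter M A.
Let mq : markov q. Proof. exact: markov_iter. Qed.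

Let Z (u v : V) (w : config G) : R :=
  noreturn q (K w u) u * on (K w u) (infinitely q (K w u)) v.

Let mK u : mset (fun w : config G => K w u).
Proof. exact: (mset_clus o Glf Gc u (@mrel_opn V G)). Qed.

Let on_if (C : set V) f v : on (R := R) C f v = if `[< C v >] then f v else 0.
Proof. by []. Qed.

Let bnd_on (f : config G -> V -> R) u v : bfun f -> bnd (fun w => on (K w u) (f w) v).
Proof.
move=> hf; apply: bnd_if; [exact: mK|exact: hf|exact: bnd_cst].
Qed.

Let bnd_Z u v : bnd (Z u v).
Proof.
apply: bndM; first exact: (bfun_noreturn R deg dg0 M (mK u)).
by apply: bnd_on; exact: (bfun_infinitely R deg dg0 M (mK u)).
Qed.

Let qg g : aut G g -> forall f u, q f (g u) = q (f \o g) u.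
Proof. by move=> gA f u; apply: iter_equivariant => ? ?; exact: avg_equivariant. Qed.

Let Z_translate g (gA : aut G g) u v w : Z u v (translate gA w) = Z (g u) (g v) w.
Proof.
rewrite /Z (opn_translate gA) (clus_pull gA) -(noreturn_equivariant (qg gA)).
congr (_ * _); rewrite !on_if /=; case: asboolP => // _.
by rewrite (infinitely_equivariant (qg gA)).
Qed.

Let Z_ge0 u v w : 0 <= Z u v w.
Proof.
apply: mulr_ge0; first exact: noreturn_ge0.
by rewrite on_if; case: ifP => // _; exact: infinitely_ge0.
Qed.

(** Let [u] send to the vertices [v] of its cluster the mass
    [noreturn u * iter k q (single v) u * infinitely v], for all [k < n]. The mass
    received is [infinitely u] times the probability of a last visit before time
    [n], hence at most [1]; the mass sent diverges with [n] wherever both factors are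
    positive. *)
Lemma noreturn_infinitely_null u :
  pr mu (fun w => noreturn q (K w u) u * infinitely q (K w u) u != 0) = 0.
Proof.
pose F n (w : config G) := noreturn q (K w u) u * \sum_(k < n) iter k q (on (K w u) (infinitely q (K w u))) u.
pose F' n (w : config G) := infinitely q (K w u) u * \sum_(k < n) iter k q (on (K w u) (noreturn q (K w u))) u.
have b1 := bfun_noreturn R deg dg0 M (mK u).
have b2 := bfun_infinitely R deg dg0 M (mK u).
have biter k (f : config G -> V -> R) : bfun f -> bfun (fun w => iter k q (f w)).
  move=> hf; elim: k => [|k IH] //=; exact: bfun_iter.
have bon (f : config G -> V -> R) : bfun f -> bfun (fun w => on (K w u) (f w)).
  by move=> hf v; exact: bnd_on.
have bsum (f : config G -> V -> R) n : bfun f ->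
    bnd (fun w => \sum_(k < n) iter k q (on (K w u) (f w)) u).
  by move=> hf; apply: bnd_sum => k _; exact: (biter k _ (bon _ hf)).
have on_ge0 (C : set V) f v : (forall x, 0 <= f x) -> 0 <= on (R := R) C f v.
  by move=> f0; rewrite on_if; case: ifP.
have inf0 w x : 0 <= infinitely q (K w u) x by exact: infinitely_ge0.
have nor0 w x : 0 <= noreturn q (K w u) x by exact: noreturn_ge0.
have swap n : Ex mu (F n) = Ex mu (F' n).
  have EF : Ex mu (F n) = \sum_(k < n) Ex mu (fun w => noreturn q (K w u) u * iter k q (on (K w u) (infinitely q (K w u))) u).
    rewrite -Ex_sum; first by congr (Ex mu _); apply/funext => w; rewrite /F mulr_sumr.
    by move=> k _; apply: bndM; [exact: b1|exact: (biter k _ (bon _ b2))].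
  have EF' : Ex mu (F' n) = \sum_(k < n) Ex mu (fun w => infinitely q (K w u) u * iter k q (on (K w u) (noreturn q (K w u))) u).
    rewrite -Ex_sum; first by congr (Ex mu _); apply/funext => w; rewrite /F' mulr_sumr.
    by move=> k _; apply: bndM; [exact: b2|exact: (biter k _ (bon _ b1))].
  rewrite EF EF'; apply: eq_bigr => k _.
  have iterq f : iter k q f = iter (k * M) A f.
    by elim: (k : nat) => //= j ->; rewrite mulSn iterD.
  set B := undup (ball G (k * M) u).
  pose S x y := iter (k * M) A (single R y) x.
  have [Gam [Gsub Gt Gcard]] := Gunim; have [Gaut _ _ _] := Gsub.
  pose T x y := S x y * Ex mu (Z x y).
  have T_inv g x y : Gam g -> T (g x) (g y) = T x y.
    move=> Gg; have gA := Gaut g Gg; congr (_ * _).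
      rewrite /S (iter_equivariant (@avg_equivariant R V G dg Glf g gA)).
      congr (iter _ _ _ x); apply/funext => z; rewrite /single /=.
      by rewrite (inj_eq (aut_inj gA)).
    rewrite -(Ex_translate gA inv (bnd_Z x y) (Z_ge0 x y)).
    by congr (Ex mu _); apply/funext => w; rewrite Z_translate.
  have := @mass_transport R V G Glf Gam T u (k * M) Gsub Gt Gcard T_inv; rewrite -/B => MT.
  have L : Ex mu (fun w => noreturn q (K w u) u * iter k q (on (K w u) (infinitely q (K w u))) u) = \sum_(v <- B) T u v.
    rewrite (_ : (fun w => _) = (fun w => \sum_(v <- B) S u v * Z u v w)); last first.
      apply/funext => w; rewrite iterq iter_avg_sum // mulr_sumr; apply: eq_bigr => v _.
      by rewrite mulrCA.
    rewrite Ex_sum; last by move=> v _; apply: bndZ; exact: bnd_Z.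
    by apply: eq_bigr => v _; rewrite ExZ.
  rewrite L MT.
  rewrite (_ : (fun w => _) = (fun w => \sum_(v <- B) S v u * Z v u w)); last first.
    apply/funext => w; rewrite iterq iter_avg_sum // mulr_sumr; apply: eq_bigr => v _.
    rewrite -/(S u v) (_ : S u v = S v u); last exact: single_sym.
    rewrite mulrCA; congr (_ * _); rewrite /Z !on_if.
    have [uv|nuv] := pselect (conn (opn w) u v).
      have E : K w u = K w v by apply: clus_eq => //; exact: opn_sym.
      rewrite -E (asboolT (P := K w u v)) // (asboolT (P := K w u u)); last exact: conn_refl.
      by rewrite mulrC.
    rewrite !asboolF ?mulr0 // => vu; apply: nuv; apply: conn_sym vu; exact: opn_sym.
  rewrite Ex_sum; last by move=> v _; apply: bndZ; exact: bnd_Z.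
  by apply: eq_bigr => v _; rewrite ExZ.
apply: (@blow_up_null _ _ _ mu F 1).
- by move=> n; apply: bndM; [exact: b1|exact: bsum].
- move=> n w; apply: mulr_ge0 => //; apply: sumr_ge0 => k _; apply: (iter_ge0 mq) => x.
  exact: on_ge0.
- move=> n w; rewrite /F big_ord_recr /= mulrDr lerDl; apply: mulr_ge0 => //.
  by apply: (iter_ge0 mq) => x; exact: on_ge0.
- move=> n; rewrite swap -[leRHS](Ex_cst mu 1); apply: Ex_le.
  + by apply: bndM; [exact: b2|exact: bsum].
  + exact: bnd_cst.
  move=> w; rewrite -[leRHS]mulr1; apply: ler_pM => //.
  + by apply: sumr_ge0 => k _; apply: (iter_ge0 mq) => x; exact: on_ge0.
  + exact: infinitely_le1.
  + have := iter_never_sum mq (K w u) n u; have := never_ge0 mq (K w u) u.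
    have : iter n q (never q (K w u)) u <= 1.
      by apply: (mk_le1 (markov_iter n mq)) => x; exact: never_le1.
    by lra.
- by apply: mP_neqf; apply: bndM; [exact: b1|exact: b2].
- move=> w; rewrite mulf_eq0 => /norP[n0 i0] b.
  have ip : 0 < infinitely q (K w u) u by rewrite lt_def i0 inf0.
  have np : 0 < noreturn q (K w u) u by rewrite lt_def n0 nor0.
  have [n hn] := sum_infinitely_unbounded mq (b / noreturn q (K w u) u) ip.
  by exists n; rewrite /F mulrC -ler_pdivrMr.
Qed.

End OneThinning.

(** For each odd [M], [noreturn * infinitely] vanishes almost surely on all clusters,
    so the maximum principle leaves only the two extreme cases. *)
Lemma nonsmall_recurrent_as :
  pr mu (fun w => exists u, ~ small R G dg (K w u) /\ ~ recurrent R G dg (K w u)) = 0.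
Proof.
pose bad M u (w : config G) := odd M /\ noreturn (iter M A) (K w u) u * infinitely (iter M A) (K w u) u != 0.
have mK u : mset (fun w : config G => K w u) by exact: (mset_clus o Glf Gc u (@mrel_opn V G)).
have m1 M u : mP (bad M u).
  apply: mP_and; first exact: mP_cst.
  by apply: mP_neqf; apply: bndM; [exact: bfun_noreturn|exact: bfun_infinitely].
have m2 M : mP (fun w => exists u, bad M u w) by apply: (mP_exV o Glf Gc).
have null : pr mu (fun w => exists M, exists u, bad M u w) = 0.
  apply: (@pr_ex_null _ _ _ _ _ id); [by move=> i; exists i|exact: m2|move=> M].
  apply: (@pr_ex_null _ _ _ _ _ (enumV G o)); [exact: enumV_surj|exact: m1|move=> u].
  apply/eqP; rewrite eq_le pr_ge0 andbT -(noreturn_infinitely_null M u).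
  apply: pr_le; [exact: m1| |by move=> w []].
  by apply: mP_neqf; apply: bndM; [exact: bfun_noreturn|exact: bfun_infinitely].
apply/eqP; rewrite eq_le pr_ge0 andbT -null; apply: pr_le.
- apply: (mP_exV o Glf Gc) => u; apply: mP_and; apply: mP_not.
    exact: (mP_small R o Glf Gc deg dg0 (mK u)).
  exact: (mP_recurrent R o Glf Gc deg dg0 (mK u)).
- by apply: mP_exn.
move=> w [u [ns nr]]; apply: contrapT => nb; apply: nr => M oM.
have mM : markov (iter M A) by exact: markov_iter.
have M0 : (0 < M)%N by case: (M) oM.
have := @infinitely_zero_one R V (iter M A) mM (K w u).
case.
- exact: (odd_avg_irreducible Glf deg dg0 oM Gc).
- by exists u; exact: conn_refl.
- move=> x ux; apply/eqP; apply: contrapT => /negP nz; apply: nb; exists M, x.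
  have e : K w x = K w u by apply/esym/clus_eq => //; exact: opn_sym.
  by split=> //; rewrite e.
- by move=> h; case: ns => z; exact: (infinitely_iter mA M0 h).
- by [].
Qed.

End ZeroOne.

(** * Trifurcation density *)

Section Trifurcations.
Variables (R : realType) (V : pointedType) (G : sgraph V) (dg : nat) (o : V).
Hypotheses (Glf : locally_finite G) (Gc : connected_graph G) (Gt : transitive_graph G).
Hypotheses (deg : forall u, degree G u = dg) (dg0 : (0 < dg)%N).
Variable mu : probability (config G) R.
Hypothesis inv : automorphism_invariant mu.
Variables (r : nat).

Local Notation A := (avg (R := R) G dg).
Let mA : markov A. Proof. exact: markov_avg. Qed.

Let D := ((degree G o).+1 ^ (r + r))%N.
Let size_ballD x : (size (ball G (r + r) x) <= D)%N.
Proof. exact: size_ball. Qed.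

Lemma sum_ind_count (P : V -> config G -> Prop) (s : seq V) w :
  \sum_(v <- s) ind R (P v) w = (size [seq v <- s | `[< P v w >]])%:R.
Proof.
rewrite size_filter -sum1_count natr_sum [RHS]big_mkcond; apply: eq_bigr => v _.
by rewrite /ind; case: asboolP.
Qed.

Lemma pr_trif_const (big : set V -> Prop) :
  (forall C : config G -> set V, mset C -> mP (fun w => big (C w))) ->
  (forall g, aut G g -> forall B, big (g @^-1` B) -> big B) ->
  forall v, pr mu (fun w => trif G (opn w) r big setT v) = pr mu (fun w => trif G (opn w) r big setT o).
Proof.
move=> mb hb v; have [g gA <-] := Gt o v.
apply: (@pr_invariant R V G mu (fun v w => trif G (opn w) r big setT v)) => //.
  by move=> x; apply: (mP_trif o Glf Gc) => //; exact: mrel_opn.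
move=> f fA x w; rewrite opn_translate // => /(trif_pull Glf fA (hb f fA)).
exact: trif_mono.
Qed.

(** No condition changes when a representative of a branch is moved inside that
    branch. *)
Lemma trif_seen rho (big : set V -> Prop) (S : set V) v : symm rho ->
  trif G rho r big setT v ->
  (forall F c, (forall e, e \in F -> e.1 \in ball G r v /\ e.2 \in ball G r v) ->
     conn rho v c -> big (clus (cut rho F) c) -> exists2 c', S c' & conn (cut rho F) c c') ->
  trif G rho r big S v.
Proof.
move=> rs [op [F [hF [c1 [c2 [c3 [_ [[k1 k2 k3] [[b1 b2 b3] [n12 n13 n23]]]]]]]]]] h.
have [d1 s1 e1] := h F c1 hF k1 b1; have [d2 s2 e2] := h F c2 hF k2 b2.
have [d3 s3 e3] := h F c3 hF k3 b3.
have cs : symm (cut rho F) by exact: cut_sym.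
have up a b : conn (cut rho F) a b -> conn rho a b by apply: conn_mono => x y; exact: cut_sub.
have E a b : conn (cut rho F) a b -> clus (cut rho F) b = clus (cut rho F) a.
  by move=> ab; apply/esym/clus_eq.
split=> //; exists F; split=> //; exists d1, d2, d3; split=> //; split.
  by split; [exact: conn_trans k1 (up _ _ e1)|exact: conn_trans k2 (up _ _ e2)|exact: conn_trans k3 (up _ _ e3)].
split; first by rewrite !(E _ _ e1) !(E _ _ e2) !(E _ _ e3).
split=> n; [apply: n12|apply: n13|apply: n23].
- by apply: conn_trans e1 (conn_trans n (conn_sym cs e2)).
- by apply: conn_trans e1 (conn_trans n (conn_sym cs e3)).
- by apply: conn_trans e2 (conn_trans n (conn_sym cs e3)).
Qed.

(** An infinite branch leaves every finite set through its boundary, so the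
    trifurcations deep in a finite set are seen from the boundary. *)
Lemma infinite_exits rho L F v c : symm rho -> subgr G rho ->
  {subset ball G r v <= L} ->
  (forall e, e \in F -> e.1 \in ball G r v /\ e.2 \in ball G r v) ->
  conn rho v c -> infinite_set (clus (cut rho F) c) ->
  exists2 c', c' \in bdry G L & conn (cut rho F) c c'.
Proof.
move=> rs rG bL hF vc ic.
have [t tL ct] : exists2 t, t \in L & conn (cut rho F) c t.
  have cv := conn_sym rs vc; clear vc ic.
  elim/conn_ind_l: c / cv => [|x y xy _ [t tL yt]].
    by exists v; [apply: bL; exact: ball_center|exact: conn_refl].
  have [xyF|xyF] := boolP ((x, y) \in F).
    by exists x; [apply: bL; case: (hF _ xyF)|exact: conn_refl].
  have [yxF|yxF] := boolP ((y, x) \in F).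
    by exists x; [apply: bL; case: (hF _ yxF)|exact: conn_refl].
  by exists t => //; apply: conn_trans yt; apply: conn_step.
have [z cz zL] := infinite_notin L ic.
have tz : conn (cut rho F) t z.
  by apply: conn_trans cz; apply: conn_sym ct; exact: cut_sym.
suff [b bdL tb] : exists2 b, b \in bdry G L & conn (cut rho F) t b.
  by exists b => //; exact: conn_trans ct tb.
clear ct; elim/conn_ind_l: t / tz tL => [zL'|x y xy _ IH xL].
  by rewrite zL' in zL.
have [yL|yL] := boolP (y \in L).
  by have [b bdL yb] := IH yL; exists b => //; apply: conn_trans yb; exact: conn_step.
exists x; last exact: conn_refl.
rewrite mem_filter xL andbT; apply/hasP; exists y => //.
by rewrite mem_nbr //; apply: rG; case: xy.
Qed.

(** Every vertex of [L] carries a trifurcation with the same probability [p]. Those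
    whose ball lies in [L] are seen from the boundary of [L], so there are at most
    [D] times as many of them as boundary vertices; the others are close to the
    boundary. Hence [p * size L] is at most a multiple of the boundary. *)
Lemma isoperimetric : pr mu (fun w => trif G (opn w) r (fun B : set V => infinite_set B) setT o) != 0 ->
  exists2 e : R, 0 < e & forall L, uniq L -> e * (size L)%:R <= (size (bdry G L))%:R.
Proof.
move=> p0; set p := pr mu _ in p0; pose D' := ((degree G o).+1 ^ r)%N.
have pp : 0 < p by rewrite lt_def p0 pr_ge0.
have DD : 0 < (D + D')%:R :> R by rewrite ltr0n addn_gt0 expn_gt0.
exists (p / (D + D')%:R); first by rewrite divr_gt0.
move=> L uL; rewrite mulrAC ler_pdivrMr // -natrM.
pose tr v (w : config G) := trif G (opn w) r (fun B : set V => infinite_set B) setT v.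
have mtr v : mP (tr v).
  apply: (mP_trif o Glf Gc); first exact: mrel_opn.
  by move=> C hC; exact: (mP_infinite o Glf Gc hC).
have -> : p * (size L)%:R = \sum_(v <- L) pr mu (tr v).
  rewrite (eq_bigr (fun=> p)); first by rewrite big_const_seq count_predT iter_addr_0 mulr_natr.
  move=> v _; apply: (pr_trif_const (big := fun B : set V => infinite_set B)).
    by move=> C hC; exact: (mP_infinite o Glf Gc hC).
  by move=> g gA B; rewrite (infinite_preimage gA).
apply: sum_pr_le => // w; rewrite sum_ind_count ler_nat.
set X := [seq v <- L | `[< tr v w >]]; have uX : uniq X by exact: filter_uniq.
pose deep v := all (fun u => u \in L) (ball G r v).
have -> : size X = (size [seq v <- X | deep v] + size [seq v <- X | predC deep v])%N.
  by rewrite [in RHS]size_filter [in RHS]size_filter (count_predC deep X).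
rewrite mulnDr [(_ * D)%N]mulnC [(_ * D')%N]mulnC; apply: leq_add.
  apply: (@size_trif V G Glf (opn w) r D (fun B : set V => infinite_set B)) => //.
  - exact: opn_sym.
  - exact: filter_uniq.
  move=> v; rewrite mem_filter => /andP[/allP dv]; rewrite mem_filter => /andP[/asboolP tv _].
  apply: trif_seen tv _; first exact: opn_sym.
  move=> F c hF vc ic; have [c' bc cc] := infinite_exits (@opn_sym V G w) (@opn_adj V G w) dv hF vc ic.
  by exists c'.
apply: (@leq_trans (size (flatten [seq ball G r b | b <- bdry G L]))).
  apply: uniq_leq_size; first exact: filter_uniq.
  move=> v; rewrite mem_filter => /andP[/allPn[u uv uL'] vX].
  have vL : v \in L by move: vX; rewrite mem_filter => /andP[].
  suff [b bL vb] : exists2 b, b \in bdry G L & b \in ball G r v.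
    by apply/flatten_mapP; exists b => //; rewrite ball_sym.
  suff H k x : x \in L -> u \in ball G k x -> exists2 b, b \in bdry G L & b \in ball G k x by exact: H.
  elim: k x => [|k IH] x xL; first by rewrite inE => /eqP ux; rewrite -ux (negbTE uL') in xL.
  case/(ballSP Glf) => [ux|[y xy uy]]; first by rewrite -ux (negbTE uL') in xL.
  have [yL|yL] := boolP (y \in L).
    by have [b bL by'] := IH y yL uy; exists b => //; apply/(ballSP Glf); right; exists y.
  exists x; last exact: ball_center.
  by rewrite mem_filter xL andbT; apply/hasP; exists y; rewrite ?mem_nbr.
rewrite size_flatten /shape -map_comp.
elim: (bdry G L) => //= b s IHs; rewrite mulnS leq_add //; exact: size_ball.
Qed.

Section Transient.
Variable e : R.
Hypothesis e0 : 0 < e.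
Hypothesis iso : forall L, uniq L -> e * (size L)%:R <= (size (bdry G L))%:R.

(** If the walk surely returned to [o], infinitely many visits to [o] would have
    probability one and the expected number of visits would diverge. *)
Lemma escape_pos : exists2 c : R, 0 < c <= 1 & forall v, noreturn A [set v] v = c.
Proof.
exists (noreturn A [set o] o); last first.
  move=> v; have [g gA <-] := Gt o v.
  rewrite (noreturn_equivariant (@avg_equivariant R V G dg Glf g gA)); congr (noreturn _ _ _).
  by apply/seteqP; split=> [x /= /(aut_inj gA) //|x ->].
rewrite noreturn_le1 // andbT lt_def noreturn_ge0 // andbT; apply/eqP => n0.
have on0 : on [set o] (noreturn A [set o]) = fun=> 0.
  by apply/funext => x; rewrite /on; case: asboolP => // ->.
have f0 : finitely A [set o] o = 0.
  rewrite -(never_in mA (C := [set o]) (v := o)) //.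
  have c := cvg_finitely mA (C := [set o]) (v := o).
  rewrite (_ : (fun n => _) = (fun=> never A [set o] o)) in c.
    by apply: (cvg_unique _ c (cvg_cst _)).
  apply/funext => n; rewrite iter_never_sum // on0 big1 ?addr0 // => k _.
  exact: (mk0 (markov_iter k mA)).
have i1 : infinitely A [set o] o = 1 by rewrite /infinitely f0 subr0.
have [n hn] := sum_infinitely_unbounded mA ((4 * dg%:R / e) ^+ 2 / 2 + 1) (C := [set o]) (v := o) (ltac:(by rewrite i1)).
have := green_bounded Glf deg dg0 e0 iso n o.
suff : \sum_(k < n) iter k A (on [set o] (infinitely A [set o])) o <= \sum_(k < n) iter k A (single R o) o.
  by move: hn; lra.
apply: ler_sum => k _; apply: (mk_mono (markov_iter k mA)) => x.
rewrite /on /single; case: asboolP => [->|]; rewrite ?eqxx ?infinitely_le1 ?ler0n //.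
Qed.

Local Notation rec := (recurrent R G dg).
Local Notation tri w S v := (trif G (opn w) r rec S v).

Hypothesis p0 : pr mu (fun w => tri w setT o) != 0.

Let mtri S v : mP (fun w : config G => tri w S v).
Proof.
apply: (mP_trif o Glf Gc); first exact: mrel_opn.
by move=> C hC; exact: (mP_recurrent R o Glf Gc deg dg0 hC).
Qed.

Section Thinning.
Variable M : nat.
Hypothesis M_odd : odd M.

(** Representatives of the branches of the trifurcation at [v] are looked for among
    the sampled vertices of the trajectory [s]. *)
Definition unseen j s v (w : config G) := tri w setT v /\ ~ tri w [set` thin M j s] v.

Let munseen j s v : mP (unseen j s v).
Proof. by apply: mP_and => //; exact: mP_not. Qed.

Let M0 : (0 < M)%N. Proof. by case: (M) M_odd. Qed.

Definition beta j n u := Ew G dg n u (fun s => pr mu (unseen j s u)).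

(** By invariance of the law, the walk may be moved by an automorphism. *)
Lemma beta_const j n u : beta j n u = beta j n o.
Proof.
have [g gA <-] := Gt o u; rewrite /beta (@Ew_equivariant R V G dg Glf g gA).
congr (Ew _ _ n o _); apply/funext => s /=.
have thin_map i t : thin M i (map g t) = map g (thin M i t).
  by elim: t i => //= x t IH [|i] /=; rewrite IH.
have tr h (hA : aut G h) S v w : tri (translate hA w) S v -> tri w (h @` S) (h v).
  by rewrite opn_translate //; apply: trif_pull => // B; rewrite recurrent_preimage.
have [g' [gA' gg' g'g]] := aut_inv gA.
have tr' S v w : tri w (g @` S) (g v) -> tri (translate gA w) S v.
  move=> h; have tt : translate gA' (translate gA w) = w.
    apply/funext => a; rewrite /translate; congr (w _); apply: edge_eq => /=.
    apply/seteqP; split=> [x [y [z az <-] <-]|x ax] /=; first by rewrite g'g.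
    by exists (g' x) => //; exists x.
  move: h; rewrite -{1}tt => /tr; rewrite gg'.
  by apply: trif_mono; rewrite ?gg' // => x [_ [z zS <-] <-]; rewrite gg'.
rewrite -(pr_translate gA inv (munseen j s o)).
apply: congr1; apply/funext => w; apply/propext; rewrite /unseen.
have E : [set` map g (thin M j s)] = g @` [set` thin M j s].
  by apply/seteqP; split=> [x /= /mapP[y ys ->]|_ [y ys <-]] /=; [exists y|exact: map_f].
split=> -[h1 h2]; split.
- by apply: tr'; apply: trif_mono h1 => // x _; exists (g' x); rewrite ?g'g.
- by move=> h; apply: h2; rewrite thin_map E; exact: tr.
- by apply: trif_mono (tr _ _ _ _ _ h1).
- by rewrite thin_map E => h; apply: h2; exact: tr'.
Qed.

Lemma Ex_Ew n u (f : seq V -> config G -> R) : (forall s, bnd (f s)) ->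
  bnd (fun w => Ew G dg n u (fun s => f s w)) /\
  Ex mu (fun w => Ew G dg n u (fun s => f s w)) = Ew G dg n u (fun s => Ex mu (f s)).
Proof.
elim: n u f => [|n IH] u f hf /=; first by split.
have h v := IH v (fun s => f (u :: s)) (fun s => hf (u :: s)).
have b : bnd (fun w => \sum_(v <- nbr G u) Ew G dg n v (fun s => f (u :: s) w)).
  by apply: bnd_sum => v _; case: (h v).
split; first exact: bndZ.
rewrite /avg ExZ // Ex_sum; last by move=> v _; case: (h v).
by congr (_ * _); apply: eq_bigr => v _; case: (h v).
Qed.

(** A trifurcation is unseen only if one of its three branches is missed at all
    sampled times, and each branch is recurrent. *)
Lemma beta_cvg0 j : beta j ^~ o @ \oo --> (0 : R).
Proof.
pose g n w := Ew G dg n o (fun s => ind R (unseen j s o) w).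
have bg n := Ex_Ew n o (fun s => bnd_ind R (munseen j s o)).
have g0 n w : 0 <= g n w by apply: Ew_ge0 => // s; rewrite /ind ler0n.
have g1 n w : g n w <= 1.
  rewrite -(Ew_cst deg dg0 n o 1); apply: Ew_le => // s _; rewrite /ind lern1; by case: asboolP.
have -> : beta j ^~ o = fun n => Ex mu (g n).
  apply/funext => n; rewrite /g (bg n).2; congr (Ew _ _ n o _).
  by apply/funext => s; rewrite Ex_ind.
rewrite -[X in _ --> X](Ex_cst mu 0).
apply: (Ex_lim (c := 1)) => [n|n w|w]; first exact: (bg n).1.
  by rewrite ger0_norm.
have [tw|ntw] := pselect (tri w setT o); last first.
  rewrite (_ : (fun n => _) = fun=> 0); first exact: cvg_cst.
  apply/funext => n; rewrite /g -[RHS](Ew_cst deg dg0 n o 0); congr (Ew _ _ n o _).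
  by apply/funext => s; rewrite /ind asboolF // => -[].
have [op [F [hF [c1 [c2 [c3 [_ [kk [[b1 b2 b3] nn]]]]]]]]] := tw.
pose C c := clus (cut (opn w) F) c.
pose mi c k := iter j A (miss (iter M A) (C c) k) o.
have mi0 c : rec (C c) -> mi c @ \oo --> (0 : R).
  move=> rc; rewrite -[X in _ --> X](mk0 (markov_iter j mA) o).
  apply: (mk_lim (markov_iter j mA)) => x; rewrite -(rc M M_odd x).
  by apply: cvg_miss; exact: markov_iter.
have bound n k : (j + M * k <= n)%N -> g n w <= mi c1 k + mi c2 k + mi c3 k.
  move=> nk; pose h c s : R := (~~ has (fun x => `[< C c x >]) (thin M j s))%:R.
  have hE c : Ew G dg n o (h c) <= mi c k by exact: Ew_thin_miss.
  apply: le_trans (lerD (lerD (hE c1) (hE c2)) (hE c3)).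
  rewrite -!EwD //; apply: Ew_le => // s _.
  rewrite /ind; case: asboolP => [[_ ns]|_]; last by rewrite !addr_ge0 ?ler0n.
  have hit c : has (fun x => `[< C c x >]) (thin M j s) -> exists2 c', c' \in thin M j s & conn (cut (opn w) F) c c'.
    by move=> /hasP[x xs /asboolP cx]; exists x.
  have [h1|h1] := boolP (has (fun x => `[< C c1 x >]) (thin M j s)); last first.
    by rewrite /h h1 -addrA lerDl addr_ge0 ?ler0n.
  have [h2|h2] := boolP (has (fun x => `[< C c2 x >]) (thin M j s)); last first.
    by rewrite /h h2 addrAC lerDr addr_ge0 ?ler0n.
  have [h3|h3] := boolP (has (fun x => `[< C c3 x >]) (thin M j s)); last first.
    by rewrite /h h3 lerDr addr_ge0 ?ler0n.
  case: ns; have [d1 s1 e1] := hit _ h1; have [d2 s2 e2] := hit _ h2; have [d3 s3 e3] := hit _ h3.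
  have cs : symm (cut (opn w) F) by apply: cut_sym; exact: opn_sym.
  have up a b : conn (cut (opn w) F) a b -> conn (opn w) a b by apply: conn_mono => x y; exact: cut_sub.
  case: kk => k1 k2 k3; case: nn => n12 n13 n23.
  split=> //; exists F; split=> //; exists d1, d2, d3; split=> //; split.
    by split; [exact: conn_trans k1 (up _ _ e1)|exact: conn_trans k2 (up _ _ e2)|exact: conn_trans k3 (up _ _ e3)].
  split; first by split; [rewrite -(clus_eq cs e1)|rewrite -(clus_eq cs e2)|rewrite -(clus_eq cs e3)].
  split=> n'; [apply: n12|apply: n13|apply: n23].
  - by apply: conn_trans e1 (conn_trans n' (conn_sym cs e2)).
  - by apply: conn_trans e1 (conn_trans n' (conn_sym cs e3)).
  - by apply: conn_trans e2 (conn_trans n' (conn_sym cs e3)).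
have mis : (fun k => mi c1 k + mi c2 k + mi c3 k) @ \oo --> (0 : R).
  rewrite -[X in _ --> X](addr0 0) -[X in _ --> X + _](addr0 0).
  by apply: cvgD; [apply: cvgD|]; exact: mi0.
apply/cvgrPdist_le => ep ep0.
have [k _ /(_ k (leqnn k)) hk] := cvgr_le _ mis _ ep0.
exists (j + M * k)%N => // n /= nk.
by rewrite sub0r normrN ger0_norm //; apply: le_trans (bound n k nk) hk.
Qed.

(** Each vertex of the trajectory is tested with the part of the trajectory that
    starts there, which is again a walk. *)
Fixpoint unseen_sum (j : nat) (s : seq V) : R :=
  if s is x :: s' then pr mu (unseen j s x) + unseen_sum (if j is i.+1 then i else M.-1) s' else 0.

Lemma sum_unseen_le j s (S : set V) : [set` thin M j s] `<=` S ->
  \sum_(v <- undup s) pr mu (fun w => tri w setT v /\ ~ tri w S v) <= unseen_sum j s.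
Proof.
elim: s j => [|x s IH] j sS; first by rewrite big_nil.
have sS' : [set` thin M (if j is i.+1 then i else M.-1) s] `<=` S.
  move=> y ys; apply: sS => /=; case: (j) ys => [|i] //= ys.
  by rewrite inE ys orbT.
have h := IH _ sS'.
have hx : pr mu (fun w => tri w setT x /\ ~ tri w S x) <= pr mu (unseen j (x :: s) x).
  apply: pr_le; [by apply: mP_and => //; exact: mP_not|exact: munseen|].
  by move=> w [h1 h2]; split=> // h3; apply: h2; exact: trif_mono h3.
rewrite [undup _]/=; case: ifP => _; last by rewrite big_cons /=; exact: lerD.
by apply: le_trans h _; rewrite /= lerDr pr_ge0.
Qed.

(** All but the last [k0] vertices of the trajectory have at least [k0] steps left, and
    are unseen with probability at most [dl]. *)
Lemma Ew_unseen_sum dl k0 : 0 <= dl ->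
  (forall j n, (j < M)%N -> (k0 <= n)%N -> beta j n o <= dl) ->
  forall n u j, (j < M)%N -> Ew G dg n u (unseen_sum j) <= dl * n.+1%:R + (minn n.+1 k0)%:R.
Proof.
move=> dl0 hb.
have beta1 j n u : beta j n u <= 1.
  by rewrite -(Ew_cst deg dg0 n u 1); apply: Ew_le => // s _; exact: pr_le1.
have step j n u : (j < M)%N -> beta j n u <= dl + (minn n.+1 k0)%:R - (minn n k0)%:R.
  move=> jM; have [kn|nk] := leqP k0 n.
    by rewrite beta_const (minn_idPr (leqW kn)) addrK; exact: hb.
  rewrite (minn_idPl nk) -natr1; have := beta1 j n u; lra.
elim=> [|n IH] u j jM.
  rewrite /= addr0; have := step j 0%N u jM; rewrite min0n subr0 /beta /= mulr1.
  by rewrite (_ : pr mu _ = pr mu (unseen j [:: u] u)).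
rewrite (_ : Ew G dg n.+1 u (unseen_sum j) = beta j n.+1 u +
    A (fun v => Ew G dg n v (unseen_sum (if j is i.+1 then i else M.-1))) u); last first.
  rewrite /beta /= -(mkD mA); congr (avg _ _ _ u); apply/funext => v.
  by rewrite -EwD.
have jM' : ((if j is i.+1 then i else M.-1) < M)%N.
  by case: (j) jM => [_|i /ltnW //]; rewrite prednK.
have a1 : A (fun v => Ew G dg n v (unseen_sum (if j is i.+1 then i else M.-1))) u <=
    dl * n.+1%:R + (minn n.+1 k0)%:R.
  rewrite -[leRHS](Ew_cst deg dg0 1 u); apply: (mk_mono mA) => v; exact: IH.
by have := step j n.+1 u jM; rewrite -[n.+2%:R]natr1; lra.
Qed.

End Thinning.

(** The first [n] steps of the walk visit on average at least [c * n] vertices, and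
    [p * c * n] of them carry trifurcations. Sampling one time in [M], at most
    [D * n / M] of these are seen from the sampled vertices, and the expected number
    of unseen ones is at most [dl * n + k0]. For [M] large and [dl] small this
    contradicts the linear growth. *)
Lemma no_recurrent_trifurcations : False.
Proof.
set p := pr mu (fun w => tri w setT o); have pp : 0 < p by rewrite lt_def p0 pr_ge0.
have [c /andP[c0 c1] hc] := escape_pos.
have pc : 0 < p * c by exact: mulr_gt0.
(* [M] is odd because recurrence is available at odd time scales, and so large that
   [D / M] is at most a quarter of [p * c]. *)
pose M := (Num.bound (4 * D%:R / (p * c))).*2.+1.
have M_odd : odd M by rewrite /M /= odd_double.
have M0 : (0 < M)%N by [].
have MR : 0 < M%:R :> R by rewrite ltr0n.
have hM : 4 * D%:R <= p * c * M%:R.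
  rewrite [leRHS]mulrC -ler_pdivrMr //; apply: ltW.
  apply: lt_le_trans (archi_boundP _) _; first by rewrite divr_ge0 ?mulr_ge0 // ltW.
  by rewrite /M; move: (Num.bound _) => N; rewrite ler_nat; lia.
pose dl := p * c / 4; have dl0 : 0 < dl by rewrite divr_gt0.
have [k0 hk0] : exists k0, forall j n, (j < M)%N -> (k0 <= n)%N -> beta M j n o <= dl.
  suff H m : exists k0, forall j n, (j < m)%N -> (k0 <= n)%N -> beta M j n o <= dl by exact: H.
  elim: m => [|m [k hk]]; first by exists 0%N.
  have [k' _ hk'] := cvgr_le _ (beta_cvg0 M_odd m) _ dl0.
  exists (maxn k k') => j n; rewrite ltnS leq_eqVlt geq_max => /orP[/eqP -> /andP[_ h]|jm /andP[h _]].
    exact: hk'.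
  exact: hk.
have key n : p * c * n.+1%:R <= D%:R * (n.+1%:R / M%:R + 1) + (dl * n.+1%:R + k0%:R).
  apply: (@le_trans _ _ (p * Ew G dg n o (fun s => (size (undup s))%:R))).
    rewrite -mulrA ler_pM2l //; apply: Ew_range_ge => // v; by rewrite hc.
  rewrite -EwZ //; apply: (@le_trans _ _ (Ew G dg n o (fun s => D%:R * (n.+1%:R / M%:R + 1) + unseen_sum M 0 s))).
    apply: Ew_le => // s ss.
    pose S := thin M 0 s.
    have -> : p * (size (undup s))%:R = \sum_(v <- undup s) pr mu (fun w => tri w setT v).
      rewrite (eq_bigr (fun=> p)); first by rewrite big_const_seq count_predT iter_addr_0 mulr_natr.
      move=> v _; apply: (pr_trif_const (big := rec)).
        by move=> C hC; exact: (mP_recurrent R o Glf Gc deg dg0 hC).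
      by move=> g gA B; rewrite recurrent_preimage.
    have h1 : \sum_(v <- undup s) pr mu (fun w => tri w [set` S] v) <= D%:R * (n.+1%:R / M%:R + 1).
      apply: (@le_trans _ _ (D * size S)%:R); last first.
        rewrite natrM ler_pM2l ?ltr0n ?expn_gt0 //.
        rewrite -(ler_pM2l MR) mulrDr mulr1 mulrCA divff ?gt_eqF // mulr1 -natrM -natrD ler_nat.
        have := size_thin s M0; rewrite addn0 ss => h; apply: leq_trans h _.
        by rewrite leq_add2l leq_pred.
      apply: sum_pr_le => // w; rewrite (sum_ind_count (fun v w => tri w [set` S] v)) ler_nat.
      apply: (@size_trif V G Glf (opn w) r D rec) => //; first exact: opn_sym.
        by apply: filter_uniq; exact: undup_uniq.
      by move=> v; rewrite mem_filter => /andP[/asboolP].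
    apply: le_trans (lerD h1 (@sum_unseen_le M 0 s [set` S] _)); last by [].
    rewrite -big_split; apply: ler_sum => v _ /=.
    apply: le_trans (pr_or_le mu (mtri [set` S] v) _); last by apply: mP_and => //; exact: mP_not.
    apply: pr_le => //; first by apply: mP_or => //; apply: mP_and => //; exact: mP_not.
    by move=> w tw; have [h|h] := pselect (tri w [set` S] v); [left|right].
  rewrite EwD // Ew_cst // lerD2l; apply: le_trans (Ew_unseen_sum M_odd (ltW dl0) hk0 n o M0) _.
  by rewrite lerD2l ler_nat geq_minr.
pose N := Num.bound ((4 * (D%:R + k0%:R)) / (p * c)).
have hN : 4 * (D%:R + k0%:R) < p * c * N%:R.
  rewrite [ltRHS]mulrC -ltr_pdivrMr //; apply: archi_boundP.
  by rewrite divr_ge0 ?mulr_ge0 ?addr_ge0 // ltW.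
have := key N; rewrite (mulrDr D%:R) mulr1 (mulrA D%:R).
have h1 : D%:R * N.+1%:R / M%:R <= p * c / 4 * N.+1%:R.
  rewrite ler_pdivrMr // mulrAC ler_pM2r ?ltr0n //; lra.
have : p * c * N%:R <= p * c * N.+1%:R by rewrite ler_pM2l // ler_nat.
rewrite /dl in h1 *; move: hN h1; set x := p * c * N.+1%:R.
have -> : p * c / 4 * N.+1%:R = x / 4 by rewrite mulrAC.
have : 0 <= D%:R + k0%:R :> R by rewrite addr_ge0.
lra.
Qed.

End Transient.
End Trifurcations.

(** * Absence of furcations *)

Section Furcations.
Variables (R : realType) (V : pointedType) (G : sgraph V) (dg : nat) (o : V).
Hypotheses (Glf : locally_finite G) (Gc : connected_graph G) (Gt : transitive_graph G).
Hypothesis Gunim : unimodular G.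
Hypotheses (deg : forall u, degree G u = dg) (dg0 : (0 < dg)%N).
Variable mu : probability (config G) R.
Hypothesis inv : automorphism_invariant mu.
Variables (r : nat).

Local Notation sm := (small R G dg).
Let mA : markov (avg (R := R) G dg). Proof. exact: markov_avg. Qed.

Let D := ((degree G o).+1 ^ (r + r))%N.
Let size_ballD x : (size (ball G (r + r) x) <= D)%N.
Proof. exact: size_ball. Qed.

Lemma small_sub B B' : B `<=` B' -> sm B' -> sm B.
Proof.
move=> BB h v; have := finitely_antimono mA v BB; have := h v.
by have := infinitely_ge0 mA B v; rewrite /infinitely; lra.
Qed.

Lemma small_setU B B' : sm B -> sm B' -> sm (B `|` B').
Proof.
move=> h h' v; have := finitely_setU mA B B' v; have := h v; have := h' v.
by have := infinitely_ge0 mA (B `|` B') v; rewrite /infinitely; lra.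
Qed.

Lemma bernoulli (x : R) n : 0 <= x <= 1 -> 1 - n%:R * x <= (1 - x) ^+ n.
Proof.
move=> /andP[x0 x1]; elim: n => [|n IH]; first by rewrite mul0r subr0 expr0.
rewrite exprS mulrBl mul1r -natr1 mulrDl mul1r.
have y1 : (1 - x) ^+ n <= 1 by apply: exprn_ile1; lra.
by have := ler_wpM2l x0 y1; lra.
Qed.

(** Take [l = 1 - 1 / (4 * (n + 1))] and Bernoulli's inequality: [l ^+ n] is at least
    [3/4]. *)
Lemma slow_decay n : exists l : R, [/\ 0 < l, l < 1 & 3/2 <= l ^+ n * 2].
Proof.
have n0 : 0 <= n%:R :> R by [].
have m0 : 0 < 4 * (n%:R + 1) :> R by lra.
pose x : R := (4 * (n%:R + 1))^-1; have x0 : 0 < x by rewrite invr_gt0.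
have xm : 4 * (n%:R * x) + 4 * x = 1.
  by rewrite -mulrDr -[X in _ + X]mul1r -mulrDl mulrA mulfV // gt_eqF.
have nx : 0 <= n%:R * x by rewrite mulr_ge0 // ltW.
exists (1 - x); split; [lra|lra|].
have := @bernoulli x n; rewrite (ltW x0) /= => /(_ (ltac:(lra))); lra.
Qed.

Lemma growth (b c : R) : 0 < c -> exists n, b <= c * (3/2) ^+ n.
Proof.
move=> c0; exists (Num.bound (2 * (`|b| / c))).
have h n : 1 + n%:R / 2 <= (3/2 : R) ^+ n.
  elim: n => [|n IH]; first by rewrite expr0; lra.
  rewrite exprS -natr1; have n0 : 0 <= n%:R :> R by []; lra.
set N := Num.bound _; have := h N.
have : 2 * (`|b| / c) < N%:R by apply: archi_boundP; rewrite mulr_ge0 // divr_ge0 // ltW.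
move=> h1 h2; have : `|b| / c <= (3/2) ^+ N by lra.
by rewrite ler_pdivrMr // mulrC; apply: le_trans; exact: ler_norm.
Qed.

Lemma sum_fibers_le (l : R) (X : seq V) (f : V -> nat) : 0 <= l -> l < 1 ->
  (forall k, (size [seq x <- X | f x == k] <= D)%N) ->
  \sum_(x <- X) l ^+ f x <= D%:R / (1 - l).
Proof.
move=> l0 l1 hf; pose K := (\max_(x <- X) f x).+1.
have -> : \sum_(x <- X) l ^+ f x = \sum_(k < K) \sum_(x <- X) l ^+ k *+ (f x == k).
  rewrite exchange_big /=; rewrite !big_seq; apply: eq_bigr => x xX.
  have fK : (f x < K)%N by rewrite ltnS; apply: leq_bigmax_seq.
  rewrite (bigD1 (Ordinal fK)) //= eqxx mulr1n big1 ?addr0 // => k /eqP nk.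
  by case: eqP => // e; case: nk; apply: val_inj.
apply: (@le_trans _ _ (\sum_(k < K) l ^+ k * D%:R)).
  apply: ler_sum => k _; rewrite sumrMnr -[leLHS]mulr_natr ler_wpM2l ?exprn_ge0 //.
  by have := hf k; rewrite size_filter -sum1_count big_mkcond /= ler_nat.
rewrite -mulr_suml mulrC ler_wpM2l // -[leRHS]mul1r ler_pdivlMr ?subr_gt0 //.
have := subrX1 l K; have := exprn_ge0 K l0; set s := \sum_(i < K) _.
by move=> h1 h2; rewrite mulrC; lra.
Qed.

Section Weights.
Variable l : R.
Hypotheses (l0 : 0 < l) (l1 : l < 1).

Let hw u x (w : config G) := hang_weight G dg (@opn V G) r l u x w.

Let bnd_hw u x : bnd (hw u x).
Proof.
apply: (bnd_hang_weight o Glf Gc deg dg0).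
- exact: mrel_opn.
- exact: opn_sym.
- exact: small_sub.
- exact: small_setU.
- by rewrite !ltW.
Qed.

Let hw_ge0 u x w : 0 <= hw u x w.
Proof. by rewrite /hw /hang_weight; case: ifP => // _; rewrite exprn_ge0 // ltW. Qed.

Let hw_translate g (gA : aut G g) u x w : hw u x (translate gA w) = hw (g u) (g x) w.
Proof.
rewrite /hw /hang_weight /hangs.
have E1 : furcation G (opn (translate gA w)) r sm x = furcation G (opn w) r sm (g x).
  by rewrite opn_translate furcation_pull.
have E2 : below G (opn (translate gA w)) r sm x u = below G (opn w) r sm (g x) (g u).
  by rewrite opn_translate below_pull.
rewrite E1 E2; have [[fx bx]|nf] := pselect (furcation G (opn w) r sm (g x) /\ below G (opn w) r sm (g x) (g u)); last first.
  by rewrite asboolF.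
suff E : rank G (opn (translate gA w)) r sm u x = rank G (opn w) r sm (g u) (g x) by rewrite E.
have fin : finite_set [set z | between G (opn (translate gA w)) r sm u x z].
  apply: finite_between => //; [exact: opn_sym|exact: small_sub|exact: small_setU|by rewrite E1|].
  by move: bx; rewrite -E2 => -[].
by move: fin; rewrite opn_translate => fin; rewrite (rank_pull Glf gA fin).
Qed.

(** The furcations of a given rank above [o] are at most [D], and ranks are weighted
    geometrically. *)
Let out_bound (s : seq V) w : uniq s -> \sum_(x <- s) hw o x w <= D%:R / (1 - l).
Proof.
move=> us; rewrite /hw /hang_weight -big_mkcond -big_filter.
apply: sum_fibers_le => [| |k]; [exact: ltW|exact: l1|].
apply: (@size_same_rank V G Glf (opn w) r D sm _ _ _ _ o k) => //.
- exact: opn_sym.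
- exact: small_sub.
- exact: small_setU.
- by do 2 apply: filter_uniq.
by move=> x; rewrite !mem_filter => /and3P[/eqP kx /asboolP[fx bx] _].
Qed.

Let mass n w := \sum_(u <- undup (ball G n o)) hw u o w.

Let bnd_mass n : bnd (mass n).
Proof. by apply: bnd_sum => u _; exact: bnd_hw. Qed.

Let Ex_mass n : Ex mu (mass n) <= D%:R / (1 - l).
Proof.
have [Gam [Gsub Gtr Gcard]] := Gunim; have [Gaut _ _ _] := Gsub.
pose F u x := Ex mu (hw u x).
have F_inv g u x : Gam g -> F (g u) (g x) = F u x.
  move=> Gg; have gA := Gaut g Gg; rewrite /F.
  have -> : hw (g u) (g x) = fun w => hw u x (translate gA w).
    by apply/funext => w; exact: (esym (hw_translate gA u x w)).
  by apply: Ex_translate.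
have MT := @mass_transport R V G Glf Gam F o n Gsub Gtr Gcard F_inv.
rewrite /mass Ex_sum; last by move=> u _; exact: bnd_hw.
rewrite -/(F _ _) -MT /F -Ex_sum; last by move=> u _; exact: bnd_hw.
rewrite -[leRHS](Ex_cst mu); apply: Ex_le; [|exact: bnd_cst|].
  by apply: bnd_sum => u _; exact: bnd_hw.
by move=> w; apply: out_bound; exact: undup_uniq.
Qed.

(** By mass transport the expected total weight of the vertices below a furcation at
    [o] equals the expected total weight of the furcations above [o], which is
    bounded; but a furcation has infinite total weight. *)
Lemma pr_furcation_of_decay : 3/2 <= l ^+ (D + D) * 2 ->
  pr mu (fun w => furcation G (opn w) r sm o) = 0.
Proof.
move=> lD; apply: (@blow_up_null _ _ _ mu mass (D%:R / (1 - l))) => //.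
- by move=> n w; apply: sumr_ge0 => u _; exact: hw_ge0.
- move=> n w; apply: sum_le_sub; [exact: undup_uniq|exact: undup_uniq| |].
    by move=> v; rewrite !mem_undup; exact: ball_leS.
  by move=> v; exact: hw_ge0.
- by apply: (mP_furcation R o Glf Gc deg dg0); exact: mrel_opn.
move=> w fo b; have [n hn] := growth b (exprn_gt0 D l0).
have [U [uU hU]] := weight_unbounded Glf (@opn_sym V G w) small_sub small_setU size_ballD l0 (ltW l1) lD n fo.
have [N hN] := seq_in_ball Glf Gc o U.
exists N; apply: le_trans hn _; apply: le_trans hU _.
rewrite (_ : weight _ _ _ _ _ _ _ = \sum_(u <- U) hw u o w).
  apply: sum_le_sub => //; first exact: undup_uniq.
  by move=> v /hN; rewrite mem_undup.
rewrite /weight big_mkcond; apply: eq_bigr => u _; rewrite /hw /hang_weight /hangs.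
case: asboolP => bu; first by rewrite asboolT.
by rewrite asboolF // => -[].
Qed.

End Weights.

Lemma pr_furcation : pr mu (fun w => furcation G (opn w) r sm o) = 0.
Proof. by have [l [l0 l1 lD]] := slow_decay (D + D); exact: pr_furcation_of_decay lD. Qed.

End Furcations.

(** * Opening a ball *)

Section Insertion.
Variables (R : realType) (V : pointedType) (G : sgraph V) (dg : nat).
Hypotheses (Glf : locally_finite G).
Hypotheses (deg : forall u, degree G u = dg) (dg0 : (0 < dg)%N).
Variables (r : nat) (x : V) (w : config G).

Local Notation sm := (small R G dg).
Local Notation ins := (insert_edges (ball_edges r x) w).

Lemma opn_sub_insert u v : opn w u v -> opn ins u v.
Proof. by move=> uv; apply/opn_insert_ball; left. Qed.

Lemma open_ball_insert : open_ball G (opn ins) r x.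
Proof. by move=> u v ux vx uv; apply/opn_insert_ball; right. Qed.

Lemma conn_insert c : c \in ball G r x -> conn (opn ins) x c.
Proof.
move=> cx; apply: conn_mono (open_ball_conn Glf open_ball_insert cx).
by move=> u v [].
Qed.

(** Cutting in the opened ball all pairs that were not open before restores the
    configuration. *)
Lemma insert_trif big c1 c2 c3 :
  [/\ c1 \in ball G r x, c2 \in ball G r x & c3 \in ball G r x] ->
  [/\ big (clus (opn w) c1), big (clus (opn w) c2) & big (clus (opn w) c3)] ->
  [/\ ~ conn (opn w) c1 c2, ~ conn (opn w) c1 c3 & ~ conn (opn w) c2 c3] ->
  trif G (opn ins) r big setT x.
Proof.
move=> [x1 x2 x3] bb nn.
pose F := [seq e <- [seq (u, v) | u <- ball G r x, v <- ball G r x] | `[< ~ opn w e.1 e.2 >]].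
have inF u v : (u, v) \in F <-> [/\ ~ opn w u v, u \in ball G r x & v \in ball G r x].
  rewrite mem_filter; split=> [/andP[/asboolP nuv /allpairsP[[a b] /= [ax bx e]]]|[nuv ux vx]].
    by case: e ax bx => <- <-.
  by apply/andP; split; [apply/asboolP|apply/allpairsP; exists (u, v)].
have E : cut (opn ins) F = opn w.
  apply/funext => u; apply/funext => v; apply/propext; split=> [[uv uvF _]|uv].
    move: uv => /opn_insert_ball[//|[_ ux vx]]; apply: contrapT => nuv.
    by move/negP: uvF; apply; apply/inF.
  split; first exact: opn_sub_insert.
    by apply/negP => /inF[].
  by apply/negP => /inF[h _ _]; apply: h; exact: opn_sym.
split; first exact: open_ball_insert.
exists F; split; first by move=> [u v] /inF[].
exists c1, c2, c3; rewrite E; do !split => //; exact: conn_insert.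
Qed.

(** An infinite cluster meeting a finite set still has an infinite piece once
    the set is removed, the pieces being attached to finitely many vertices. *)
Lemma infinite_piece rho (B : seq V) c : symm rho -> subgr G rho -> c \in B ->
  infinite_set (clus rho c) ->
  exists a, [/\ conn rho c a, a \notin B & infinite_set (clus (avoid rho B) a)].
Proof.
move=> rs rG cB ic; apply: contrapT => h; apply: ic.
pose L := flatten [seq nbr G b | b <- B].
pose P : set V := [set a | [/\ a \in L, conn rho c a & a \notin B]].
apply: (@sub_finite_set _ _ ([set` B] `|` \bigcup_(a in P) clus (avoid rho B) a)); last first.
  rewrite finite_setU; split; first exact: finite_seq.
  apply: bigcup_finite; first by apply: (@finite_subset_seq _ _ L) => a [].
  by move=> a [_ ca aB]; apply: contrapT => ia; apply: h; exists a.
move=> t ct; have tc := conn_sym rs ct.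
suff [tB|[s [sL sB cs st]]] : t \in B \/ exists s, [/\ s \in L, s \notin B, conn rho c s & conn (avoid rho B) s t].
  by left.
  by right; exists s.
elim/conn_ind_l: t / tc ct => [|u v uv vc IH] cu; first by left.
have [uB|uB] := boolP (u \in B); first by left.
right; have [vB|vB] := boolP (v \in B).
  exists u; split=> //; last exact: conn_refl.
  by apply/flatten_mapP; exists v => //; rewrite mem_nbr //; apply: rG; exact: rs.
have [vB'|[s [sL sB cs sv]]] := IH (conn_sym rs vc); first by rewrite vB' in vB.
by exists s; split=> //; apply: conn_trans sv _; apply: conn_step; split=> //; exact: rs.
Qed.

(** Outside the ball nothing changes; inside it the three clusters are joined, so the
    new cluster contains a non-small set and the two small pieces stay cut off. *)
Lemma insert_furcation c0 c1 c2 :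
  [/\ c0 \in ball G r x, c1 \in ball G r x & c2 \in ball G r x] ->
  ~ sm (clus (opn w) c0) ->
  sm (clus (opn w) c1) /\ infinite_set (clus (opn w) c1) ->
  sm (clus (opn w) c2) /\ infinite_set (clus (opn w) c2) ->
  ~ conn (opn w) c1 c2 ->
  furcation G (opn ins) r sm x.
Proof.
move=> [x0 x1 x2] n0 [s1 i1] [s2 i2] n12.
have E : avoid (opn ins) (ball G r x) = avoid (opn w) (ball G r x).
  apply/funext => u; apply/funext => v; apply/propext.
  split=> -[uv ux vx]; split=> //; last exact: opn_sub_insert.
  by move: uv => /opn_insert_ball[//|[_]]; rewrite (negbTE ux).
have up u v : conn (opn w) u v -> conn (opn ins) u v.
  by apply: conn_mono => a b; exact: opn_sub_insert.
have piece c : c \in ball G r x -> sm (clus (opn w) c) -> infinite_set (clus (opn w) c) ->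
    exists a, [/\ below G (opn ins) r sm x a, infinite_set (branch G (opn ins) r x a) & conn (opn w) c a].
  move=> cx sc ic.
  have [a [ca ax ia]] := infinite_piece (@opn_sym V G w) (@opn_adj V G w) cx ic.
  exists a; rewrite /below /branch E; split=> //; split=> //.
    by apply: conn_trans (conn_insert cx) (up _ _ ca).
  apply: (@small_sub R V G dg deg dg0 _ _ _) sc => z az; apply: conn_trans ca _.
  by apply: conn_mono az => u v; exact: avoid_sub.
have [a1 [b1 j1 d1]] := piece _ x1 s1 i1; have [a2 [b2 j2 d2]] := piece _ x2 s2 i2.
split; first exact: open_ball_insert.
  move=> h; apply: n0; apply: (@small_sub R V G dg deg dg0 _ _ _) h => z cz.
  by apply: conn_trans (conn_insert x0) (up _ _ cz).
exists a1, a2; split=> // a12; apply: n12; apply: conn_trans d1 _.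
have os := @opn_sym V G w.
apply: conn_trans (conn_sym os d2); move: a12; rewrite /branch E.
by apply: conn_mono => u v; exact: avoid_sub.
Qed.

End Insertion.

(** * Every cluster is transient *)

Section AllSmall.
Variables (R : realType) (V : pointedType) (G : sgraph V) (dg : nat) (o : V).
Hypotheses (Glf : locally_finite G) (Gc : connected_graph G) (Gt : transitive_graph G).
Hypothesis Gunim : unimodular G.
Hypotheses (deg : forall u, degree G u = dg) (dg0 : (0 < dg)%N).
Variable mu : probability (config G) R.
Hypothesis inv : automorphism_invariant mu.
Hypothesis ins : insertion_tolerant mu.

Local Notation sm := (small R G dg).
Local Notation K w u := (clus (opn w) u).

(** The form of having infinitely many infinite clusters that is used below; its
    measurability is plain since all quantifiers are countable. *)
Definition many (w : config G) := forall s : seq V, exists v,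
  infinite_set (K w v) /\ forall u, u \in s -> ~ conn (opn w) u v.

Let mK u : mset (fun w : config G => K w u).
Proof. exact: (mset_clus o Glf Gc u (@mrel_opn V G)). Qed.

Let mconn u v : mP (fun w : config G => conn (opn w) u v).
Proof. exact: (mrel_conn o Glf Gc (@mrel_opn V G)). Qed.

Let minf u : mP (fun w : config G => infinite_set (K w u)).
Proof. exact: (mP_infinite o Glf Gc (mK u)). Qed.

Lemma mP_many : mP many.
Proof.
apply: (mP_all (enum_seq_surj o Glf Gc)) => s; apply: (mP_exV o Glf Gc) => v.
by apply: mP_and => //; apply: mP_all_seq => u; apply: mP_not; exact: mconn.
Qed.

Hypothesis many_as : pr mu (fun w => ~ many w) = 0.

Let msm u : mP (fun w : config G => sm (K w u)).
Proof. exact: (mP_small R o Glf Gc deg dg0 (mK u)). Qed.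

Let mrec u : mP (fun w : config G => recurrent R G dg (K w u)).
Proof. exact: (mP_recurrent R o Glf Gc deg dg0 (mK u)). Qed.

Let pr_or0 P Q : mP P -> mP Q -> pr mu P = 0 -> pr mu Q = 0 -> pr mu (fun w => P w \/ Q w) = 0.
Proof.
move=> mp mq p0 q0; apply/eqP; rewrite eq_le pr_ge0 andbT.
by have := pr_or_le mu mp mq; rewrite p0 q0 addr0.
Qed.

Let positive_at (E : nat -> config G -> Prop) (N B : config G -> Prop) :
  (forall k, mP (E k)) -> mP N -> mP B -> pr mu N = 0 -> pr mu B != 0 ->
  (forall w, B w -> N w \/ exists k, E k w) -> exists k, pr mu (E k) != 0.
Proof.
move=> mE mN mB N0 B0 h; apply: contrapT => nE; move/eqP: B0; apply.
have E0 k : pr mu (E k) = 0 by apply: contrapT => /eqP e; apply: nE; exists k.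
have ex0 : pr mu (fun w => exists k, E k w) = 0.
  by apply: (@pr_ex_null _ _ _ _ _ id) => // i; exists i.
apply/eqP; rewrite eq_le pr_ge0 andbT -(pr_or0 mN (mP_exn mE) N0 ex0).
apply: pr_le => //; apply: mP_or => //; exact: mP_exn.
Qed.

Let three (Q : V -> V -> V -> config G -> Prop) r w := exists c1 c2 c3,
  [/\ c1 \in ball G r o, c2 \in ball G r o & c3 \in ball G r o] /\ Q c1 c2 c3 w.

Let mthree Q r : (forall c1 c2 c3, mP (Q c1 c2 c3)) -> mP (three Q r).
Proof.
move=> mQ; do 3 (apply: (mP_exV o Glf Gc) => ?).
by apply: mP_and => //; exact: mP_cst.
Qed.

Let threeI (Q : V -> V -> V -> config G -> Prop) c1 c2 c3 w : Q c1 c2 c3 w -> exists r, three Q r w.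
Proof.
move=> q; have [r hr] := seq_in_ball Glf Gc o [:: c1; c2; c3]; exists r, c1, c2, c3; split=> //.
by split; apply: hr; rewrite !inE eqxx ?orbT.
Qed.

Let distinct c1 c2 c3 (w : config G) :=
  [/\ ~ conn (opn w) c1 c2, ~ conn (opn w) c1 c3 & ~ conn (opn w) c2 c3].

Let mdistinct c1 c2 c3 : mP (distinct c1 c2 c3).
Proof.
apply: (mP_eq (P := fun w => ~ conn (opn w) c1 c2 /\ (~ conn (opn w) c1 c3 /\ ~ conn (opn w) c2 c3))).
  by move=> w; split=> [[? []]|[]].
by do !apply: mP_and; exact: mP_not.
Qed.

Let tri (big : set V -> Prop) c1 c2 c3 (w : config G) :=
  (big (K w c1) /\ (big (K w c2) /\ big (K w c3))) /\ distinct c1 c2 c3 w.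

Let mtri (big : set V -> Prop) c1 c2 c3 : (forall u, mP (fun w : config G => big (K w u))) -> mP (tri big c1 c2 c3).
Proof. by move=> mb; do !apply: mP_and. Qed.

Let trif_pos (big : set V -> Prop) r :
  (forall C : config G -> set V, mset C -> mP (fun w => big (C w))) ->
  pr mu (three (tri big) r) != 0 ->
  pr mu (fun w => trif G (opn w) r big setT o) != 0.
Proof.
move=> mb; apply: (pr_insert_pos ins (@finite_ball_edges V G r o)).
- by apply: mthree => c1 c2 c3; apply: mtri => u; exact: mb.
- by apply: (mP_trif o Glf Gc) => //; exact: mrel_opn.
move=> w [c1 [c2 [c3 [cc [[b1 [b2 b3]] nn]]]]].
exact: (@insert_trif V G Glf r o w big c1 c2 c3).
Qed.

(** Three infinite clusters meet some fixed ball with positive probability, and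
    opening that ball makes it a trifurcation. *)
Let isoperimetry :
  exists2 e : R, 0 < e & forall L, uniq L -> e * (size L)%:R <= (size (bdry G L))%:R.
Proof.
have [r pr0] : exists r, pr mu (three (tri (fun B => infinite_set B)) r) != 0.
  apply: (positive_at (N := fun w => ~ many w) (B := fun=> True)) => //.
  - by move=> k; apply: mthree => c1 c2 c3; apply: mtri => u; exact: minf.
  - by apply: mP_not; exact: mP_many.
  - exact: mP_cst.
  - by rewrite (pr_true mu) oner_neq0.
  move=> w _; have [mw|] := pselect (many w); last by left.
  right; have [v1 [i1 _]] := mw [::]; have [v2 [i2 d2]] := mw [:: v1].
  have [v3 [i3 d3]] := mw [:: v1; v2]; apply: (threeI (c1 := v1) (c2 := v2) (c3 := v3)).
  by split=> //; split; [apply: d2|apply: d3|apply: d3]; rewrite !inE eqxx ?orbT.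
apply: (isoperimetric Glf Gc Gt inv (r := r) (o := o)).
by apply: trif_pos pr0 => C mC; exact: (mP_infinite o Glf Gc mC).
Qed.

(** Three recurrent clusters would produce recurrent trifurcations; otherwise, as
    soon as there is a recurrent cluster, there are two infinite transient ones
    besides it, and joining the three produces a furcation. *)
Theorem clusters_small : pr mu (fun w => exists u, ~ sm (K w u)) = 0.
Proof.
have [e e0 iso] := isoperimetry.
apply/eqP; apply: contrapT => /negP B0.
pose Q c0 c1 c2 (w : config G) := ~ sm (K w c0) /\ ((sm (K w c1) /\ infinite_set (K w c1)) /\
   ((sm (K w c2) /\ infinite_set (K w c2)) /\ ~ conn (opn w) c1 c2)).
have mQ c0 c1 c2 : mP (Q c0 c1 c2).
  by rewrite /Q; do !apply: mP_and => //; exact: mP_not.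
pose E r (w : config G) := three (tri (recurrent R G dg)) r w \/ three Q r w.
have m1 r : mP (three (tri (recurrent R G dg)) r).
  by apply: mthree => c1 c2 c3; apply: mtri => u; exact: mrec.
have m2 r : mP (three Q r) by exact: mthree.
pose N (w : config G) := ~ many w \/ exists u, ~ sm (K w u) /\ ~ recurrent R G dg (K w u).
have mN' : mP (fun w : config G => exists u, ~ sm (K w u) /\ ~ recurrent R G dg (K w u)).
  by apply: (mP_exV o Glf Gc) => u; apply: mP_and; exact: mP_not.
have [r] : exists r, pr mu (E r) != 0.
  apply: (positive_at (N := N) (B := fun w => exists u, ~ sm (K w u))) => //.
  - by move=> r; exact: mP_or.
  - by apply: mP_or => //; apply: mP_not; exact: mP_many.
  - by apply: (mP_exV o Glf Gc) => u; exact: mP_not.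
  - by apply: pr_or0 => //; [apply: mP_not; exact: mP_many|exact: (nonsmall_recurrent_as o Glf Gc Gunim deg dg0 inv)].
  move=> w [c0 n0]; have [nw|nw] := pselect (N w); first by left.
  right; have mw : many w by apply: contrapT => h; apply: nw; left.
  have rc u : ~ sm (K w u) -> recurrent R G dg (K w u).
    by move=> nu; apply: contrapT => nr; apply: nw; right; exists u.
  have [t|nt] := pselect (exists c1 c2 c3, tri (recurrent R G dg) c1 c2 c3 w).
    have [c1 [c2 [c3 /threeI[r hr]]]] := t; exists r; left; exact: hr.
  (* Without three of them, all non-small clusters are met by at most two vertices. *)
  have [s hs] : exists s : seq V, forall u, ~ sm (K w u) -> exists2 v, v \in s & conn (opn w) v u.
    have [[c1 [n1 c01]]|h] := pselect (exists c1, ~ sm (K w c1) /\ ~ conn (opn w) c0 c1).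
      exists [:: c0; c1] => u nu; apply: contrapT => nv; apply: nt; exists c0, c1, u.
      do !split => //; try exact: rc.
        by move=> h; apply: nv; exists c0; rewrite // inE eqxx.
      by move=> h; apply: nv; exists c1; rewrite // !inE eqxx orbT.
    exists [:: c0] => u nu; exists c0; rewrite ?inE ?eqxx //.
    by apply: contrapT => nc; apply: h; exists u.
  have smallK v : (forall u, u \in s -> ~ conn (opn w) u v) -> sm (K w v).
    by move=> h; apply: contrapT => /hs[u us]; exact: h.
  have [v1 [i1 d1]] := mw s; have [v2 [i2 d2]] := mw (v1 :: s).
  have [|r hr] := @threeI Q c0 v1 v2 w; last by exists r; right.
  split=> //; split; first by split=> //; exact: smallK.
  split; last by apply: d2; rewrite inE eqxx.
  by split=> //; apply: smallK => u us; apply: d2; rewrite inE us orbT.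
move=> pE; have [p1|p1] := eqVneq (pr mu (three (tri (recurrent R G dg)) r)) 0; last first.
  apply: (no_recurrent_trifurcations Glf Gc Gt deg dg0 inv e0 iso (r := r) (o := o)).
  by apply: trif_pos p1 => C mC; exact: (mP_recurrent R o Glf Gc deg dg0 mC).
have [p2|p2] := eqVneq (pr mu (three Q r)) 0.
  by move: pE; rewrite /E pr_or0 ?eqxx.
have := pr_furcation o Glf Gc Gt Gunim deg dg0 inv r; apply/eqP.
apply: (pr_insert_pos ins (@finite_ball_edges V G r o)) p2 => //.
  by apply: (mP_furcation R o Glf Gc deg dg0); exact: mrel_opn.
move=> w [c0 [c1 [c2 [cc [n0 [h1 [h2 n12]]]]]]].
exact: (@insert_furcation R V G dg Glf deg dg0 r o w c0 c1 c2).
Qed.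

End AllSmall.

(** * From transient clusters to finitely many visits *)

Section Visits.
Variables (R : realType) (V : pointedType) (G : sgraph V) (dg : nat) (o : V).
Hypotheses (Glf : locally_finite G) (Gc : connected_graph G).
Hypotheses (deg : forall u, degree G u = dg) (dg0 : (0 < dg)%N).

Lemma Ew_miss (C : set V) m u :
  Ew G dg m u (fun s => (~~ has (fun z => `[< C z >]) s)%:R) = miss (avg (R := R) G dg) C m.+1 u.
Proof.
elim: m u => [|m IH] u; rewrite [LHS]/= [RHS]/=.
  rewrite orbF; case: asboolP => // _; by rewrite (mk1 (markov_avg R deg dg0)).
have [Cu|nC] := pselect (C u).
  rewrite asboolT // /= (_ : (fun v => _) = fun=> 0) ?(mk0 (markov_avg R deg dg0)) //.
  by apply/funext => v; rewrite (Ew_cst deg dg0).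
rewrite asboolF // /=; congr (avg _ _ _ u); apply/funext => v; rewrite IH //=.
Qed.

Lemma Ew_drop_miss (C : set V) N m u :
  Ew G dg (N + m) u (fun s => (~~ has (fun z => `[< C z >]) (drop N s))%:R) =
  iter N (avg (R := R) G dg) (miss (avg (R := R) G dg) C m.+1) u.
Proof.
elim: N u => [|N IH] u.
  rewrite add0n -[RHS]/(miss (avg G dg) C m.+1 u) -(Ew_miss C m u); congr (Ew _ _ _ _ _); apply/funext => s; by rewrite drop0.
by rewrite addSn /=; congr (avg _ _ _ u); apply/funext => v; rewrite -IH.
Qed.

Variables (d : measure_display) (Omega : measurableType d) (P : probability Omega R).
Variables (omega : {RV P >-> config G}) (Z : {RV P >-> trajectory V}).
Hypotheses (Z_srw : simple_random_walk P G o Z) (Z_indep : independent_rv P omega Z).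

Let mu : probability (config G) R := distribution P omega.

Lemma mP_omega (B : config G -> Prop) : mP B -> mP (fun x : Omega => B (omega x)).
Proof.
by move=> mB; have := measurable_funPTI omega mB.
Qed.

Lemma mP_walk i (v : V) : mP (fun x : Omega => Z x i = v).
Proof.
have mC : measurable [set f : trajectory V | f i = v].
  by apply: sub_sigma_algebra; exists i, [set v].
by have := measurable_funPTI Z mC.
Qed.

Lemma mP_prefix n (B : seq V -> Omega -> Prop) : (forall s, mP (B s)) ->
  mP (fun x => B (mkseq (Z x) n) x).
Proof.
move=> mB; apply: (mP_eq (P := fun x => exists s, mkseq (Z x) n = s /\ B s x)).
  by move=> x; split=> [[s [-> //]]|h]; exists (mkseq (Z x) n).
apply: (mP_ex (enum_seq_surj o Glf Gc)) => s; apply: mP_and => //.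
apply: (mP_eq (P := fun x => size s = n /\ forall i, i \in iota 0 n -> Z x i = nth o s i)).
  move=> x; split=> [[ss h]|<-]; last first.
    by rewrite size_mkseq; split=> // i; rewrite mem_iota => /andP[_ iN]; rewrite nth_mkseq.
  apply: (@eq_from_nth _ o); rewrite size_mkseq // => i iN.
  by rewrite nth_mkseq // h // mem_iota.
apply: mP_and; first exact: mP_cst.
by apply: mP_all_seq => i; exact: mP_walk.
Qed.

Let pr_prefix_step k s u (v : V) : size s = k ->
  pr P (fun x => mkseq (Z x) k.+1 = rcons s u /\ Z x k.+1 = v) =
  pr P (fun x => mkseq (Z x) k.+1 = rcons s u) * srw_step R G u v.
Proof.
move=> ss; pose p := nth o (rcons (rcons s u) v).
have pk : p k = u by rewrite /p nth_rcons size_rcons ss ltnSn nth_rcons ss ltnn eqxx.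
have pk1 : p k.+1 = v by rewrite /p nth_rcons size_rcons ss ltnn eqxx.
have E1 : [set x | mkseq (Z x) k.+1 = rcons s u] = follows Z p k.
  apply/seteqP; split=> x /= h.
    move=> i ik; rewrite -(nth_mkseq o (Z x) (n := k.+1)) ?ltnS // h /p.
    by rewrite [in RHS]nth_rcons size_rcons ss ltnS ik.
  apply: (@eq_from_nth _ o); rewrite size_mkseq ?size_rcons ?ss // => i ik.
  by rewrite nth_mkseq // h // /p [in LHS]nth_rcons size_rcons ss ik.
have E2 : [set x | mkseq (Z x) k.+1 = rcons s u /\ Z x k.+1 = v] = follows Z p k.+1.
  have E1' x : (mkseq (Z x) k.+1 = rcons s u) = follows Z p k x.
    by rewrite -E1.
  apply/seteqP; split=> x /=.
    rewrite E1' => -[h e] i; rewrite leq_eqVlt => /orP[/eqP ->|]; first by rewrite pk1.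
    exact: h.
  move=> h; split; last by rewrite h ?pk1.
  by rewrite E1' => i ik; apply: h; exact: leqW.
have [_ step] := Z_srw; rewrite /pr E1 E2 step fineM; last by [].
  by rewrite pk pk1.
rewrite -E1; apply: fin_num_measure.
exact: (@mP_prefix k.+1 (fun t _ => t = rcons s u) (fun t => mP_cst _ _)).
Qed.

(** Along a fixed path the configuration keeps its law, by independence; summing
    over paths, the law of the walk reproduces [Ew]. The inequality drops the
    event that the walk does not start at [o]. *)
Lemma pr_walk (B : seq V -> config G -> Prop) n : (forall s, mP (B s)) ->
  Ew G dg n o (fun t => pr mu (B t)) <= pr P (fun x => B (mkseq (Z x) n.+1) (omega x)).
Proof.
move=> mB.
have mB' k : mP (fun x => B (mkseq (Z x) k) (omega x)).
  by apply: (@mP_prefix _ (fun s x => B s (omega x))) => s; exact: mP_omega.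
have mF k s : mP (fun x => mkseq (Z x) k = s).
  by apply: (@mP_prefix _ (fun t _ => t = s)) => t; exact: mP_cst.
suff H k s u : size s = k ->
    pr P (fun x => mkseq (Z x) k.+1 = rcons s u /\ B (mkseq (Z x) (k + n).+1) (omega x)) =
    pr P (fun x => mkseq (Z x) k.+1 = rcons s u) * Ew G dg n u (fun t => pr mu (B (s ++ t))).
  have := H 0%N [::] o erefl; rewrite /= (_ : pr P (fun x => [:: Z x 0%N] = [:: o]) = 1); last first.
    rewrite /pr (_ : [set x | _] = [set x | Z x 0%N = o]); first by rewrite Z_srw.1.
    by apply/seteqP; split=> x /= [->].
  rewrite mul1r => <-; apply: pr_le; last by move=> x [].
    by apply: mP_and; [exact: (mF 1%N)|exact: mB'].
  exact: mB'.
elim: n k s u => [|n IH] k s u ss.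
  rewrite addn0 /= cats1.
  have mA : measurable [set w | B (rcons s u) w] by exact: mB.
  have mC : measurable [set f : trajectory V | mkseq f k.+1 = rcons s u].
    rewrite (_ : [set f | _] = \bigcap_(i in [set i | (i <= k)%N]) [set f : trajectory V | f i = nth o (rcons s u) i]).
      apply: bigcap_measurable => [|i _]; first by exists 0%N.
      apply: sub_sigma_algebra.
      by exists i, [set nth o (rcons s u) i].
    apply/seteqP; split=> f /=.
      by move=> h i /= ik; rewrite -h nth_mkseq.
    move=> h; apply: (@eq_from_nth _ o); rewrite size_mkseq ?size_rcons ?ss // => i ik.
    by rewrite nth_mkseq // h.
  have := Z_indep mA mC; rewrite /pr.
  rewrite (_ : omega @^-1` _ `&` _ =
    [set x | mkseq (Z x) k.+1 = rcons s u /\ B (mkseq (Z x) k.+1) (omega x)]); last first.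
    by apply/seteqP; split=> x /= [h1 h2]; split=> //; [rewrite h2|rewrite -h1].
  move=> ->; rewrite fineM //.
    by rewrite mulrC.
    by apply: fin_num_measure; exact: mP_omega.
  by apply: fin_num_measure; exact: mF.
pose F x := mkseq (Z x) k.+1 = rcons s u.
pose E x := F x /\ B (mkseq (Z x) (k + n.+1).+1) (omega x).
have mE : mP E by apply: mP_and; [exact: mF|exact: mB'].
have un : uniq (nbr G u) by exact: nbr_uniq.
have stepF v : v \in nbr G u -> pr P (fun x => F x /\ Z x k.+1 = v) = dg%:R^-1 * pr P F.
  by move=> vu; rewrite pr_prefix_step // /srw_step -(mem_nbr Glf) vu deg mulrC.
(* The steps to neighbours already have total probability one. *)
have out0 : pr P (fun x => F x /\ Z x k.+1 \notin nbr G u) = 0.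
  have := pr_split P un (mF k.+1 (rcons s u)) (mP_walk k.+1); rewrite -/F.
  rewrite (eq_big_seq (fun=> dg%:R^-1 * pr P F)) ?big_const_seq ?count_predT; last by move=> v /stepF.
  have e : (dg%:R^-1 * pr P F) *+ dg = pr P F.
    by rewrite -[LHS]mulr_natl mulrA divff ?mul1r // pnatr_eq0 -lt0n.
  rewrite iter_addr_0 size_nbr // deg e.
  by move/eqP; rewrite -subr_eq0 opprD addrA subrr sub0r oppr_eq0 => /eqP.
have mout Q : mP Q -> mP (fun x => Q x /\ Z x k.+1 \notin nbr G u).
  move=> mq; apply: mP_and => //; apply: (mP_eq (P := fun x => forall v, v \in nbr G u -> ~ Z x k.+1 = v)).
    move=> x; split=> [h|/negP h v vs e]; first by apply/negP => /h.
    by apply: h; rewrite e.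
  by apply: mP_all_seq => v; apply: mP_not; exact: mP_walk.
rewrite -/E -/F (pr_split P un mE (mP_walk k.+1)) (_ : pr P (fun x => E x /\ _) = 0); last first.
  apply/eqP; rewrite eq_le pr_ge0 andbT -out0; apply: pr_le; [exact: mout|apply: mout; exact: mF|].
  by move=> x [[h _] h'].
rewrite addr0 (eq_big_seq (fun v => dg%:R^-1 * pr P F * Ew G dg n v (fun t => pr mu (B (s ++ u :: t))))).
  by rewrite -mulr_sumr [dg%:R^-1 * _]mulrC -mulrA.
move=> v vu; rewrite -(stepF v vu).
have := IH k.+1 (rcons s u) v; rewrite size_rcons ss => /(_ erefl).
have e x : (mkseq (Z x) k.+2 = rcons (rcons s u) v) = (F x /\ Z x k.+1 = v) :> Prop.
  apply/propext; rewrite mkseqS /F; split=> [/rcons_inj[-> ->] //|[-> ->] //].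
rewrite (_ : (fun x => _ /\ _) = (fun x => E x /\ Z x k.+1 = v)); last first.
  apply/funext => x; rewrite e /E addSnnS; apply/propext; split=> [[[? ?] ?]|[[? ?] ?]] //.
rewrite (_ : (fun x => mkseq _ _ = _) = (fun x => F x /\ Z x k.+1 = v)); last by apply/funext => x; exact: e.
by move=> ->; congr (_ * Ew _ _ _ _ _); apply/funext => t; rewrite cat_rcons.
Qed.

Let A := avg (R := R) G dg.
Let mA : markov A. Proof. exact: markov_avg. Qed.
Local Notation K w v := (clus (opn w) v).

Let mK v : mset (fun w : config G => K w v).
Proof. exact: (mset_clus o Glf Gc v (@mrel_opn V G)). Qed.

Local Notation hit v x n := (K (omega x) v (Z x n)).

Let mhit v n : mP (fun x => hit v x n).
Proof.
apply: (mP_eq (P := fun x => exists u, Z x n = u /\ K (omega x) v u)).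
  by move=> x; split=> [[u [<- //]]|h]; exists (Z x n).
apply: (mP_exV o Glf Gc) => u; apply: mP_and; first exact: mP_walk.
by apply: (@mP_omega (fun w => K w v u)); exact: mK.
Qed.

Definition finite_visits v x := exists N, forall n, (N <= n)%N -> ~ hit v x n.

Lemma mP_no_visits v N : mP (fun x => forall n, (N <= n)%N -> ~ hit v x n).
Proof.
by apply: mP_alln => n; apply: mP_imp; [exact: mP_cst|apply: mP_not; exact: mhit].
Qed.

Lemma mP_finite_visits v : mP (finite_visits v).
Proof. by apply: mP_exn => N; exact: mP_no_visits. Qed.

Let biter N v : bnd (fun w : config G => iter N A (never A (K w v)) o).
Proof.
have bn := @bfun_never R V G dg deg dg0 _ (config G) 1%N _ (mK v).
suff H u : bnd (fun w : config G => iter N A (never A (K w v)) u) by exact: H.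
elim: N u => [|N IH] u; first exact: bn.
exact: (@bfun_avg R V G dg _ (config G) (fun w : config G => iter N A (never A (K w v)))).
Qed.

(** The event is the decreasing limit of the events of no visit in [N, N + m], whose
    probabilities are given by the joint law of walk and configuration. *)
Lemma pr_no_visits v N :
  Ex mu (fun w : config G => iter N A (never A (K w v)) o) <= pr P (fun x => forall n, (N <= n)%N -> ~ hit v x n).
Proof.
pose Q m x := forall n, n \in iota N m.+1 -> ~ hit v x n.
have mQ m : mP (Q m) by apply: mP_all_seq => n; apply: mP_not; exact: mhit.
have lb m : Ex mu (fun w : config G => iter N A (never A (K w v)) o) <= pr P (Q m).
  pose B s (w : config G) : Prop := ~~ has (fun z => `[< K w v z >]) (drop N s).
  have mB s : mP (B s).
    apply: (mP_eq (P := fun w => forall z, z \in drop N s -> ~ K w v z)).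
      move=> w; split=> [h|/hasPn h z /h /negP hz Kz]; last by apply: hz; exact/asboolP.
      by apply/hasPn => z /h nz; apply/negP => /asboolP.
    by apply: mP_all_seq => z; apply: mP_not; exact: mK.
  have hB : pr P (fun x => B (mkseq (Z x) (N + m).+1) (omega x)) <= pr P (Q m).
    apply: pr_le => //.
      by apply: (@mP_prefix _ (fun s x => B s (omega x))) => s; exact: mP_omega.
    move=> x /hasPn h n; rewrite mem_iota => /andP[Nn nm] hn.
    have : Z x n \in drop N (mkseq (Z x) (N + m).+1).
      rewrite /mkseq -map_drop drop_iota add0n; apply: map_f; rewrite mem_iota Nn /=.
      by move: nm; lia.
    by move=> /h /negP; apply; exact/asboolP.
  apply: le_trans hB; apply: le_trans (pr_walk (N + m) mB).
  have [b e] := Ex_Ew dg mu (N + m) o (fun s => bnd_ind R (mB s)).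
  rewrite (_ : Ew _ _ _ _ _ = Ew G dg (N + m) o (fun s => Ex mu (ind R (B s)))); last first.
    by congr (Ew _ _ _ _ _); apply/funext => s; rewrite Ex_ind.
  rewrite -e; apply: Ex_le => // w.
  rewrite (_ : Ew _ _ _ _ _ = iter N A (miss A (K w v) m.+1) o); last first.
    rewrite -Ew_drop_miss; congr (Ew _ _ _ _ _); apply/funext => s.
    by rewrite /ind /B asboolb.
  by apply: (mk_mono (markov_iter N mA)) => x; exact: never_le_miss.
have mN := mP_no_visits v N.
have c : (fun m => Ex P (ind R (Q m))) @ \oo --> Ex P (ind R (fun x => forall n, (N <= n)%N -> ~ hit v x n)).
  apply: (Ex_lim (c := 1)) => [m|m x|x].
  - exact: bnd_ind.
  - by rewrite /ind; case: asboolP => _; rewrite ?normr1 ?normr0.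
  have [h|h] := pselect (forall n, (N <= n)%N -> ~ hit v x n).
    rewrite /ind asboolT // (_ : (fun m => _) = fun=> 1); first exact: cvg_cst.
    apply/funext => m; rewrite asboolT // => n; rewrite mem_iota => /andP[Nn _]; exact: h.
  have [n [Nn hn]] : exists n, (N <= n)%N /\ hit v x n.
    by apply: contrapT => h'; apply: h => n Nn hn; apply: h'; exists n.
  apply: cvg_near_cst; exists n => // m /= nm.
  rewrite /ind asboolF ?[in RHS]asboolF // => h'; apply: (h' n) hn.
  by rewrite mem_iota Nn /=; lia.
rewrite -Ex_ind //; apply: (ler_cvg_to (cvg_cst _) c); apply: nearW => m.
by rewrite Ex_ind.
Qed.

(** The lower bounds of [pr_no_visits] increase with [N] to the expectation of
    [finitely], which is [1] when the cluster is small. *)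
Lemma pr_finite_visits v : pr mu (fun w : config G => exists u, ~ small R G dg (K w u)) = 0 ->
  pr P (fun x => ~ finite_visits v x) = 0.
Proof.
move=> H0.
have mF := mP_finite_visits v.
have msm u : mP (fun w : config G => small R G dg (K w u)).
  exact: (mP_small R o Glf Gc deg dg0 (mK u)).
have bf : bnd (fun w : config G => finitely A (K w v) o).
  apply: (bnd_lim (F := fun N (w : config G) => iter N A (never A (K w v)) o) (c := 1)) => [N|N w|w].
  - exact: biter.
  - rewrite ger0_norm; last by apply: (iter_ge0 mA) => x; exact: never_ge0.
    by apply: (mk_le1 (markov_iter N mA)) => x; exact: never_le1.
  - exact: cvg_finitely.
have E1 : 1 <= Ex mu (fun w : config G => finitely A (K w v) o).
  apply: (@le_trans _ _ (pr mu (fun w : config G => small R G dg (K w v)))).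
    rewrite -(pr_true mu) -[leRHS]addr0 -H0.
    have mex : mP (fun w : config G => exists u, ~ small R G dg (K w u)).
      by apply: (mP_exV o Glf Gc) => u; exact: mP_not.
    apply: le_trans (pr_or_le mu (msm v) mex).
    apply: pr_le; [exact: mP_cst|exact: mP_or|move=> w _].
    by have [h|h] := pselect (small R G dg (K w v)); [left|right; exists v].
  rewrite -Ex_ind //; apply: Ex_le => //; first exact: bnd_ind.
  move=> w; rewrite /ind; case: asboolP => [h|_]; last exact: finitely_ge0.
  by have := h o; rewrite /infinitely => /eqP; rewrite subr_eq0 => /eqP <-.
have c : (fun N => Ex mu (fun w : config G => iter N A (never A (K w v)) o)) @ \oo --> Ex mu (fun w : config G => finitely A (K w v) o).
  apply: (Ex_lim (c := 1)) => [N|N w|w].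
  - exact: biter.
  - rewrite ger0_norm; last by apply: (iter_ge0 mA) => x; exact: never_ge0.
    by apply: (mk_le1 (markov_iter N mA)) => x; exact: never_le1.
  - exact: cvg_finitely.
have F1 : 1 <= pr P (finite_visits v).
  apply: le_trans E1 _; apply: (ler_cvg_to c (cvg_cst _)); apply: nearW => N.
  apply: le_trans (pr_no_visits v N) _; apply: pr_le => //; first exact: mP_no_visits.
  by move=> x h; exists N.
rewrite pr_not //; apply/eqP; rewrite subr_eq0 eq_le F1.
exact: pr_le1.
Qed.

End Visits.

(** * From the almost sure hypothesis to the conclusion *)

(** An infinite set contains a vertex other than [v], and the path to it leaves [v]. *)
Lemma degree_pos (V : pointedType) (G : sgraph V) (v : V) (C : set V) :
  locally_finite G -> connected_graph G -> infinite_set C -> (0 < degree G v)%N.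
Proof.
move=> Glf Gc iC; have [u _ uv] := infinite_notin [:: v] iC.
have [n un] := ball_connected Glf Gc v u; rewrite -size_nbr //.
case: n un => [|n]; first by move=> uv'; rewrite uv' in uv.
case/(ballSP Glf) => [e|[x vx _]]; first by rewrite e inE eqxx in uv.
by move: vx; rewrite -(mem_nbr Glf); case: (nbr G v).
Qed.

Lemma many_of_infinitely_many (V : pointedType) (G : sgraph V) (w : config G) :
  infinitely_many_infinite_clusters w -> many w.
Proof.
move=> inf s; apply: contrapT => h; apply: inf.
apply: (@sub_finite_set _ _ (cluster_of w @` [set` s])); last first.
  by apply: finite_image; exact: finite_seq.
move=> C [[v _ <-] iC]; apply: contrapT => nC; apply: h; exists v; split=> // u us uv.
by apply: nC; exists u => //; apply: clus_eq => //; exact: opn_sym.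
Qed.

Theorem theorem7p1 (R : realType) (V : pointedType) (G : sgraph V)
    (Gconn : connected_graph G) (Glf : locally_finite G)
    (Gtrans : transitive_graph G) (Gunim : unimodular G)
    (d : measure_display) (Omega : measurableType d) (P : probability Omega R)
    (omega : {RV P >-> config G})
    (omega_inv : automorphism_invariant (distribution P omega))
    (omega_ins : insertion_tolerant (distribution P omega))
    (o : V) (Z : {RV P >-> trajectory V})
    (Z_srw : simple_random_walk P G o Z)
    (Z_indep : independent_rv P omega Z)
    (omega_inf :
      \forall x \ae P, infinitely_many_infinite_clusters (omega x)) :
  \forall x \ae P, forall C : set V, clusters (omega x) C ->
    finite_set [set n : nat | C (Z x n)].
Proof.
pose mu : probability (config G) R := distribution P omega.
have deg u : degree G u = degree G o by exact: degree_const.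
have [N [mN N0 hN]] := omega_inf.
have dg0 : (0 < degree G o)%N.
  have [x xN] : exists x, ~ N x.
    apply: contrapT => h; have NT : N = setT.
      by apply/seteqP; split=> // x _; apply: contrapT => nx; apply: h; exists x.
    by have := probability_setT P; rewrite -NT N0 => /eqP; rewrite eq_sym onee_eq0.
  have inf : infinitely_many_infinite_clusters (omega x).
    by apply: contrapT => h; apply: xN; exact: hN.
  have [v [iv _]] := many_of_infinitely_many inf [::].
  exact: degree_pos Glf Gconn iv.
have mmany : mP (fun w : config G => ~ many w).
  by apply: mP_not; exact: (mP_many o Glf Gconn).
have many0 : pr mu (fun w => ~ many w) = 0.
  rewrite /pr (_ : mu _ = 0%E) //; apply/eqP; rewrite eq_le measure_ge0 andbT -N0.
  apply: (@le_measure _ _ _ P (omega @^-1` [set w | ~ many w]) N); rewrite ?inE //.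
    exact: (mP_omega omega mmany).
  by move=> x nm; apply: hN => h; apply: nm; exact: many_of_infinitely_many.
have small0 := clusters_small o Glf Gconn Gtrans Gunim deg dg0 omega_inv omega_ins many0.
have fin0 : pr P (fun x => exists v, ~ finite_visits omega Z v x) = 0.
  apply: (@pr_ex_null _ _ _ _ _ (enumV G o)).
  - exact: enumV_surj.
  - by move=> v; apply: mP_not; exact: (mP_finite_visits o Glf Gconn).
  - by move=> v; exact: (pr_finite_visits Glf Gconn deg dg0 Z_srw Z_indep v small0).
have mfin : mP (fun x => exists v, ~ finite_visits omega Z v x).
  by apply: (mP_exV o Glf Gconn) => v; apply: mP_not; exact: (mP_finite_visits o Glf Gconn).
exists [set x | exists v, ~ finite_visits omega Z v x]; split=> //.
  exact: pr_eq0.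
move=> x; apply: contra_notP => h C [v _ <-].
have [M hM] : finite_visits omega Z v x by apply: contrapT => nf; apply: h; exists v.
apply: (@finite_subset_seq _ _ (iota 0 M)) => n /= hn; rewrite mem_iota /= add0n.
by rewrite ltnNge; apply/negP => /hM.
Qed.
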